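(* Let $\mathbf{L}=\coprod_{k\geq1}\mathbf{L}_k$ be an $\mathbb{N}$-graded Lie algebra of type FP over a field $\mathbb{F}$, and let $\lambda_1,\ldots,\lambda_n\in\mathbb{C}$ be the eigenvalues of $\mathbf{L}$. Then for every $k\geq1$ $$\dim(\mathbf{L}_k)=\sum_{1\leq i\leq n}M_k(\lambda_i),$$ where $M_k(y)=\frac1k\sum_{j\mid k}\mu(k/j)\,y^j\in\mathbb{Q}[y]$ is the necklace polynomial of degree $k$ and $\mu\colon\mathbb{N}\to\mathbb{Z}$ is the Möbius function.
   Context: $\mathbb{F}$ is an arbitrary field. An $\mathbb{N}$-graded Lie algebra $\mathbf{L}=\coprod_{k\geq1}\mathbf{L}_k$ satisfies $[\mathbf{L}_n,\mathbf{L}_m]\subseteq\mathbf{L}_{n+m}$; $\mathcal{U}(\mathbf{L})$ is its universal enveloping algebra, an $\mathbb{N}_0$-graded connected algebra. $\mathbf{L}$ is of type FP if the trivial left $\mathcal{U}(\mathbf{L})$-module $\mathbb{F}$ has a projective resolution with all terms finitely generated (type FP$_\infty$) and also has a projective resolution of finite length (finite cohomological dimension). In this case $\mathbf{L}$ is finitely generated and each $\dim(\mathbf{L}_k)$ is finite. The groups $\mathrm{Ext}^{s,t}_{\mathcal{U}(\mathbf{L})}(\mathbb{F},\mathbb{F})$ are bigraded, $s$ being the homological degree and $t$ the internal degree coming from the grading. The characteristic polynomial of an $\mathbb{N}$-graded Lie algebra of type FP is $$\chi_{\mathbf{L}}(y)=\sum_{s,t\geq0}(-1)^s\dim(\mathrm{Ext}^{s,t}_{\mathcal{U}(\mathbf{L})}(\mathbb{F},\mathbb{F}))\,y^t\in\mathbb{Z}[y],$$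 which has constant term $1$. Let $n=\deg\chi_{\mathbf{L}}$. The eigenvalues of $\mathbf{L}$ are the complex numbers $\lambda_1,\dots,\lambda_n$ (listed with multiplicity) with $\chi_{\mathbf{L}}(y)=\prod_{1\leq i\leq n}(1-\lambda_iy)$. *)

(* Defs.v *)
From HB Require Import structures.
From mathcomp Require Import all_boot all_order all_algebra.
From mathcomp Require Import generic_quotient ring_quotient.
From mathcomp Require Import boolp classical_sets functions fsbigop reals.
From mathcomp Require Import complex monalg.

Set Implicit Arguments.
Unset Strict Implicit.
Unset Printing Implicit Defensive.

Import Order.TTheory GRing.Theory Num.Theory.

Local Open Scope classical_set_scope.
Local Open Scope quotient_scope.
Local Open Scope ring_scope.

(** * Gradings and dimensions *)

Definition is_grading (V : zmodType) (G : nat -> set V) : Prop :=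
  [/\ forall n, G n 0 /\ (forall x y, G n x -> G n y -> G n (x - y)),
      forall v, exists N : nat, exists2 c : nat -> V,
        (forall n, G n (c n)) & v = \sum_(n < N) c n
    & forall (N : nat) (c : nat -> V), (forall n, G n (c n)) ->
        \sum_(n < N) c n = 0 -> forall n, (n < N)%N -> c n = 0].

(* [has_dim Z B d]: the subquotient Z / B of V has dimension d, witnessed by d
   vectors of Z whose classes form a basis of Z / B.  For B = 0 this is the
   dimension of the subspace Z. *)
Definition has_dim (F : fieldType) (V : lmodType F) (Z B : set V) (d : nat) :
    Prop :=
  exists2 b : 'I_d -> V, (forall i, Z (b i)) &
    forall z, Z z -> exists! c : 'rV[F]_d, B (z - \sum_i c 0 i *: b i).

(* The dimension of Z / B; by convention 0 if Z / B is infinite-dimensional. *)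
Definition dim (F : fieldType) (V : lmodType F) (Z B : set V) : nat :=
  xget 0%N [set d | has_dim Z B d].

(** * Graded Lie algebras *)

HB.mixin Record Lmodule_isLie (F : fieldType) L of GRing.Lmodule F L := {
  bracket : L -> L -> L;
  bracket_linear_l : forall y, linear (bracket^~ y);
  bracket_linear_r : forall x, linear (bracket x);
  bracket_alt : forall x, bracket x x = 0;
  bracket_jacobi : forall x y z,
    bracket x (bracket y z) + bracket y (bracket z x)
      + bracket z (bracket x y) = 0
}.

#[short(type="lieType")]
HB.structure Definition Lie (F : fieldType) :=
  {L of Lmodule_isLie F L & GRing.Lmodule F L}.

(* The components are indexed by nat, the component of degree 0 being zero. *)
HB.mixin Record Lie_isGraded (F : fieldType) L of Lie F L := {
  homog : nat -> set L;
  homog_grading : is_grading homog;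
  homogZ : forall n (a : F) x, homog n x -> homog n (a *: x);
  homog0 : homog 0 = [set 0];
  homog_bracket : forall n m x y,
    homog n x -> homog m y -> homog (n + m) (bracket x y)
}.

#[short(type="gradedLieType")]
HB.structure Definition GradedLie (F : fieldType) :=
  {L of Lie_isGraded F L & Lie F L}.

(** * The universal enveloping algebra *)

(* The free associative algebra on the set L; the relations UeaRelD and UeaRelZ
   below turn it into the tensor algebra of the vector space L. *)
Local Notation free_algebra F L := {malg F[{fmonom L}]}.

(* HB.lock only prevents costly unfoldings during unification. *)
HB.lock Definition free_gen (F : fieldType) (L : lieType F) (x : L) :
  free_algebra F L := << fmu x >>.

(* The constant coefficient. *)
HB.lock Definition free_augm (F : fieldType) (L : lieType F)
  (a : free_algebra F L) : F := mcoeff mone a.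

Section Ideal.
Variables (F : fieldType) (L : lieType F).
Local Notation free_alg := (free_algebra F L).

Inductive uea_rel : free_alg -> Prop :=
| UeaRelD x y : uea_rel (free_gen (x + y) - (free_gen x + free_gen y))
| UeaRelZ a x : uea_rel (free_gen (a *: x) - a *: free_gen x)
| UeaRelB x y : uea_rel
    (free_gen (bracket x y) - (free_gen x * free_gen y - free_gen y * free_gen x)).

(* The two-sided ideal generated by uea_rel. *)
Inductive uea_ideal_spec : free_alg -> Prop :=
| UeaIdealRel a : uea_rel a -> uea_ideal_spec a
| UeaIdeal0 : uea_ideal_spec 0
| UeaIdealB a b : uea_ideal_spec a -> uea_ideal_spec b -> uea_ideal_spec (a - b)
| UeaIdealMl a b : uea_ideal_spec b -> uea_ideal_spec (a * b)
| UeaIdealMr a b : uea_ideal_spec a -> uea_ideal_spec (a * b).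

Definition uea_ideal : {pred free_alg} := fun a => `[< uea_ideal_spec a >].

Lemma uea_idealP a : reflect (uea_ideal_spec a) (a \in uea_ideal).
Proof. exact: asboolP. Qed.

Lemma uea_ideal_zmod_closed : zmod_closed uea_ideal.
Proof.
split=> [|a b /uea_idealP Ia /uea_idealP Ib]; apply/uea_idealP.
  exact: UeaIdeal0.
exact: UeaIdealB.
Qed.

HB.instance Definition _ :=
  GRing.isZmodClosed.Build free_alg uea_ideal uea_ideal_zmod_closed.

Definition uea : Type := {ideal_quot uea_ideal}.
HB.instance Definition _ := GRing.Zmodule.on uea.

Definition uea_repr (u : uea) : free_alg := repr (u : {ideal_quot uea_ideal}).

End Ideal.

HB.lock Definition uea_pi (F : fieldType) (L : lieType F)
  (a : free_algebra F L) : uea L := \pi_({ideal_quot uea_ideal (L := L)}) a.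

HB.lock Definition uea_mul (F : fieldType) (L : lieType F) (u v : uea L) :
  uea L := uea_pi (uea_repr u * uea_repr v).

HB.lock Definition augm (F : fieldType) (L : lieType F) (u : uea L) : F :=
  free_augm (uea_repr u).

Section Enveloping.
Variables (F : fieldType) (L : lieType F).
Local Notation free_alg := (free_algebra F L).
Local Notation uea := (uea L).
Local Notation uea_pi := (@uea_pi F L).
Local Notation uea_mul := (@uea_mul F L).
Local Notation augm := (@augm F L).

Lemma uea_piP (a b : free_alg) :
  reflect (uea_pi a = uea_pi b) (a - b \in uea_ideal (L := L)).
Proof. by rewrite Quotient.idealrBE uea_pi.unlock; apply: eqP. Qed.

Lemma uea_reprK (u : uea) : uea_pi (uea_repr u) = u.
Proof. by rewrite uea_pi.unlock reprK. Qed.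

Lemma uea_pi_is_zmod_morphism : zmod_morphism uea_pi.
Proof. by move=> a b; rewrite uea_pi.unlock; exact: raddfB. Qed.

HB.instance Definition _ :=
  GRing.isZmodMorphism.Build free_alg uea uea_pi uea_pi_is_zmod_morphism.

Lemma uea_mulE (a b : free_alg) :
  uea_mul (uea_pi a) (uea_pi b) = uea_pi (a * b).
Proof.
rewrite uea_mul.unlock; set a' := uea_repr _; set b' := uea_repr _.
have /uea_piP/uea_idealP Ia : uea_pi a' = uea_pi a by rewrite uea_reprK.
have /uea_piP/uea_idealP Ib : uea_pi b' = uea_pi b by rewrite uea_reprK.
apply/uea_piP; have -> : a' * b' - a * b = (a' - a) * b' + a * (b' - b).
  by rewrite mulrBl mulrBr addrA subrK.
by apply: rpredD; apply/uea_idealP; [apply: UeaIdealMr | apply: UeaIdealMl].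
Qed.

Lemma free_augm_gen (x : L) : free_augm (free_gen x) = 0.
Proof.
rewrite free_augm.unlock free_gen.unlock mcoeffU.
by case: eqP => // /(congr1 (@fmonom_val _)); rewrite fm1 fmU.
Qed.

Implicit Types a b : free_alg.

Lemma free_augm1 : free_augm (1 : free_alg) = 1.
Proof. by rewrite free_augm.unlock; exact: rmorph1. Qed.
Lemma free_augmZ c a : free_augm (c *: a) = c * free_augm a.
Proof. by rewrite free_augm.unlock; exact: mcoeffZ. Qed.
Lemma free_augmB a b : free_augm (a - b) = free_augm a - free_augm b.
Proof. by rewrite free_augm.unlock; exact: raddfB. Qed.
Lemma free_augmD a b : free_augm (a + b) = free_augm a + free_augm b.
Proof. by rewrite free_augm.unlock; exact: raddfD. Qed.
Lemma free_augmM a b : free_augm (a * b) = free_augm a * free_augm b.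
Proof. by rewrite free_augm.unlock; exact: rmorphM. Qed.
Lemma free_augm0 : free_augm (0 : free_alg) = 0.
Proof. by rewrite -(subrr 0) free_augmB subrr. Qed.

Lemma free_augm_rel a : uea_rel a -> free_augm a = 0.
Proof.
have E (u v : L) : free_augm (free_gen u * free_gen v) = 0.
  by rewrite free_augmM free_augm_gen mul0r.
case=> {a} [x y|c x|x y].
- by rewrite free_augmB free_augmD 3!free_augm_gen addr0 subr0.
- by rewrite free_augmB free_augmZ 2!free_augm_gen mulr0 subr0.
- rewrite free_augmB; apply/eqP; rewrite subr_eq0; apply/eqP.
  transitivity (0 : F); first exact: free_augm_gen.
  apply/esym; apply: etrans (free_augmB _ _) _.
  exact: etrans (congr2 (fun r s => r - s) (E x y) (E y x)) (subr0 0).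
Qed.

Lemma free_augm_ideal a : uea_ideal_spec a -> free_augm a = 0.
Proof.
elim=> {a} [a /free_augm_rel||a b _ Ea _ Eb|a b _ E|a b _ E] //.
- exact: free_augm0.
- by rewrite free_augmB Ea Eb subr0.
- by rewrite free_augmM E mulr0.
- by rewrite free_augmM E mul0r.
Qed.

Lemma augm_pi a : augm (uea_pi a) = free_augm a.
Proof.
rewrite augm.unlock; apply/eqP; rewrite -subr_eq0 -free_augmB.
by apply/eqP/free_augm_ideal/uea_idealP/uea_piP; exact: uea_reprK.
Qed.

Definition uea_one : uea := uea_pi 1.

Let uea_mulA : associative uea_mul.
Proof.
move=> u v w; rewrite -(uea_reprK u) -(uea_reprK v) -(uea_reprK w).
by rewrite !uea_mulE mulrA.
Qed.
Let uea_mul1 : left_id uea_one uea_mul.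
Proof. by move=> u; rewrite -(uea_reprK u) uea_mulE mul1r. Qed.
Let uea_1mul : right_id uea_one uea_mul.
Proof. by move=> u; rewrite -(uea_reprK u) uea_mulE mulr1. Qed.
Let uea_mulDl : left_distributive uea_mul +%R.
Proof.
move=> u v w; rewrite -(uea_reprK u) -(uea_reprK v) -(uea_reprK w).
by rewrite -raddfD !uea_mulE mulrDl raddfD.
Qed.
Let uea_mulDr : right_distributive uea_mul +%R.
Proof.
move=> u v w; rewrite -(uea_reprK u) -(uea_reprK v) -(uea_reprK w).
by rewrite -raddfD !uea_mulE mulrDr raddfD.
Qed.
Let uea_one_neq0 : uea_one != 0.
Proof.
apply/eqP=> /(congr1 augm)/eqP.
by rewrite -(raddf0 uea_pi) 2!augm_pi free_augm1 free_augm0 oner_eq0.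
Qed.

HB.instance Definition _ := GRing.Zmodule_isNzRing.Build uea
  uea_mulA uea_mul1 uea_1mul uea_mulDl uea_mulDr uea_one_neq0.

Lemma uea_pi_is_monoid_morphism : monoid_morphism uea_pi.
Proof. by split=> [|a b]; [|rewrite -uea_mulE]. Qed.

HB.instance Definition _ :=
  GRing.isMonoidMorphism.Build free_alg uea uea_pi uea_pi_is_monoid_morphism.

Lemma free_scale1C c (a : free_alg) : a * c%:A = c%:A * a.
Proof.
have cE : c%:A = malgC c :> free_alg by rewrite -mul_malgC mulr1.
rewrite cE !malgM_def fgmulgU fgmulUg; apply: eq_bigr => k _.
by rewrite mulm1 mul1m mulrC.
Qed.

Definition uea_scale (c : F) (u : uea) : uea := uea_pi (c%:A) * u.

Let uea_scaleA (a b : F) u : uea_scale a (uea_scale b u) = uea_scale (a * b) u.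
Proof.
apply: etrans (mulrA _ _ _) _; congr (_ * u).
transitivity (uea_pi (a%:A * b%:A)); first exact/esym/(rmorphM uea_pi).
by congr (uea_pi _); rewrite -scalerAl mul1r scalerA.
Qed.
Let uea_scale1 : left_id 1 uea_scale.
Proof. by move=> u; rewrite /uea_scale scale1r rmorph1 mul1r. Qed.
Let uea_scaleDr : right_distributive uea_scale +%R.
Proof. by move=> c u v; rewrite /uea_scale mulrDr. Qed.
Let uea_scaleDl u : {morph uea_scale^~ u : c d / c + d}.
Proof. by move=> c d; rewrite /uea_scale scalerDl raddfD mulrDl. Qed.

HB.instance Definition _ := GRing.Zmodule_isLmodule.Build F uea
  uea_scaleA uea_scale1 uea_scaleDr uea_scaleDl.

Let uea_scaleAl (c : F) (u v : uea) : c *: (u * v) = (c *: u) * v.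
Proof. exact: mulrA. Qed.

HB.instance Definition _ := GRing.Lmodule_isLalgebra.Build F uea uea_scaleAl.

Let uea_scaleAr (c : F) (u v : uea) : c *: (u * v) = u * (c *: v).
Proof.
rewrite -[LHS]/(uea_pi c%:A * (u * v)) -[c *: v]/(uea_pi c%:A * v) !mulrA.
by congr (_ * v); rewrite -(uea_reprK u) -2!(rmorphM uea_pi) free_scale1C.
Qed.

HB.instance Definition _ := GRing.Lalgebra_isAlgebra.Build F uea uea_scaleAr.

Definition uea_gen (x : L) : uea := uea_pi (free_gen x).

Lemma uea_gen_linear : linear uea_gen.
Proof.
move=> a x y; have -> : a *: uea_gen x = uea_pi (a *: free_gen x).
  by rewrite -[LHS]/(uea_pi a%:A * uea_gen x) -(rmorphM uea_pi) -scalerAl mul1r.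
rewrite /uea_gen -raddfD; apply/uea_piP.
have -> : free_gen (a *: x + y) - (a *: free_gen x + free_gen y) =
    free_gen (a *: x + y) - (free_gen (a *: x) + free_gen y)
    + (free_gen (a *: x) - a *: free_gen x).
  rewrite -addrA [- (free_gen (a *: x) + _) + _]addrC; congr (_ + _).
  by rewrite [in RHS]opprD addrACA subrr add0r opprD.
by apply: rpredD; apply/uea_idealP/UeaIdealRel; [exact: UeaRelD|exact: UeaRelZ].
Qed.

Lemma uea_gen_bracket x y :
  uea_gen (bracket x y) = uea_gen x * uea_gen y - uea_gen y * uea_gen x.
Proof.
rewrite /uea_gen -2!(rmorphM uea_pi) -raddfB; apply/uea_piP/uea_idealP/UeaIdealRel.
exact: UeaRelB.
Qed.

Lemma augm_gen x : augm (uea_gen x) = 0.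
Proof. by rewrite augm_pi free_augm_gen. Qed.

Lemma augm_is_zmod_morphism : zmod_morphism augm.
Proof.
move=> u v; rewrite -(uea_reprK u) -(uea_reprK v).
by rewrite -raddfB 3!augm_pi free_augmB.
Qed.

Lemma augm_is_monoid_morphism : monoid_morphism augm.
Proof.
split=> [|u v]; first by rewrite -(rmorph1 uea_pi) augm_pi free_augm1.
rewrite -(uea_reprK u) -(uea_reprK v).
by rewrite -(rmorphM uea_pi) 3!augm_pi free_augmM.
Qed.

HB.instance Definition _ :=
  GRing.isZmodMorphism.Build uea F augm augm_is_zmod_morphism.
HB.instance Definition _ :=
  GRing.isMonoidMorphism.Build uea F augm augm_is_monoid_morphism.

End Enveloping.

Arguments uea_gen {F L} x.

(* The trivial left module: F, on which L acts by 0. *)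
Definition triv_mod (F : fieldType) (L : lieType F) : Type := F.

Section TrivialModule.
Variables (F : fieldType) (L : lieType F).
Local Notation uea := (uea L).
Local Notation triv_mod := (triv_mod L).

HB.instance Definition _ := GRing.Zmodule.on triv_mod.

Definition triv_scale (u : uea) (x : triv_mod) : triv_mod := augm u * (x : F).

Let triv_scaleA u v x : triv_scale u (triv_scale v x) = triv_scale (u * v) x.
Proof. by rewrite /triv_scale mulrA -rmorphM. Qed.
Let triv_scale1 : left_id 1 triv_scale.
Proof. by move=> x; rewrite /triv_scale rmorph1 mul1r. Qed.
Let triv_scaleDr : right_distributive triv_scale +%R.
Proof. by move=> u x y; rewrite /triv_scale mulrDr. Qed.
Let triv_scaleDl x : {morph triv_scale^~ x : u v / u + v}.
Proof. by move=> u v; rewrite /triv_scale rmorphD mulrDl. Qed.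

HB.instance Definition _ := GRing.Zmodule_isLmodule.Build uea triv_mod
  triv_scaleA triv_scale1 triv_scaleDr triv_scaleDl.

End TrivialModule.

(* The grading of the universal enveloping algebra induced by that of L: degree
   n is spanned by the monomials x_1 ... x_r, x_i homogeneous of degree k_i,
   with k_1 + ... + k_r = n. *)
Inductive uea_homog (F : fieldType) (L : gradedLieType F) :
    nat -> uea L -> Prop :=
| UeaHomog0 n : uea_homog n 0
| UeaHomogD n u v : uea_homog n u -> uea_homog n v -> uea_homog n (u + v)
| UeaHomogZ n (a : F) u : uea_homog n u -> uea_homog n (a *: u)
| UeaHomog1 : uea_homog 0 1
| UeaHomogM k n x u : homog k x -> uea_homog n u ->
    uea_homog (k + n) (uea_gen x * u).

(** * Projective resolutions and finiteness conditions *)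

Definition projective (R : pzRingType) (P : lmodType R) : Prop :=
  forall (M N : lmodType R) (g : {linear M -> N}) (f : {linear P -> N}),
    (forall y, exists x, g x = y) ->
    exists h : {linear P -> M}, forall x, g (h x) = f x.

Definition finitely_generated (R : pzRingType) (M : lmodType R) : Prop :=
  exists (n : nat) (g : 'I_n -> M),
    forall m, exists c : 'I_n -> R, m = \sum_i c i *: g i.

Record proj_resolution (R : pzRingType) (M : lmodType R) := ProjResolution {
  res_mod :> nat -> lmodType R;
  res_diff : forall s, {linear res_mod s.+1 -> res_mod s};
  res_aug : {linear res_mod 0 -> M};
  res_projective : forall s, projective (res_mod s);
  res_aug_surj : forall m, exists x, res_aug x = m;
  res_exact0 : forall x, res_aug x = 0 <-> exists y, res_diff 0 y = x;
  res_exact : forall s x,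
    res_diff s x = 0 <-> exists y, res_diff s.+1 y = x
}.

Definition type_FP_infty (R : pzRingType) (M : lmodType R) : Prop :=
  exists P : proj_resolution M, forall s, finitely_generated (P s).

Definition finite_proj_dim (R : pzRingType) (M : lmodType R) : Prop :=
  exists (P : proj_resolution M) (N : nat),
    forall s, (N <= s)%N -> forall x : P s, x = 0.

Definition type_FP (F : fieldType) (L : lieType F) : Prop :=
  type_FP_infty (triv_mod L) /\ finite_proj_dim (triv_mod L).

(** * Bigraded Ext *)

(* A projective resolution of the trivial module by graded modules and maps of
   degree 0, the trivial module being concentrated in degree 0. *)
Record graded_resolution (F : fieldType) (L : gradedLieType F) :=
    GradedResolution {
  gres_res :> proj_resolution (triv_mod L);
  gres_homog : forall s, nat -> set (gres_res s);
  gres_grading : forall s, is_grading (@gres_homog s);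
  gres_homogM : forall s n m (u : uea L) x,
    uea_homog n u -> gres_homog m x -> gres_homog (n + m) (u *: x : gres_res s);
  gres_homog_diff : forall s n x,
    gres_homog n x -> gres_homog n (res_diff gres_res s x);
  gres_homog_aug : forall n x,
    n != 0%N -> gres_homog n x -> res_aug gres_res x = 0
}.

Section Ext.
Variables (F : fieldType) (L : gradedLieType F) (P : graded_resolution L).

(* Cochains of bidegree (s, t) are the module homomorphisms from P_s to the
   trivial module that vanish on the homogeneous elements of degree other than
   t; they are viewed in the F-vector space of all functions from P_s to F. *)
Definition cochain (s t : nat) : set (P s -> F^o) :=
  [set f | linear (f : P s -> triv_mod L) /\
           forall n x, n != t -> gres_homog n x -> f x = 0].

Definition cocycle (s t : nat) : set (P s -> F^o) :=
  [set f | cochain t f /\ forall y, f (res_diff P s y) = 0].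

Definition coboundary (s t : nat) : set (P s -> F^o) :=
  match s return set (P s -> F^o) with
  | 0 => [set 0]
  | s'.+1 => [set g | exists2 f, @cochain s' t f &
                      forall x, g x = f (res_diff P s' x)]
  end.

Definition ext_dim (s t : nat) : nat := dim (@cocycle s t) (@coboundary s t).

Definition char_term (st : nat * nat) : {poly int} :=
  ((-1) ^+ st.1 * (ext_dim st.1 st.2)%:Z) *: 'X^(st.2).

(* The sum is over the finite support of char_term. *)
Definition lie_char_poly : {poly int} :=
  \sum_(st \in [set: nat * nat]) char_term st.

End Ext.

(** * Necklace polynomials *)

(* Only meaningful for n > 0. *)
Definition moebius (n : nat) : int :=
  if all (fun p => logn p n == 1%N) (primes n) then (-1) ^+ size (primes n)
  else 0.

Definition necklace (k : nat) : {poly rat} :=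
  k%:R^-1 *: \sum_(j <- divisors k) (moebius (k %/ j))%:~R *: 'X^j.

(* Main.v *)
(* Let d_k = dim L_k, h_k = dim U(L)_k and let chi be the characteristic polynomial.
   Comparing the logarithmic derivatives of both sides of
     chi(y) = \prod_k (1 - y^k)^(d_k)
   gives \sum_i lambda_i^m = \sum_(k | m) k d_k, and the theorem is the Moebius
   inversion of this formula.  The product formula holds because both sides are
   inverse to the power series H(y) = \sum_k h_k y^k.

   For the right-hand side, let N be the lowest degree of L, let x in L_N, and let I be
   a graded ideal complementary to the line F x.  Then U(L) is the Ore extension
   U(I)[x; ad x], so that the Hilbert series of U(I) is (1 - y^N) H(y).  Iterating,
   one removes the components of L up to any given degree; no basis of U(L) of
   Poincare-Birkhoff-Witt type is needed.

   For the left-hand side, let P be a graded projective resolution of F.  The complex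
   of F-linear functionals on P has cohomology F, in degree 0.  It is filtered by the
   functionals vanishing on K P, for right ideals K of U(L); when K grows by a line of
   degree m, projectivity of P shows that the quotient is a copy, shifted by m, of the
   complex computing Ext, and Euler characteristics are additive.  The Ext groups are
   finite-dimensional, and zero in high homological degree, by comparison of P with
   the resolutions provided by type FP. *)
Require Import Defs.
From HB Require Import structures.
From mathcomp Require Import all_boot all_order all_algebra.
From mathcomp Require Import boolp classical_sets functions fsbigop reals.
From mathcomp Require Import complex.
From mathcomp Require Import finmap monalg ssrAC zify ring.

Set Implicit Arguments.
Unset Strict Implicit.
Unset Printing Implicit Defensive.

Import Order.TTheory GRing.Theory Num.Theory.
Local Open Scope classical_set_scope.
Local Open Scope ring_scope.
Local Open Scope complex_scope.

(** * Dimensions of subquotients *)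

(** The resolutions supplied by type FP carry no grading, while nothing bounds the size or the
    length of the graded resolution [P], so finiteness has to be transported. For Ext this is done
    through an ungraded homotopy, of which the part of internal degree [t] is extracted afterwards.
    For [L] it starts from the augmentation ideal: as a finitely generated left ideal it makes each
    [U(L)_n] finite-dimensional, and the lowest nonzero component of [L] embeds in [U(L)]. Only
    lowest components have to embed, because every ideal of the tower is again examined in its own
    lowest degree. Maps out of [U(L)] come from representations of [L] on explicit modules, applied
    to a chosen vector: [U(L)[X]] yields the grading, [U(I) * U(I)] the derivations, [U(I)[X]] the
    Ore extension, and [F * L] the embedding of the lowest component. The dimension of [L_k] depends
    only on coefficients up to degree [k]. Power series are therefore replaced by polynomials
    compared modulo [X^(k+1)], which keeps the tower of ideals, the filtration by right ideals and
    all products finite. *)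

Section Subspace.
Variables (F : fieldType) (V : lmodType F).
Implicit Types (Z B Y : set V).

Definition subspace Z :=
  Z 0 /\ forall (a : F) x y, Z x -> Z y -> Z (a *: x + y).

Lemma subspaceD Z x y : subspace Z -> Z x -> Z y -> Z (x + y).
Proof. by move=> [_ H] Zx Zy; rewrite -[x]scale1r; apply: H. Qed.

Lemma subspaceZ Z a x : subspace Z -> Z x -> Z (a *: x).
Proof. by move=> [Z0 H] Zx; rewrite -[_ *: _]addr0; apply: H. Qed.

Lemma subspaceN Z x : subspace Z -> Z x -> Z (- x).
Proof. by rewrite -scaleN1r; apply: subspaceZ. Qed.

Lemma subspaceB Z x y : subspace Z -> Z x -> Z y -> Z (x - y).
Proof. by move=> sZ Zx Zy; apply: subspaceD => //; apply: subspaceN. Qed.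

Lemma subspace_sum Z I (r : seq I) (P : pred I) (f : I -> V) :
  subspace Z -> (forall i, P i -> Z (f i)) -> Z (\sum_(i <- r | P i) f i).
Proof.
move=> sZ Zf; elim/big_rec: _ => [|i x Pi Zx]; first by case: sZ.
by apply: subspaceD => //; apply: Zf.
Qed.

Lemma subspace0 : subspace [set 0].
Proof. by split=> // a x y -> ->; rewrite scaler0 addr0. Qed.

(** Linearity is asked on [Z] only: coordinate maps are obtained by choice and take arbitrary values
    elsewhere. *)
Definition linear_on (W : lmodType F) Z (f : V -> W) :=
  forall a x y, Z x -> Z y -> f (a *: x + y) = a *: f x + f y.

Section LinearOn.
Variables (W : lmodType F) (Z : set V) (f : V -> W).
Hypotheses (sZ : subspace Z) (lf : linear_on Z f).

Lemma linear_on0 : f 0 = 0.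
Proof.
case: sZ => Z0 _; have := lf 1 Z0 Z0.
by rewrite !scale1r addr0 => /eqP; rewrite -subr_eq subrr => /eqP.
Qed.

Lemma linear_onD x y : Z x -> Z y -> f (x + y) = f x + f y.
Proof. by move=> Zx Zy; have := lf 1 Zx Zy; rewrite !scale1r. Qed.

Lemma linear_onZ a x : Z x -> f (a *: x) = a *: f x.
Proof.
by case: sZ => Z0 _ Zx; have := lf a Zx Z0; rewrite linear_on0 !addr0.
Qed.

Lemma linear_onB x y : Z x -> Z y -> f (x - y) = f x - f y.
Proof.
move=> Zx Zy; rewrite linear_onD //; last exact: subspaceN.
by rewrite -!scaleN1r linear_onZ.
Qed.

Lemma linear_on_sum I (r : seq I) (g : I -> V) :
  (forall i, Z (g i)) -> f (\sum_(i <- r) g i) = \sum_(i <- r) f (g i).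
Proof.
move=> Zg; elim: r => [|i r IH]; first by rewrite !big_nil linear_on0.
by rewrite !big_cons linear_onD ?IH //; apply: subspace_sum.
Qed.

End LinearOn.

Definition coordinates Z B d (c : V -> 'rV[F]_d) :=
  [/\ linear_on Z c, forall r, exists2 z, Z z & c z = r
    & forall z, Z z -> (c z = 0 <-> B z)].

(** The coefficients with respect to a basis are unique modulo [B]; uniqueness turns them into a
    function and makes this function linear on [Z]. Conversely, preimages of the unit vectors form a
    basis. *)
Lemma has_dim_coordinates Z B d : subspace Z -> subspace B ->
  has_dim Z B d <-> exists c : V -> 'rV[F]_d, coordinates Z B c.
Proof.
move=> sZ sB; split.
  move=> [b Zb Hb].
  have /choice [c Hc] : forall z, exists c : 'rV[F]_d,
     Z z -> B (z - \sum_i c 0 i *: b i) /\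
       forall r : 'rV[F]_d, B (z - \sum_i r 0 i *: b i) -> r = c.
    move=> z; have [/Hb [c [Bc uc]]|nZ] := pselect (Z z).
      by exists c => _; split=> // r Br; apply/esym/uc.
    by exists 0 => /nZ.
  have Zs (r : 'rV[F]_d) : Z (\sum_i r 0 i *: b i).
    by apply: subspace_sum => // i _; apply: subspaceZ.
  exists c; split.
  - move=> a x y Zx Zy; have Zxy : Z (a *: x + y) by apply: (proj2 sZ).
    apply/esym/(proj2 (Hc _ Zxy)).
    have -> : \sum_i (a *: c x + c y) 0 i *: b i =
       a *: \sum_i c x 0 i *: b i + \sum_i c y 0 i *: b i.
      rewrite scaler_sumr -big_split /=; apply: eq_bigr => i _.
      by rewrite !mxE scalerDl scalerA.
    rewrite opprD addrACA -scalerBr; apply: (proj2 sB).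
      by case: (Hc _ Zx).
    by case: (Hc _ Zy).
  - move=> r; exists (\sum_i r 0 i *: b i) => //.
    by apply/esym/(proj2 (Hc _ (Zs r))); rewrite subrr; case: sB.
  - move=> z Zz; case: (Hc _ Zz) => Bc uc.
    have E0 : \sum_i (0 : 'rV[F]_d) 0 i *: b i = 0.
      by rewrite big1 // => i _; rewrite mxE scale0r.
    split=> [c0|Bz].
      by move: Bc; rewrite c0 E0 subr0.
    by apply/esym/uc; rewrite E0 subr0.
move=> [c [lc sc kc]].
have /choice [b Hb] : forall i : 'I_d, exists z, Z z /\ c z = delta_mx 0 i.
  by move=> i; have [z] := sc (delta_mx 0 i); exists z.
have Zb i : Z (b i) by case: (Hb i).
exists b => // z Zz.
have Zs (r : 'rV[F]_d) : Z (\sum_i r 0 i *: b i).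
  by apply: subspace_sum => // i _; apply: subspaceZ.
have cs (r : 'rV[F]_d) : c (\sum_i r 0 i *: b i) = r.
  rewrite (linear_on_sum sZ lc) => [|i]; last exact: subspaceZ.
  rewrite [RHS]row_sum_delta; apply: eq_bigr => i _.
  by rewrite (linear_onZ sZ lc) //; case: (Hb i) => _ ->.
exists (c z); split=> [|r Br].
  by apply/kc; rewrite ?(linear_onB sZ lc) ?cs ?subrr //; apply: subspaceB.
have /kc : Z (z - \sum_i r 0 i *: b i) by apply: subspaceB.
by case=> _ /(_ Br); rewrite (linear_onB sZ lc) // cs => /subr0_eq.
Qed.

Lemma has_dim_unique Z B d d' : subspace Z -> subspace B ->
  has_dim Z B d -> has_dim Z B d' -> d = d'.
Proof.
move=> sZ sB.
suff H n n' : has_dim Z B n -> has_dim Z B n' -> (n <= n')%N.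
  by move=> h h'; apply/eqP; rewrite eqn_leq !H.
move=> /(has_dim_coordinates _ sZ sB) [c [lc sc kc]].
move=> [b' Zb' Hb'].
have /choice [b Hb] : forall i : 'I_n, exists z, Z z /\ c z = delta_mx 0 i.
  by move=> i; have [z] := sc (delta_mx 0 i); exists z.
have /choice [m Hm] : forall i : 'I_n, exists r : 'rV[F]_n',
    B (b i - \sum_j r 0 j *: b' j).
  by move=> i; have [r [Br _]] := Hb' _ (proj1 (Hb i)); exists r.
(* [M] expresses preimages of the unit vectors through the second basis, and [M'] holds the
   coordinates of the second basis. Their product is the identity of size [n], whose rank is at most
   the number [n'] of columns of [M]. *)
pose M := \matrix_i m i; pose M' := \matrix_j c (b' j).
have MM : M *m M' = 1%:M.
  apply/row_matrixP => i; rewrite row1 -(proj2 (Hb i)) row_mul mulmx_sum_row.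
  have Zs : Z (\sum_j m i 0 j *: b' j).
    by apply: subspace_sum => // j _; apply: subspaceZ.
  have Zbi := proj1 (Hb i).
  have /kc [_ /(_ (Hm i))] : Z (b i - \sum_j m i 0 j *: b' j).
    exact: subspaceB.
  rewrite (linear_onB sZ lc) // => /subr0_eq ->.
  rewrite (linear_on_sum sZ lc) => [|j]; last exact: subspaceZ.
  apply: eq_bigr => j _; by rewrite (linear_onZ sZ lc) // !rowK.
by have := mxrankM_maxl M M'; rewrite MM mxrank1 => /leq_trans; apply; apply: rank_leq_col.
Qed.

Lemma dimE Z B d : subspace Z -> subspace B -> has_dim Z B d -> Defs.dim Z B = d.
Proof.
move=> sZ sB h; apply: (has_dim_unique sZ sB _ h).
exact: (xgetPex 0%N (ex_intro _ d h)).
Qed.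

End Subspace.

Section Rows.
Variables (F : fieldType) (m : nat).

(** Among the matrices whose row space lies in [S], one of maximal rank is taken; a row of [S]
    outside its row space would increase the rank. *)
Lemma subspace_row (S : set 'rV[F]_m) : subspace S ->
  exists U : 'M[F]_m, forall r : 'rV_m, S r <-> (r <= U)%MS.
Proof.
move=> sS.
pose Q n := `[< exists U : 'M[F]_m, \rank U = n /\
  forall r : 'rV_m, (r <= U)%MS -> S r >].
have Q0 : exists n, Q n.
  exists 0%N; apply/asboolP; exists 0; split; first exact: mxrank0.
  by move=> r; rewrite submx0 => /eqP ->; case: sS.
have Qm n : Q n -> (n <= m)%N by move=> /asboolP [U [<- _]]; apply: rank_leq_row.
case: (ex_maxnP Q0 Qm) => n /asboolP [U [rU SU]] maxn; exists U => r.
split=> [Sr|]; last exact: SU.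
apply/negP => /negP nrU.
have /maxn : Q (\rank (U + r)%MS).
  apply/asboolP; exists (U + r)%MS; split=> // s /sub_addsmxP [[u v] /= ->].
  apply: subspaceD => //; first by apply: SU; apply: submxMl.
  by rewrite [v]mx11_scalar mul_scalar_mx; apply: subspaceZ.
rewrite leqNgt -rU => /negP; apply;
rewrite ltnNge; apply: contra nrU => h.
have /eqmxP E : (U == U + r)%MS.
  by rewrite -(geq_leqif (mxrank_leqif_eq (addsmxSl U r))).
by rewrite E addsmxSr.
Qed.

Lemma has_dim_row_split (S : set 'rV[F]_m) : subspace S ->
  exists e, [/\ (e <= m)%N, has_dim [set: 'rV[F]_m] S (m - e)
   & has_dim S [set 0] e].
Proof.
move=> sS; have [U SU] := subspace_row sS; exists (\rank U); split.
- exact: rank_leq_row.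
(* The square matrix [cokermx U] detects membership in the row space; passing to its column base
   removes the redundant columns and leaves exactly [m - \rank U] coordinates on the quotient. *)
- have key (r : 'rV_m) : (r <= U)%MS = (r *m col_base (cokermx U) == 0).
    rewrite submxE; apply/eqP/eqP => E; last first.
      by rewrite -[X in _ *m X]mulmx_base mulmxA E mul0mx.
    rewrite -(mulmxKp (row_base_free (cokermx U)) (r *m _)).
    by rewrite /= -(mulmxA r) mulmx_base E mul0mx.
  rewrite -mxrank_coker; apply/has_dim_coordinates => //.
  exists (fun r => r *m col_base (cokermx U)); split.
  + by move=> a x y _ _; rewrite mulmxDl scalemxAl.
  + move=> r; have /submxP [u ->] := submx_full r (col_base_full (cokermx U)).
    by exists u.
  + by move=> r _; rewrite SU key; split=> [->|/eqP].
- apply/has_dim_coordinates => //; first exact: subspace0.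
  exists (fun r => r *m pinvmx (row_base U)); split.
  + by move=> a x y _ _; rewrite mulmxDl scalemxAl.
  + move=> r; exists (r *m row_base U).
      by apply/SU; rewrite (submx_trans (submxMl _ _)) ?eq_row_base.
    by rewrite mulmxKp // row_base_free.
  + move=> r /SU; rewrite -(eq_row_base U) => rU; split=> [E|->]; last by rewrite mul0mx.
    by rewrite /= -(mulmxKpV rU) E mul0mx.
Qed.

End Rows.

Section Transfer.
Variables (F : fieldType) (V W : lmodType F).
Variables (Z B : set V) (Z' B' : set W) (f : V -> W).
Hypotheses (sZ : subspace Z) (sB' : subspace B').
Hypotheses (lf : linear_on Z f) (fZ : forall z, Z z -> Z' (f z)).
Hypotheses (fB : forall z, Z z -> (B' (f z) <-> B z)).
Hypothesis (fsurj : forall w, Z' w -> exists2 z, Z z & B' (w - f z)).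

(** [fB] and [fsurj] say that [f] induces an isomorphism from [Z / B] onto [Z' / B']. A basis is
    carried forward here, and lifted back in [has_dim_pullback]. *)
Lemma has_dim_pushforward d : has_dim Z B d -> has_dim Z' B' d.
Proof.
move=> [b Zb Hb]; exists (fun i => f (b i)) => [i|w Zw]; first exact: fZ.
have [z Zz Bwz] := fsurj Zw.
have Zs (r : 'rV[F]_d) : Z (\sum_i r 0 i *: b i).
  by apply: subspace_sum => // i _; apply: subspaceZ.
have E (r : 'rV[F]_d) : B' (w - \sum_i r 0 i *: f (b i)) <->
    B (z - \sum_i r 0 i *: b i).
  have -> : \sum_i r 0 i *: f (b i) = f (\sum_i r 0 i *: b i).
    rewrite (linear_on_sum sZ lf) => [|i]; last exact: subspaceZ.
    by apply: eq_bigr => i _; rewrite (linear_onZ sZ lf).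
  rewrite -fB ?(linear_onB sZ lf) //; last exact: subspaceB.
  split=> H.
    by rewrite -(subrKA w) addrC; apply: subspaceD; rewrite // -opprB; apply: subspaceN.
  by rewrite -(subrKA (f z)); apply: subspaceD.
have [c [Bc uc]] := Hb _ Zz; exists c; split; first exact/E.
by move=> r Br; apply: uc; apply/E.
Qed.

Lemma has_dim_pullback d : has_dim Z' B' d -> has_dim Z B d.
Proof.
move=> [b Zb Hb].
have /choice [a Ha] : forall i, exists z, Z z /\ B' (b i - f z).
  by move=> i; have [z] := fsurj (Zb i); exists z.
have Za i : Z (a i) by case: (Ha i).
exists a => // z Zz.
have Zs (r : 'rV[F]_d) : Z (\sum_i r 0 i *: a i).
  by apply: subspace_sum => // i _; apply: subspaceZ.
have E (r : 'rV[F]_d) : B' (f z - \sum_i r 0 i *: b i) <->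
    B (z - \sum_i r 0 i *: a i).
  rewrite -fB ?(linear_onB sZ lf) //; last exact: subspaceB.
  have H : B' (\sum_i r 0 i *: b i - f (\sum_i r 0 i *: a i)).
    rewrite (linear_on_sum sZ lf) => [|i]; last exact: subspaceZ.
    rewrite -sumrB; apply: subspace_sum => // i _.
    by rewrite (linear_onZ sZ lf) // -scalerBr; apply: subspaceZ => //; case: (Ha i).
  split=> H'.
    by rewrite -(subrKA (\sum_i r 0 i *: b i)); apply: subspaceD.
  rewrite -(subrKA (f (\sum_i r 0 i *: a i))); apply: subspaceD => //.
  by rewrite -opprB; apply: subspaceN.
have [c [Bc uc]] := Hb _ (fZ Zz); exists c; split; first exact/E.
by move=> r Br; apply: uc; apply/E.
Qed.

End Transfer.

Section Dimension.
Variables (F : fieldType) (V : lmodType F).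
Implicit Types (Z B Y : set V).

(** Coordinates on [Z / B] carry [Y] to a space [S] of row vectors, where row reduction splits the
    dimension; both halves are then pulled back. *)
Lemma has_dim_split Z Y B d : subspace Z -> subspace Y -> subspace B ->
  (B `<=` Y) -> (Y `<=` Z) -> has_dim Z B d ->
  exists e, [/\ (e <= d)%N, has_dim Z Y (d - e) & has_dim Y B e].
Proof.
move=> sZ sY sB BY YZ /(has_dim_coordinates _ sZ sB) [c [lc sc kc]].
pose S := [set r | exists2 y, Y y & c y = r].
have sS : subspace S.
  split; first by exists 0; [case: sY | rewrite (linear_on0 sZ lc)].
  move=> a _ _ [x Yx <-] [y Yy <-]; exists (a *: x + y); first exact: (proj2 sY).
  by rewrite lc //; apply: YZ.
have [e [le h1 h2]] := has_dim_row_split sS; exists e; split=> //.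
- apply: (has_dim_pullback (f := c)) h1 => //.
    move=> z Zz; split=> [[y Yy E]|Yz]; last by exists z.
    have Zy := YZ _ Yy.
    rewrite -(subrK y z); apply: subspaceD => //; apply: BY; apply/kc.
      exact: subspaceB.
    by rewrite (linear_onB sZ lc) // E subrr.
  by move=> w _; have [z Zz <-] := sc w; exists z; rewrite ?subrr //; case: sS.
- apply: (has_dim_pullback (f := c)) h2 => //.
  + exact: subspace0.
  + by move=> a x y Yx Yy; apply: lc; apply: YZ.
  + by move=> y Yy; exists y.
  + by move=> y Yy; apply: kc; apply: YZ.
  + by move=> w [y Yy <-]; exists y; rewrite ?subrr.
Qed.

Lemma has_dim_add Z Y B d e : subspace Z -> subspace Y -> subspace B ->
  (B `<=` Y) -> (Y `<=` Z) -> has_dim Z Y d -> has_dim Y B e ->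
  has_dim Z B (d + e).
Proof.
move=> sZ sY sB BY YZ /[dup] h /(has_dim_coordinates _ sZ sY) [c [lc sc kc]].
move=> /(has_dim_coordinates _ sY sB) [c' [lc' sc' kc']].
apply/has_dim_coordinates => //.
have /choice [b Hb] : forall i : 'I_d, exists z, Z z /\ c z = delta_mx 0 i.
  by move=> i; have [z] := sc (delta_mx 0 i); exists z.
have Zb i : Z (b i) by case: (Hb i).
pose s (r : 'rV[F]_d) := \sum_i r 0 i *: b i.
have Zs r : Z (s r).
  by apply: subspace_sum => // i _; apply: subspaceZ.
have cs r : c (s r) = r.
  rewrite (linear_on_sum sZ lc) => [|i]; last exact: subspaceZ.
  rewrite [RHS]row_sum_delta; apply: eq_bigr => i _.
  by rewrite (linear_onZ sZ lc) //; case: (Hb i) => _ ->.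
have sD a r r' : s (a *: r + r') = a *: s r + s r'.
  rewrite /s scaler_sumr -big_split; apply: eq_bigr => i _.
  by rewrite !mxE scalerDl scalerA.
have Yp z : Z z -> Y (z - s (c z)).
  move=> Zz; apply/kc; first exact: subspaceB.
  by rewrite (linear_onB sZ lc) // cs subrr.
(* [s] is a linear section of [c], so [z - s (c z)] lies in [Y] and has coordinates modulo [B]. *)
exists (fun z => row_mx (c z) (c' (z - s (c z)))); split.
- move=> a x y Zx Zy; rewrite lc // sD opprD addrACA -scalerBr lc'; last first.
  + exact: Yp.
  + exact: Yp.
  by rewrite scale_row_mx add_row_mx.
- move=> r; have [y Yy Ey] := sc' (rsubmx r).
  have Zy := YZ _ Yy.
  exists (s (lsubmx r) + y); first exact: subspaceD.
  have -> : c (s (lsubmx r) + y) = lsubmx r.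
    rewrite (linear_onD lc) // cs.
    by have /(kc _ Zy) -> := Yy; rewrite addr0.
  by rewrite addrC addKr Ey hsubmxK.
- move=> z Zz; have s0 : s 0 = 0.
    by rewrite /s big1 // => i _; rewrite mxE scale0r.
  split=> [/eqP|Bz].
    rewrite -[0]row_mx0 => /eqP /eq_row_mx [c0].
    by rewrite c0 s0 subr0 => /kc'; apply; apply/kc.
  have -> : c z = 0 by apply/kc => //; apply: BY.
  have -> : c' (z - s 0) = 0 by rewrite s0 subr0; apply/kc' => //; apply: BY.
  by rewrite row_mx0.
Qed.

Lemma has_dim_self Z B : subspace B -> (Z `<=` B) -> has_dim Z B 0.
Proof.
move=> sB ZB; exists (fun=> 0); first by case.
move=> z Zz; exists 0; split=> [|r _]; last by apply/rowP; case.
by rewrite big_ord0 subr0; apply: ZB.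
Qed.

Lemma has_dim0 Z B : has_dim Z B 0 -> Z `<=` B.
Proof. by move=> [b _ H] z /H [c [+ _]]; rewrite big_ord0 subr0. Qed.

End Dimension.

Lemma has_dim_row (F : fieldType) m : has_dim [set: 'rV[F]_m] [set 0] m.
Proof.
by apply/has_dim_coordinates => //; [apply: subspace0 | exists id; split=> // r; exists r].
Qed.

Section Finite.
Variables (F : fieldType) (V : lmodType F).
Implicit Types (Z B : set V).

(** Since the kernel of [c] on [Z] lies in [B], the quotient [Z / B] is isomorphic to the quotient
    of the images of [Z] and [B], two spaces of row vectors. *)
Lemma has_dim_finite m (c : V -> 'rV[F]_m) Z B :
  subspace Z -> subspace B -> (B `<=` Z) -> linear_on Z c ->
  (forall z, Z z -> c z = 0 -> B z) -> exists d, has_dim Z B d.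
Proof.
move=> sZ sB BZ lc kc.
have sIm Y : subspace Y -> Y `<=` Z -> subspace [set r | exists2 y, Y y & c y = r].
  move=> sY YZ; split; first by exists 0; [case: sY | rewrite (linear_on0 sZ lc)].
  move=> a _ _ [x Yx <-] [y Yy <-]; exists (a *: x + y); first exact: (proj2 sY).
  by rewrite lc //; apply: YZ.
have s1 := sIm _ sZ (fun _ => id); have s2 := sIm _ sB BZ.
set S1 := (X in subspace X) in s1; set S2 := (X in subspace X) in s2.
have [d [_ _]] := has_dim_row_split s1.
have S20 : [set 0] `<=` S2 by move=> _ ->; case: s2.
have S21 : S2 `<=` S1 by move=> _ [y By <-]; exists y => //; apply: BZ.
move=> /(has_dim_split s1 s2 (subspace0 _) S20 S21) [e [_ h _]].
exists (d - e)%N; apply: (has_dim_pullback (f := c)) h => //.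
- by move=> z Zz; exists z.
- move=> z Zz; split=> [[y By E]|Bz]; last by exists z.
  rewrite -(subrK y z); apply: subspaceD => //; have Zy := BZ _ By; apply: kc.
    exact: subspaceB.
  by rewrite (linear_onB sZ lc) // E subrr.
- by move=> _ [z Zz <-]; exists z; rewrite ?subrr //; case: s2.
Qed.

Lemma has_dim_span m (g : 'I_m -> V) Z : subspace Z ->
  (forall z, Z z -> exists r : 'rV[F]_m, z = \sum_i r 0 i *: g i) ->
  exists d, has_dim Z [set 0] d.
Proof.
move=> sZ gZ.
pose f (r : 'rV[F]_m) := \sum_i r 0 i *: g i.
have lf a r r' : f (a *: r + r') = a *: f r + f r'.
  rewrite /f scaler_sumr -big_split; apply: eq_bigr => i _.
  by rewrite !mxE scalerDl scalerA.
have f0 : f 0 = 0 by rewrite /f big1 // => i _; rewrite mxE scale0r.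
have sf Y : subspace Y -> subspace [set r | Y (f r)].
  move=> [Y0 YD]; split=> [|a x y Yx Yy] /=; first by rewrite f0.
  by rewrite lf; apply: YD.
have s1 := sf _ sZ; have s2 := sf _ (subspace0 V).
have [d [_ _]] := has_dim_row_split s1.
have h1 : [set 0] `<=` [set r | [set 0] (f r)] by move=> _ ->.
have h2 : [set r | [set 0] (f r)] `<=` [set r | Z (f r)].
  by move=> r /= ->; case: sZ.
move=> /(has_dim_split s1 s2 (subspace0 _) h1 h2) [e [_ h _]].
exists (d - e)%N; apply: (has_dim_pushforward (f := f)) h => //.
  exact: subspace0.
move=> z Zz; have [r E] := gZ _ Zz; have Er : f r = z by [].
by exists r; rewrite /= Er ?subrr.
Qed.

End Finite.

Section RawLinear.
Variables (R : pzRingType) (V W : lmodType R) (f : V -> W).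
Hypothesis lf : linear f.

Let g : {linear V -> W} := HB.pack f (GRing.isLinear.Build R V W *:%R f lf).

Lemma lin0 : f 0 = 0. Proof. exact: (raddf0 g). Qed.
Lemma linD x y : f (x + y) = f x + f y. Proof. exact: (raddfD g). Qed.
Lemma linB x y : f (x - y) = f x - f y. Proof. exact: (raddfB g). Qed.
Lemma linZ a x : f (a *: x) = a *: f x. Proof. exact: (linearZ_LR g). Qed.
Lemma linsum I (r : seq I) (P : pred I) (h : I -> V) :
  f (\sum_(i <- r | P i) h i) = \sum_(i <- r | P i) f (h i).
Proof. exact: (raddf_sum g). Qed.

End RawLinear.

(** * Gradings and representations of Lie algebras *)

Section Projections.

(** [is_grading] only asserts that decompositions exist and are independent; later arguments compute
    with the component maps [p n]. *)
Record projections (V : zmodType) (G : nat -> set V) (p : nat -> V -> V) :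
    Prop := {
  proj_in : forall n v, G n (p n v);
  projB : forall n u v, p n (u - v) = p n u - p n v;
  proj_id : forall n v, G n v -> p n v = v;
  proj_ne : forall n m v, G n v -> m != n -> p m v = 0;
  proj_sum : forall v, exists N : nat, v = \sum_(n < N) p n v
}.

Section Theory.
Variables (V : zmodType) (G : nat -> set V) (p : nat -> V -> V).
Hypothesis (hp : projections G p).

Lemma proj0 n : p n 0 = 0.
Proof. by rewrite -[X in p n X](subrr 0) (projB hp) subrr. Qed.

Lemma projN n v : p n (- v) = - p n v.
Proof. by rewrite -sub0r (projB hp) proj0 sub0r. Qed.

Lemma projD n u v : p n (u + v) = p n u + p n v.
Proof. by rewrite -{1}[v]opprK (projB hp) projN opprK. Qed.

Lemma proj_bigsum n I (r : seq I) (P : pred I) (f : I -> V) :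
  p n (\sum_(i <- r | P i) f i) = \sum_(i <- r | P i) p n (f i).
Proof.
elim/big_rec2: _ => [|i x y _ <-]; first exact: proj0.
by rewrite projD.
Qed.

Lemma projK n m v : p n (p m v) = if n == m then p n v else 0.
Proof.
have [->|nm] := eqVneq n m; first by rewrite (proj_id hp) //; apply: (proj_in hp).
by rewrite (proj_ne hp (n := m)) //; apply: (proj_in hp).
Qed.

Lemma proj_eq u v : (forall n, p n u = p n v) -> u = v.
Proof.
move=> E; apply/eqP; rewrite -subr_eq0; apply/eqP.
have [N ->] := proj_sum hp (u - v).
by rewrite big1 // => i _; rewrite (projB hp) E subrr.
Qed.

Lemma proj_large v : exists N : nat, forall n, (N <= n)%N -> p n v = 0.
Proof.
have [N E] := proj_sum hp v; exists N => n Nn.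
rewrite E proj_bigsum big1 // => i _; rewrite projK.
by rewrite gtn_eqF // (leq_trans (ltn_ord i)).
Qed.

Lemma proj_sum_le v N : (forall n, (N <= n)%N -> p n v = 0) ->
  v = \sum_(n < N) p n v.
Proof.
move=> vN; apply: (proj_eq) => n; rewrite proj_bigsum.
have [nN|Nn] := ltnP n N.
  rewrite (bigD1 (Ordinal nN)) //= projK eqxx big1 ?addr0 // => i ni.
  by rewrite projK ifF //; apply/negbTE; rewrite eq_sym.
rewrite vN // big1 // => i _; rewrite projK gtn_eqF //.
exact: leq_trans (ltn_ord i) Nn.
Qed.

End Theory.

Lemma grading_projections (V : zmodType) (G : nat -> set V) :
  is_grading G -> exists p, projections G p.
Proof.
move=> [Gsub Gsum Gindep].
have G0 n : G n 0 by case: (Gsub n).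
have GB n x y : G n x -> G n y -> G n (x - y) by move=> *; apply: (proj2 (Gsub n)).
have /choice [N HN] := Gsum; have /choice [c Hc] : forall v,
    exists c : nat -> V, (forall n, G n (c n)) /\ v = \sum_(n < N v) c n.
  by move=> v; have [c] := HN v; exists c.
have cut N' M (f : nat -> V) : (N' <= M)%N ->
    \sum_(n < N') f n = \sum_(n < M) if (n < N')%N then f n else 0.
  by move=> h; rewrite (big_ord_widen _ f h) big_mkcond.
pose p n v := if (n < N v)%N then c v n else 0.
have Gp n v : G n (p n v) by rewrite /p; case: ifP => // _; case: (Hc v).
(* Two decompositions are padded with zeros to the common length [K], and independence is applied to
   their difference. Additivity and the values on homogeneous elements then follow by exhibiting a
   decomposition. *)
have uniq_p v M (e : nat -> V) : (forall n, G n (e n)) -> v = \sum_(n < M) e n ->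
    forall n, p n v = if (n < M)%N then e n else 0.
  move=> Ge Ev n; pose K := maxn (N v) M.
  have [nK|Kn] := ltnP n K; last first.
    by move: Kn; rewrite geq_max /p !ltnNge => /andP[-> ->].
  apply/subr0_eq; apply: (Gindep K (fun n => p n v - if (n < M)%N then e n else 0)) => //.
    by move=> m; apply: GB => //; case: ifP.
  rewrite sumrB /p -(cut _ _ (c v)) ?leq_maxl // -(cut _ _ e) ?leq_maxr //.
  by rewrite -Ev -(proj2 (Hc v)) subrr.
have Ep v : v = \sum_(n < N v) p n v.
  rewrite {1}(proj2 (Hc v)); apply: eq_bigr => i _; by rewrite /p ltn_ord.
exists p; split=> //.
- move=> n u v; pose K := maxn (N u) (N v).
  rewrite (uniq_p _ K (fun n => p n u - p n v)).
  + case: ltnP => // Kn; rewrite /p !ifF ?subrr //; apply/negbTE; rewrite -leqNgt.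
      exact: leq_trans (leq_maxr _ _) Kn.
    exact: leq_trans (leq_maxl _ _) Kn.
  + by move=> m; apply: GB.
  + rewrite sumrB {1}(Ep u) {1}(Ep v) (cut _ K (p^~ u)) ?leq_maxl // (cut (N v) K (p^~ v)) ?leq_maxr //.
    by congr (_ - _); apply: eq_bigr => i _; rewrite /p; case: (i < N _)%N.
- move=> n v Gv; rewrite (uniq_p _ n.+1 (fun m => if m == n then v else 0)).
  + by rewrite ltnSn eqxx.
  + by move=> m; case: eqP => // ->.
  + rewrite big_ord_recr /= eqxx big1 ?add0r // => i _.
    by rewrite ltn_eqF.
- move=> n m v Gv mn; rewrite (uniq_p _ n.+1 (fun m => if m == n then v else 0)).
  + by rewrite (negbTE mn) if_same.
  + by move=> k; case: eqP => // ->.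
  + rewrite big_ord_recr /= eqxx big1 ?add0r // => i _.
    by rewrite ltn_eqF.
- by move=> v; exists (N v).
Qed.

Section Shift.
Variables (V W : zmodType) (G : nat -> set V) (H : nat -> set W).
Variables (p : nat -> V -> V) (q : nat -> W -> W) (f : V -> W) (k : nat).
Hypotheses (hp : projections G p) (hq : projections H q).
Hypothesis fB : zmod_morphism f.
Hypothesis fG : forall n v, G n v -> H (k + n)%N (f v).

Let f_sum I (r : seq I) (P : pred I) (g : I -> V) :
  f (\sum_(i <- r | P i) g i) = \sum_(i <- r | P i) f (g i).
Proof.
have f0 : f 0 = 0 by rewrite -(subrr 0) fB subrr.
elim/big_rec2: _ => [//|i x y _ <-].
by rewrite -{1}[y]opprK fB -[- y]sub0r fB f0 sub0r opprK.
Qed.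

Lemma proj_shift n v : q (k + n) (f v) = f (p n v).
Proof.
have [N vN] := proj_large hp v; pose M := maxn N n.+1.
have E : v = \sum_(i < M) p i v.
  by apply: (proj_sum_le hp) => // i Mi; apply: vN; apply: leq_trans (leq_maxl _ _) Mi.
rewrite {1}E f_sum (proj_bigsum hq).
have nM : (n < M)%N by apply: leq_maxr.
rewrite (bigD1 (Ordinal nM)) //= (proj_id hq); last by apply: fG; apply: (proj_in hp).
rewrite big1 ?addr0 // => i ni.
apply: (proj_ne hq (n := (k + i)%N)); first by apply: fG; apply: (proj_in hp).
by rewrite eqn_add2l eq_sym.
Qed.

Lemma proj_shift_lt m v : (m < k)%N -> q m (f v) = 0.
Proof.
move=> mk; have [N E] := proj_sum hp v.
rewrite E f_sum (proj_bigsum hq) big1 // => i _.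
apply: (proj_ne hq (n := (k + i)%N)); first by apply: fG; apply: (proj_in hp).
by rewrite ltn_eqF // (leq_trans mk) // leq_addr.
Qed.

End Shift.

End Projections.

(** * Extending representations of a Lie algebra to its enveloping algebra *)

Section Representation.
Variables (F : fieldType) (L : lieType F) (V : lmodType F).
Variable rho : L -> V -> V.
Hypotheses (rho_r : forall x, linear (rho x)) (rho_l : forall v, linear (rho^~ v)).
Hypothesis rho_bracket : forall x y v,
  rho (bracket x y) v = rho x (rho y v) - rho y (rho x v).
Local Notation free_alg := {malg F[{fmonom L}]}.

Definition word_act (m : {fmonom L}) (v : V) : V := foldr rho v m.

Definition free_act (a : free_alg) (v : V) : V :=
  \sum_(m <- msupp a) mcoeff m a *: word_act m v.

Lemma free_actEw (a : free_alg) (d : {fset {fmonom L}}) v :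
  (msupp a `<=` d)%fset -> free_act a v = \sum_(m <- d) mcoeff m a *: word_act m v.
Proof.
move=> le; rewrite /free_act (big_fset_incl _ le) //= => i _ /mcoeff_outdom ->.
by rewrite scale0r.
Qed.

Lemma free_act_linear_l v : linear (free_act^~ v).
Proof.
move=> c a b.
pose d := (msupp a `|` msupp b `|` msupp (c *: a + b))%fset.
have ha : (msupp a `<=` d)%fset by rewrite /d -fsetUA fsubsetUl.
have hb : (msupp b `<=` d)%fset by rewrite /d fsubsetU // fsubsetUr.
rewrite (free_actEw _ ha) (free_actEw _ hb) (@free_actEw _ d) ?fsubsetUr //.
rewrite scaler_sumr -big_split; apply: eq_bigr => m _ /=.
by rewrite mcoeffD mcoeffZ scalerDl scalerA.
Qed.

Lemma word_act_linear m : linear (word_act m).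
Proof.
rewrite /word_act; elim: (m : seq L) => [|x s IH] c u v //=.
by rewrite IH rho_r.
Qed.

Lemma free_act_linear_r a : linear (free_act a).
Proof.
move=> c u v; rewrite /free_act scaler_sumr -big_split; apply: eq_bigr => m _ /=.
by rewrite word_act_linear scalerDr !scalerA mulrC.
Qed.

Lemma free_actU c m v : free_act << c *g m >> v = c *: word_act m v.
Proof.
rewrite (@free_actEw _ [fset m]%fset) ?msuppU_le // big_seq_fset1.
by rewrite mcoeffUU.
Qed.

Lemma free_actM a b v : free_act (a * b) v = free_act a (free_act b v).
Proof.
rewrite malgME.
have -> : free_act a (free_act b v) = \sum_(k1 <- msupp a) \sum_(k2 <- msupp b)
    (mcoeff k1 a * mcoeff k2 b) *: word_act (mmul k1 k2) v.
  rewrite {1}/free_act; apply: eq_bigr => k1 _.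
  rewrite /free_act.
  have -> : word_act k1 (\sum_(m <- msupp b) mcoeff m b *: word_act m v) =
      \sum_(m <- msupp b) mcoeff m b *: word_act (mmul k1 m) v.
    rewrite (linsum (word_act_linear k1)); apply: eq_bigr => m _.
    by rewrite (linZ (word_act_linear k1)) /word_act fmM foldr_cat.
  by rewrite scaler_sumr; apply: eq_bigr => m _; rewrite scalerA.
rewrite (linsum (free_act_linear_l v)); apply: eq_bigr => k1 _.
rewrite (linsum (free_act_linear_l v)); apply: eq_bigr => k2 _.
by rewrite free_actU.
Qed.

Lemma free_act1 v : free_act 1 v = v.
Proof. by rewrite free_actU scale1r /word_act fm1. Qed.

Lemma free_act_gen x v : free_act (free_gen x) v = rho x v.
Proof. by rewrite free_gen.unlock free_actU scale1r /word_act fmU. Qed.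

Lemma free_act_ideal a v : uea_ideal_spec a -> free_act a v = 0.
Proof.
move=> Ia; elim: Ia v => {a} [_ [x y|k x|x y]||a b _ Ea _ Eb|a b _ E|a b _ E] v;
  have lv := free_act_linear_l v.
- by rewrite (linB lv) (linD lv) !free_act_gen (linD (rho_l v)) subrr.
- by rewrite (linB lv) (linZ lv) !free_act_gen (linZ (rho_l v)) subrr.
- rewrite (linB lv) (linB lv) (free_actM (free_gen x)) (free_actM (free_gen y)).
  by rewrite !free_act_gen rho_bracket subrr.
- exact: lin0 lv.
- by rewrite (linB lv) Ea Eb subrr.
- by rewrite free_actM E (lin0 (free_act_linear_r _)).
- by rewrite free_actM E.
Qed.

Definition uea_act (u : uea L) (v : V) : V := free_act (uea_repr u) v.

Lemma uea_act_pi a v : uea_act (uea_pi a) v = free_act a v.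
Proof.
apply/eqP; rewrite -subr_eq0; apply/eqP.
rewrite -(linB (free_act_linear_l v)).
by apply/free_act_ideal/uea_idealP/uea_piP; exact: uea_reprK.
Qed.

Lemma uea_act1 v : uea_act 1 v = v.
Proof. by rewrite -[1](rmorph1 (@uea_pi F L)) uea_act_pi free_act1. Qed.

Lemma uea_actM u w v : uea_act (u * w) v = uea_act u (uea_act w v).
Proof.
rewrite -(uea_reprK u) -(uea_reprK w) -(rmorphM (@uea_pi F L)) !uea_act_pi.
exact: free_actM.
Qed.

Lemma uea_act_gen x v : uea_act (uea_gen x) v = rho x v.
Proof. by rewrite uea_act_pi free_act_gen. Qed.

Lemma uea_act_linear_l v : linear (uea_act^~ v).
Proof.
move=> c u w; rewrite -(uea_reprK u) -(uea_reprK w).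
have -> : c *: uea_pi (uea_repr u) = uea_pi (c *: uea_repr u).
  rewrite -[LHS]/(uea_pi c%:A * uea_pi _) -(rmorphM (@uea_pi F L)).
  by rewrite -scalerAl mul1r.
rewrite -(raddfD (@uea_pi F L)) !uea_act_pi.
exact: free_act_linear_l.
Qed.

End Representation.

Lemma uea_ind (F : fieldType) (L : lieType F) (P : uea L -> Prop) :
  (forall (a : F) u v, P u -> P v -> P (a *: u + v)) -> P 1 ->
  (forall x u, P u -> P (uea_gen x * u)) -> forall u, P u.
Proof.
move=> PD P1 PM u.
have P0 : P 0 by rewrite -(subrr 1) addrC -scaleN1r; apply: PD.
have Pw (m : {fmonom L}) : P (uea_pi << m >>).
  have -> : m = FMonom m by rewrite fmK.
  elim: (m : seq L) => [|x s IH].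
    by rewrite -fmoneE; have := P1; rewrite -(rmorph1 (@uea_pi F L)).
  have -> : FMonom (x :: s) = mmul (fmu x) (FMonom s).
    by apply/eqP; rewrite fmP fmM fmU.
  have -> : << mmul (fmu x) (FMonom s) >> =
     << fmu x >> * << FMonom s >> :> {malg F[{fmonom L}]}.
    by rewrite malgM_def fgmulUU mulr1.
  rewrite (rmorphM (@uea_pi F L)).
  by have := PM x _ IH; rewrite /uea_gen free_gen.unlock.
rewrite -(uea_reprK u) (monalgE (uea_repr u)) raddf_sum /=.
elim/big_rec: _ => [//|m x _ Px].
have -> : << mcoeff m (uea_repr u) *g m >> =
    (mcoeff m (uea_repr u))%:A * << m >> :> {malg F[{fmonom L}]}.
  rewrite -scalerAl mul1r; apply/malgP => k.
  by rewrite mcoeffZ !mcoeffU mulr_natr.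
rewrite (rmorphM (@uea_pi F L)).
exact: (PD _ _ _ (Pw m) Px).
Qed.

(** * The grading of the enveloping algebra *)

Section Bilinear.
Variables (F : fieldType) (L : lieType F).
Implicit Types (x y : L).

Lemma bracketDl x x' y : bracket (x + x') y = bracket x y + bracket x' y.
Proof. exact: (linD (@bracket_linear_l F L y)). Qed.
Lemma bracketDr x y y' : bracket x (y + y') = bracket x y + bracket x y'.
Proof. exact: (linD (@bracket_linear_r F L x)). Qed.
Lemma bracketBl x x' y : bracket (x - x') y = bracket x y - bracket x' y.
Proof. exact: (linB (@bracket_linear_l F L y)). Qed.
Lemma bracketBr x y y' : bracket x (y - y') = bracket x y - bracket x y'.
Proof. exact: (linB (@bracket_linear_r F L x)). Qed.
Lemma bracketZl a x y : bracket (a *: x) y = a *: bracket x y.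
Proof. exact: (linZ (@bracket_linear_l F L y)). Qed.
Lemma bracketZr a x y : bracket x (a *: y) = a *: bracket x y.
Proof. exact: (linZ (@bracket_linear_r F L x)). Qed.
Lemma bracket0l y : bracket (0 : L) y = 0.
Proof. exact: (lin0 (@bracket_linear_l F L y)). Qed.
Lemma bracket0r x : bracket x (0 : L) = 0.
Proof. exact: (lin0 (@bracket_linear_r F L x)). Qed.
Lemma bracket_suml I (r : seq I) (P : pred I) (h : I -> L) y :
  bracket (\sum_(i <- r | P i) h i) y = \sum_(i <- r | P i) bracket (h i) y.
Proof. exact: (linsum (@bracket_linear_l F L y)). Qed.
Lemma bracketC x y : bracket x y = - bracket y x.
Proof.
have := bracket_alt (x + y).
by rewrite bracketDl !bracketDr !bracket_alt add0r addr0 => /eqP; rewrite addr_eq0 => /eqP.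
Qed.
Lemma bracket_derivation x y z :
  bracket x (bracket y z) = bracket (bracket x y) z + bracket y (bracket x z).
Proof.
have E : bracket y (bracket z x) = - bracket y (bracket x z).
  by rewrite [bracket z x]bracketC -scaleN1r bracketZr scaleN1r.
have := bracket_jacobi x y z; rewrite E [bracket z _]bracketC.
by rewrite -addrA -opprD => /eqP; rewrite subr_eq0 addrC => /eqP.
Qed.

End Bilinear.

Lemma augm_scale (F : fieldType) (L : lieType F) (c : F) : augm (c%:A : uea L) = c.
Proof.
have -> : (c%:A : uea L) = uea_pi c%:A by rewrite -[LHS]/(uea_pi c%:A * 1) mulr1.
by rewrite augm_pi free_augmZ free_augm1 mulr1.
Qed.

Lemma lie_projections (F : fieldType) (L : gradedLieType F) :
  exists p : nat -> L -> L, projections (homog : nat -> set L) p.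
Proof. exact: grading_projections (@homog_grading F L). Qed.

Lemma conv_bound (V : nmodType) N k (f : nat -> V) :
  (forall i, (N <= i)%N -> f i = 0) ->
  \sum_(i < N) (if (i <= k)%N then f i else 0) = \sum_(i < k.+1) f i.
Proof.
move=> f0; pose M := maxn N k.+1.
rewrite (big_ord_widen M (fun i => if (i <= k)%N then f i else 0)) ?leq_maxl //.
rewrite (big_ord_widen M f) ?leq_maxr // -!big_mkcondr /=.
rewrite [LHS]big_mkcond [RHS]big_mkcond; apply: eq_bigr => i _ /=.
by rewrite ltnS; case: ltnP => //= Ni; case: ifP => // _; rewrite f0.
Qed.

(* {poly A} is a module over A only; upoly A carries its F-module structure. *)
Definition upoly (F : fieldType) (A : algType F) : Type := {poly A}.

Section PolynomialModule.
Variables (F : fieldType) (A : algType F).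
Local Notation upoly := (upoly A).

HB.instance Definition _ := GRing.PzRing.on upoly.

Definition upoly_scale (c : F) (q : upoly) : upoly := (c%:A : A) *: (q : {poly A}).

Let upoly_scaleA a b q : upoly_scale a (upoly_scale b q) = upoly_scale (a * b) q.
Proof.
apply: etrans (scalerA (a%:A : A) (b%:A : A) (q : {poly A})) _.
by congr (_ *: _); apply: etrans (mulr_algl _ _) (scalerA _ _ _).
Qed.
Let upoly_scale1 : left_id 1 upoly_scale.
Proof. by move=> q; rewrite /upoly_scale !scale1r. Qed.
Let upoly_scaleDr : right_distributive upoly_scale +%R.
Proof. by move=> c u v; rewrite /upoly_scale scalerDr. Qed.
Let upoly_scaleDl q : {morph upoly_scale^~ q : c d / c + d}.
Proof. by move=> c d; rewrite /upoly_scale !scalerDl. Qed.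

HB.instance Definition _ := GRing.Zmodule_isLmodule.Build F upoly
  upoly_scaleA upoly_scale1 upoly_scaleDr upoly_scaleDl.

Lemma upoly_scaleE (c : F) (q : upoly) k :
  ((c *: q : upoly) : {poly A})`_k = c *: (q : {poly A})`_k.
Proof. by rewrite coefZ mulr_algl. Qed.

Lemma upoly_scaleAl (c : F) (q r : upoly) : c *: (q * r) = (c *: q) * r.
Proof. by rewrite -[LHS]/(c%:A *: _) -[c *: q]/(c%:A *: _) scalerAl. Qed.

Lemma upoly_scaleAr (c : F) (q r : upoly) : c *: (q * r) = q * (c *: r).
Proof.
apply/polyP => k; rewrite upoly_scaleE !coefM scaler_sumr; apply: eq_bigr => i _.
by rewrite upoly_scaleE scalerAr.
Qed.

End PolynomialModule.

Section GradedEnveloping.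
Variables (F : fieldType) (L : gradedLieType F).
Local Notation U := (uea L).
Variable (p : nat -> L -> L).
Hypothesis (hp : projections (homog : nat -> set L) p).

Lemma proj_linear n : linear (p n).
Proof.
move=> a x y; rewrite (projD hp); congr (_ + _).
apply: (@proj_shift _ _ _ _ _ p (fun x : L => a *: x) 0 hp hp).
  by move=> u v; rewrite scalerBr.
by move=> m v; rewrite add0n; apply: homogZ.
Qed.

Lemma proj_bracket k x y :
  p k (bracket x y) = \sum_(i < k.+1) bracket (p i x) (p (k - i) y).
Proof.
have [N xN] := proj_large hp x.
rewrite {1}(proj_sum_le hp xN) bracket_suml (proj_bigsum hp).
rewrite -(@conv_bound _ N k (fun i => bracket (p i x) (p (k - i) y))); last first.
  by move=> i Ni; rewrite xN // bracket0l.
have lb i : zmod_morphism (bracket (p i x)) by move=> u v; rewrite bracketBr.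
have hb i n v : homog n v -> homog (i + n) (bracket (p i x) v).
  by move=> hv; apply: homog_bracket => //; apply: (proj_in hp).
apply: eq_bigr => i _; case: leqP => ik.
  by rewrite -{1}(subnKC ik) (proj_shift hp hp (lb i) (hb i)).
by rewrite (proj_shift_lt hp hp (lb i) (hb i)).
Qed.

Let bound (x : L) : nat := xget 0%N [set N | forall n, (N <= n)%N -> p n x = 0].

Let boundP x n : (bound x <= n)%N -> p n x = 0.
Proof.
rewrite /bound; case: xgetP => [N _ h|h]; first exact: h.
by have [N hN] := proj_large hp x; have := h N.
Qed.

Local Notation upoly := (upoly U).

(* x acts on U[X] as multiplication by \sum_k x_k X^k, x_k the component of x of
   degree k; applying u to 1 puts the degree n part of u in front of X^n. *)
Definition degree_gen (x : L) : upoly := \poly_(k < bound x) uea_gen (p k x).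

Lemma coef_degree_gen x k : (degree_gen x : {poly U})`_k = uea_gen (p k x).
Proof.
rewrite coef_poly; case: ltnP => // /boundP ->.
by rewrite (lin0 (@uea_gen_linear F L)).
Qed.

Lemma degree_gen_linear : linear degree_gen.
Proof.
move=> a x y; apply/polyP => k; rewrite coefD upoly_scaleE !coef_degree_gen.
by rewrite proj_linear uea_gen_linear.
Qed.

Lemma degree_gen_bracket x y : degree_gen (bracket x y) =
  degree_gen x * degree_gen y - degree_gen y * degree_gen x.
Proof.
apply/polyP => k; rewrite coef_degree_gen proj_bracket (linsum (@uea_gen_linear F L)).
rewrite coefB coefM coefMr -sumrB; apply: eq_bigr => i _.
by rewrite !coef_degree_gen uea_gen_bracket.
Qed.

Let rho (x : L) (q : upoly) : upoly := degree_gen x * q.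

Let rho_r x : linear (rho x).
Proof. by move=> c u v; rewrite /rho mulrDr upoly_scaleAr. Qed.
Let rho_l v : linear (rho^~ v).
Proof. by move=> c x y; rewrite /rho degree_gen_linear mulrDl upoly_scaleAl. Qed.
Let rho_bracket x y v : rho (bracket x y) v = rho x (rho y v) - rho y (rho x v).
Proof. by rewrite /rho degree_gen_bracket mulrBl !mulrA. Qed.

Definition degree_mor (u : U) : upoly := uea_act rho u 1.

Lemma degree_mor_linear : linear degree_mor.
Proof. exact: (uea_act_linear_l rho_r rho_l rho_bracket). Qed.

Lemma degree_mor1 : degree_mor 1 = 1.
Proof. exact: (uea_act1 rho_r rho_l rho_bracket). Qed.

Lemma degree_mor_genM x u : degree_mor (uea_gen x * u) = degree_gen x * degree_mor u.
Proof.
rewrite /degree_mor (uea_actM rho_r rho_l rho_bracket).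
exact: (uea_act_gen rho_r rho_l rho_bracket).
Qed.

Lemma degree_morM u v : degree_mor (u * v) = degree_mor u * degree_mor v.
Proof.
elim/uea_ind: u => [a u w Eu Ew||x u Eu].
- rewrite mulrDl -scalerAl !degree_mor_linear Eu Ew mulrDl.
  by rewrite upoly_scaleAl.
- by rewrite mul1r degree_mor1 mul1r.
- by rewrite -mulrA !degree_mor_genM Eu mulrA.
Qed.

Definition uproj (n : nat) (u : U) : U := (degree_mor u : {poly U})`_n.

Lemma uproj_linear n : linear (uproj n).
Proof. by move=> a u v; rewrite /uproj degree_mor_linear coefD upoly_scaleE. Qed.

Lemma uprojM n u v : uproj n (u * v) = \sum_(i < n.+1) uproj i u * uproj (n - i) v.
Proof. by rewrite /uproj degree_morM coefM. Qed.

Lemma degree_mor_homog n u : uea_homog n u ->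
  degree_mor u = (u%:P * 'X^n : {poly U}).
Proof.
elim=> {n u} [n|n u v _ Eu _ Ev|n a u _ Eu||k n x u hx _ Eu].
- by rewrite (lin0 degree_mor_linear) mul0r.
- by rewrite (linD degree_mor_linear) Eu Ev polyCD mulrDl.
- rewrite (linZ degree_mor_linear) Eu; apply/polyP => m.
  by rewrite upoly_scaleE [in RHS]coefCM [in LHS]coefCM; exact: scalerAl.
- by rewrite degree_mor1 mulr1.
- rewrite degree_mor_genM Eu.
  have -> : degree_gen x = ((uea_gen x)%:P * 'X^k : {poly U}).
    apply/polyP => m; rewrite coef_degree_gen coefCM coefXn.
    have [->|mk] := eqVneq m k; first by rewrite (proj_id hp) // mulr1.
    by rewrite (proj_ne hp hx) // (lin0 (@uea_gen_linear F L)) mulr0.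
  by rewrite polyCM exprD -!mulrA; congr (_ * _);
    rewrite !mulrA; congr (_ * _); apply/esym/commr_polyXn.
Qed.

Lemma uea_homog_subspace n : subspace (@uea_homog F L n).
Proof.
split=> [|a x y hx hy]; first exact: UeaHomog0.
by apply: UeaHomogD => //; apply: UeaHomogZ.
Qed.

Lemma uproj_projections : projections (@uea_homog F L) uproj.
Proof.
split.
- move=> n u; elim/uea_ind: u n => [a u v hu hv n||x u hu n].
  + rewrite uproj_linear; exact: UeaHomogD (UeaHomogZ a (hu n)) (hv n).
  + move=> n; rewrite /uproj degree_mor1 coef1.
    by case: n => [|n]; [exact: UeaHomog1 | exact: UeaHomog0].
  + rewrite /uproj degree_mor_genM coefM; have sn := uea_homog_subspace n.
    apply: (subspace_sum _ sn) => i _; rewrite coef_degree_gen.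
    rewrite -{1}(subnKC (ltn_ord i : (i <= n)%N)); apply: UeaHomogM => //.
    exact: (proj_in hp).
- by move=> n u v; rewrite (linB (@uproj_linear n)).
- by move=> n u hu; rewrite /uproj (degree_mor_homog hu) coefCM coefXn eqxx mulr1.
- move=> n m u hu mn; rewrite /uproj (degree_mor_homog hu) coefCM coefXn.
  by rewrite (negbTE mn) mulr0.
- move=> u; exists (size (degree_mor u : {poly U})).
  (* The coefficients of [degree_mor u] are the components of [u], so evaluation at [X = 1] gives
     their sum. Evaluation is multiplicative because 1 is central. *)
  have E : (degree_mor u : {poly U}).[1] = u.
    have hM (q r : {poly U}) : (q * r).[1] = q.[1] * r.[1].
      by apply: hornerM_comm; rewrite /comm_poly mul1r mulr1.
    elim/uea_ind: u => [a u v Eu Ev||x u Eu].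
    + rewrite degree_mor_linear hornerD Ev -[X in X.[1]]/(a%:A *: _) hornerZ Eu.
      by rewrite mulr_algl.
    + by rewrite degree_mor1 hornerC.
    + rewrite degree_mor_genM hM Eu; congr (_ * _).
      rewrite (horner_coef_wide 1 (size_poly _ _)).
      rewrite [in RHS](proj_sum_le hp (@boundP x)) (linsum (@uea_gen_linear F L)).
      by apply: eq_bigr => i _; rewrite coef_degree_gen expr1n mulr1.
  rewrite -{1}E horner_coef; apply: eq_bigr => i _.
  by rewrite expr1n mulr1.
Qed.

End GradedEnveloping.

Section HomogMul.
Variables (F : fieldType) (L : gradedLieType F).
Implicit Types (u v : uea L).

Lemma uea_homog_mul n m u v :
  uea_homog n u -> uea_homog m v -> uea_homog (n + m) (u * v).
Proof.
move=> hu hv; elim: hu => {n u} [n|n u w _ hu _ hw|n a u _ hu||k n x u hx _ hu].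
- by rewrite mul0r; apply: UeaHomog0.
- by rewrite mulrDl; apply: UeaHomogD.
- by rewrite -scalerAl; apply: UeaHomogZ.
- by rewrite mul1r.
- by rewrite -mulrA -addnA; apply: UeaHomogM.
Qed.

Lemma uea_homog_gen n (x : L) : homog n x -> uea_homog n (uea_gen x).
Proof.
move=> hx; rewrite -[uea_gen x]mulr1 -(addn0 n).
by apply: UeaHomogM => //; apply: UeaHomog1.
Qed.

Lemma augm_homog n u : uea_homog n u -> (0 < n)%N -> augm u = 0.
Proof.
have aZ a w : augm w = 0 -> augm (a *: w : uea L) = 0.
  by move=> E; rewrite -(mulr_algl a w) rmorphM /= E mulr0.
elim=> {n u} [n _|n u v _ Eu _ Ev n0|n a u _ Eu n0||k n x u _ _ _ _] //.
- by rewrite raddf0.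
- by rewrite raddfD /= Eu ?Ev ?addr0.
- by rewrite aZ ?Eu.
- by rewrite rmorphM /= augm_gen mul0r.
Qed.

(** A product of total degree 0 has factors of degree 0, and [L] is zero there; only multiples of 1
    remain. *)
Lemma uea_homog0 u : uea_homog 0 u -> u = (augm u)%:A.
Proof.
move=> hu; suff [c ->] : exists c : F, u = c%:A by rewrite augm_scale.
move: hu; move En : 0%N => n hu.
elim: hu En => {n u} [n|n u v _ Eu _ Ev|n a u _ Eu||k n x u hx _ _] n0.
- by exists 0; rewrite scale0r.
- by case: (Eu n0) => c ->; case: (Ev n0) => d ->; exists (c + d); rewrite scalerDl.
- by case: (Eu n0) => c ->; exists (a * c); rewrite scalerA.
- by exists 1; rewrite scale1r.
- move/esym/eqP: n0; rewrite addn_eq0 => /andP[/eqP k0 _].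
  move: hx; rewrite k0 homog0 => ->; exists 0.
  by rewrite (lin0 (@uea_gen_linear F L)) mul0r scale0r.
Qed.

Lemma augm_proj0 p u : projections (@uea_homog F L) p -> p 0%N u = (augm u)%:A.
Proof.
move=> hp; rewrite [LHS]uea_homog0; last exact: (proj_in hp).
suff -> : augm (p 0%N u) = augm u by [].
have [N uN] := proj_large hp u.
have -> : augm u = augm (\sum_(i < N.+1) p i u).
  by rewrite -(proj_sum_le hp) // => n /ltnW; apply: uN.
rewrite big_ord_recl (raddfD (@augm F L)) (raddf_sum (@augm F L)).
rewrite big1 ?addr0 // => i _.
exact: (augm_homog (proj_in hp _ _)).
Qed.

End HomogMul.

(** * Finite-dimensionality of the components of the enveloping algebra *)

Section AugmentationIdeal.
Variables (F : fieldType) (L : lieType F).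
Local Notation U := (uea L).

Lemma augm_linear : linear (@augm F L : U^o -> triv_mod L).
Proof. by move=> u v w; rewrite raddfD /= rmorphM. Qed.

HB.instance Definition _ := GRing.isLinear.Build U U^o (triv_mod L) *:%R
  (@augm F L : U^o -> triv_mod L) augm_linear.

(* If q in Q_0 and h : Q_0 -> U lift 1 and the augmentation of Q_0, then every v in
   the augmentation ideal is v (1 - h q) + h (v q), and v q comes from Q_1. *)
Lemma augm_ideal_fg : type_FP_infty (triv_mod L) ->
  exists (m : nat) (e : 'I_m -> U), (forall i, augm (e i) = 0) /\
    forall v, augm v = 0 -> exists c : 'I_m -> U, v = \sum_i c i * e i.
Proof.
move=> [Q Qfg].
have [|h hE] := res_projective (p := Q) (s := 0%N)
    (g := (@augm F L : U^o -> triv_mod L)) (res_aug Q).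
  by move=> c; exists (c%:A : U); apply: augm_scale.
have [q Eq] := res_aug_surj Q (1 : F).
have [m [g Hg]] := Qfg 1%N.
pose e (i : 'I_m.+1) : U := if unlift ord0 i is Some j then h (res_diff Q 0 (g j)) else 1 - h q.
exists m.+1, e; split.
  move=> i; rewrite /e; case: unliftP => [j _|_].
    rewrite -[LHS]/((@augm F L : U^o -> triv_mod L) (h _)) hE.
    exact: (proj2 (res_exact0 _) (ex_intro _ (g j) erefl)).
  rewrite raddfB /= rmorph1.
  rewrite -[augm (h q)]/((@augm F L : U^o -> triv_mod L) (h q)) hE Eq.
  exact: subrr.
move=> v v0.
have [y Ey] : exists y, res_diff Q 0 y = v *: q.
  apply/(res_exact0); rewrite linearZ /= Eq.
  by rewrite -[LHS]/(augm v * 1) v0 mul0r.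
have [c Ec] := Hg y.
exists (fun i => if unlift ord0 i is Some j then c j else v).
rewrite big_ord_recl /= /e unlift_none.
have -> : \sum_(i < m) (if unlift ord0 (lift ord0 i) is Some j then c j else v) *
    (if unlift ord0 (lift ord0 i) is Some j then h (res_diff Q 0 (g j)) else 1 - h q) = v * h q.
  rewrite -[v * h q]/(v *: (h q : U^o)) -linearZ -Ey Ec !linear_sum /=.
  by apply: eq_bigr => i _; rewrite liftK !linearZ.
by rewrite mulrBr mulr1 subrK.
Qed.

End AugmentationIdeal.

Lemma has_dim_span_fin (F : fieldType) (V : lmodType F) (I : finType)
    (g : I -> V) (Z : set V) : subspace Z ->
  (forall z, Z z -> exists r : I -> F, z = \sum_i r i *: g i) ->
  exists d, has_dim Z [set 0] d.
Proof.
move=> sZ gZ; apply: (has_dim_span (g := fun i : 'I_#|I| => g (enum_val i)) sZ).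
move=> z /gZ [r ->]; exists (\row_i r (enum_val i)).
rewrite big_enum_val /=; apply: eq_bigr => i _; by rewrite mxE.
Qed.

Section FiniteEnveloping.
Variables (F : fieldType) (L : gradedLieType F).
Local Notation U := (uea L).

(** An element of degree [n + 1] is [\sum_j c_j e_j] with generators [e_j] of the augmentation
    ideal. Its degree [n + 1] part pairs the component of [e_j] of degree [i] with that of [c_j] of
    degree [n + 1 - i]. The term [i = 0] vanishes because [augm (e_j) = 0], so only components of
    [c_j] of degree at most [n] occur, and induction applies. One finite family spans all degrees up
    to [n] at once. *)
Lemma uea_homog_finite : type_FP_infty (triv_mod L) ->
  forall n, exists h, has_dim (@uea_homog F L n) [set 0] h.
Proof.
move=> /augm_ideal_fg [m [e [e0 He]]].
have [p hp] := lie_projections L.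
have hu := uproj_projections hp; set q := uproj p in hu.
suff H n : exists (I : finType) (g : I -> U), forall k, (k <= n)%N ->
    forall u, uea_homog k u -> exists r : I -> F, u = \sum_i r i *: g i.
  move=> n; have [I [g Hg]] := H n.
  apply: (has_dim_span_fin (g := g)) => [|u hn]; first exact: uea_homog_subspace.
  exact: (Hg n).
elim: n => [|n [I [g Hg]]].
  exists unit, (fun=> 1) => k; rewrite leqn0 => /eqP -> u /uea_homog0 Eu.
  by exists (fun=> augm u); rewrite (big_pred1 tt) //; case.
(* The old spanning family is kept for degrees up to [n]; the products of its members with the
   components of the [e_j] up to degree [n + 1] are added. *)
exists (I + 'I_m * 'I_n.+2 * I)%type.
exists (fun x : I + 'I_m * 'I_n.+2 * I =>
  match x with inl i => g i | inr (j, k, i) => g i * q k (e j) end).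
move=> k; rewrite leq_eqVlt ltnS => /orP[/eqP -> u hn|/Hg Hk u /Hk [r ->]]; last first.
  exists (fun x : I + 'I_m * 'I_n.+2 * I => if x is inl i then r i else 0).
  rewrite big_sumType /= [X in _ + X]big1 ?addr0 // => x _.
  by rewrite scale0r.
have [c Ec] := He u (augm_homog hn isT).
have Eu : u = \sum_j \sum_(i < n.+2) q (n.+1 - i)%N (c j) * q i (e j).
  rewrite -[LHS](proj_id hu hn) Ec (proj_bigsum hu); apply: eq_bigr => j _.
  rewrite [LHS](uprojM hp) (reindex_inj rev_ord_inj) /=; apply: eq_bigr => i _.
  by rewrite subSS subKn // -ltnS.
have /choice [r Hr] : forall x : 'I_m * 'I_n.+2, exists r : I -> F,
    (0 < x.2)%N -> q (n.+1 - x.2)%N (c x.1) = \sum_i r i *: g i.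
  move=> [j [[|i] Hi]] /=; first by exists (fun=> 0).
  rewrite subSS; have [r Hr] := Hg _ (leq_subr i n) _ (proj_in hu (n - i)%N (c j)).
  by exists r.
exists (fun x : I + 'I_m * 'I_n.+2 * I => match x with inl i => 0 | inr (jk, i) => r jk i end).
rewrite big_sumType /= big1 ?add0r => [|i _]; last by rewrite scale0r.
rewrite {1}Eu pair_bigA /=.
transitivity (\sum_(x : 'I_m * 'I_n.+2) \sum_l r x l *: (g l * q x.2 (e x.1))); last first.
  by rewrite pair_bigA /=; apply: eq_bigr => -[[j i] l].
apply: eq_bigr => -[j i] _ /=.
have [i0|i0] := posnP i; last first.
  by rewrite (Hr (j, i) i0) mulr_suml; apply: eq_bigr => l _; rewrite scalerAl.
have qe : q i (e j) = 0 by rewrite i0 (augm_proj0 _ hu) e0 scale0r.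
by rewrite qe mulr0 big1 // => l _; rewrite mulr0 scaler0.
Qed.

End FiniteEnveloping.

(** * Codimension one ideals *)

Lemma addr_bracket (V : zmodType) (a b c d e f : V) :
  (a - b) + ((c - d) + (e - f)) = (a + e + c) - (b + d + f).
Proof.
by rewrite !opprD [c - d + _]addrACA [LHS]addrACA [c + e]addrC !addrA.
Qed.

Lemma addr_shuffle (V : zmodType) (a b c : V) : a = b + (a - (b + c) + c).
Proof. by rewrite opprD [a + _]addrA subrK addrCA subrr addr0. Qed.

Lemma addr_ore (V : zmodType) (a b m n p q w : V) :
  (a - b) + (m - n) = (a + p + (q + m + w)) - (b + q + (p + n + w)).
Proof.
rewrite [a + p + _](AC (2*3) ((1*4)*(2*3*5))) [b + q + _](AC (2*3) ((1*4)*(3*2*5))).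
by rewrite opprD [RHS]addrACA subrr addr0 opprD [RHS]addrACA.
Qed.

(** This is the bracket relation for the action on [U(I)[X]], read off one coefficient: [a], [b] are
    the generators of [r v], [r w], while [c], [d] are those of [D (r v)], [D (r w)]; [s], [t] are
    [phi v], [phi w]; and [p], [e], [w] are coefficients of a polynomial and of its first and second
    images under [E]. *)
Lemma ore_identity (F : fieldType) (A : algType F) (a b c d p e w : A) (s t : F) :
  (a * b - b * a + (s *: d - t *: c)) * p =
  a * (b * p + t *: e) + s *: (b * e + d * p + t *: w)
  - (b * (a * p + s *: e) + t *: (a * e + c * p + s *: w)).
Proof.
rewrite !mulrDl !mulNr !mulrDr !mulrA -!scalerAl -!scalerAr !scalerDr !scalerA.
by rewrite [t * s]mulrC; apply: addr_ore.
Qed.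

Section Derivation.
Variables (F : fieldType) (I : lieType F) (D : I -> I).
Hypothesis lD : linear D.
Hypothesis dD : forall a b, D (bracket a b) = bracket (D a) b + bracket a (D b).
Local Notation U := (uea I).
Local Notation V := (U * U)%type.

(* The matrices [[a, 0], [D a, a]]. *)
Let rho (a : I) (w : V) : V :=
  (uea_gen a * w.1, uea_gen a * w.2 + uea_gen (D a) * w.1).

Let rho_r a : linear (rho a).
Proof.
move=> c [u u'] [v v']; rewrite /rho /=; congr (_, _) => /=.
  by rewrite mulrDr scalerAr.
by rewrite !mulrDr !scalerDr -!scalerAr addrACA.
Qed.

Let rho_l w : linear (rho^~ w).
Proof.
case: w => u u' c a b; rewrite /rho /=; congr (_, _) => /=.
  by rewrite uea_gen_linear mulrDl scalerAl.
by rewrite lD !uea_gen_linear !mulrDl !scalerDr -!scalerAl addrACA.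
Qed.

Let rho_bracket a b w : rho (bracket a b) w = rho a (rho b w) - rho b (rho a w).
Proof.
case: w => u u'; rewrite /rho /=; congr (_, _) => /=.
  by rewrite uea_gen_bracket mulrBl !mulrA.
rewrite dD (linD (@uea_gen_linear F I)) !uea_gen_bracket.
rewrite mulrBl mulrDl !mulrBl !mulrDr !mulrA; exact: addr_bracket.
Qed.

Let act := uea_act rho.
Let act_l (w : V) : linear (act^~ w).
Proof. exact: (uea_act_linear_l rho_r rho_l rho_bracket). Qed.

Let act_genM a u w : act (uea_gen a * u) w = rho a (act u w).
Proof.
rewrite /act (uea_actM rho_r rho_l rho_bracket).
exact: (uea_act_gen rho_r rho_l rho_bracket).
Qed.

Lemma derivation_extension : exists delta : U -> U,
  [/\ linear delta, delta 1 = 0 &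
    forall a u, delta (uea_gen a * u) = uea_gen (D a) * u + uea_gen a * delta u].
Proof.
(* The orbit map of [(1, 0)] is [u |-> (u, delta u)]; its second component is the derivation
   sought. *)
have E1 u : (act u (1, 0)).1 = u.
  elim/uea_ind: u => [c u v Eu Ev||a u Eu].
  - rewrite (act_l (1, 0) c u v).
    exact: (congr2 (fun s t : U => c *: s + t) Eu Ev).
  - by rewrite /act (uea_act1 rho_r rho_l rho_bracket).
  - by rewrite act_genM /= Eu.
exists (fun u => (act u (1, 0)).2); split.
- by move=> c u v; rewrite (act_l (1, 0) c u v).
- by rewrite /act (uea_act1 rho_r rho_l rho_bracket).
- by move=> a u; rewrite act_genM /= E1 addrC.
Qed.

End Derivation.

Section Morphism.
Variables (F : fieldType) (I L : lieType F) (iota : I -> L).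
Hypothesis li : linear iota.
Hypothesis iB : forall a b, iota (bracket a b) = bracket (iota a) (iota b).

Let rho (a : I) (u : uea L) : uea L := uea_gen (iota a) * u.
Let rho_r a : linear (rho a).
Proof. by move=> c u v; rewrite /rho mulrDr scalerAr. Qed.
Let rho_l u : linear (rho^~ u).
Proof. by move=> c a b; rewrite /rho li uea_gen_linear mulrDl scalerAl. Qed.
Let rho_bracket a b u : rho (bracket a b) u = rho a (rho b u) - rho b (rho a u).
Proof. by rewrite /rho iB uea_gen_bracket mulrBl !mulrA. Qed.

Lemma uea_morphism : exists f : uea I -> uea L,
  [/\ linear f, f 1 = 1 & forall a u, f (uea_gen a * u) = uea_gen (iota a) * f u].
Proof.
exists (fun u => uea_act rho u 1); split.
- exact: (uea_act_linear_l rho_r rho_l rho_bracket).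
- exact: (uea_act1 rho_r rho_l rho_bracket).
- move=> a u; rewrite (uea_actM rho_r rho_l rho_bracket).
  exact: (uea_act_gen rho_r rho_l rho_bracket).
Qed.

End Morphism.

Section Ore.
Variables (F : fieldType) (I L : lieType F) (iota : I -> L) (x : L).
Variables (phi : L -> F) (r : L -> I) (D : I -> I).
Hypotheses (li : linear iota) (lphi : linear (phi : L -> F^o)) (lr : linear r) (lD : linear D).
Hypothesis iB : forall a b, iota (bracket a b) = bracket (iota a) (iota b).
Hypothesis dD : forall a b, D (bracket a b) = bracket (D a) b + bracket a (D b).
Hypothesis iD : forall a, iota (D a) = bracket x (iota a).
Hypothesis phiB : forall v w, phi (bracket v w) = 0.
Hypothesis rB : forall v w, r (bracket v w) =
  bracket (r v) (r w) + (phi v *: D (r w) - phi w *: D (r v)).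
Hypothesis rE : forall v, v = iota (r v) + phi v *: x.
Hypotheses (ri : forall a, r (iota a) = a) (phi_i : forall a, phi (iota a) = 0).
Hypotheses (rx : r x = 0) (phix : phi x = 1).
Local Notation U := (uea I).
Local Notation V := (upoly U).

(* U(L) is the Ore extension U(I)[x; delta]: it acts on U(I)[X], an element of I by
   left multiplication and x by p |-> p X + delta p, and [g u] is the constant
   coefficient of u . 1.  The map Psi : \sum_i u_i X^i |-> \sum_i u_i x^i is inverse to
   u |-> u . 1. *)
Lemma ore_extension : exists (f : U -> uea L) (delta : U -> U)
    (g : uea L -> U),
  [/\ [/\ linear f, f 1 = 1 & forall a u, f (uea_gen a * u) = uea_gen (iota a) * f u],
      [/\ linear delta, delta 1 = 0 &
        forall a u, delta (uea_gen a * u) = uea_gen (D a) * u + uea_gen a * delta u],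
      [/\ linear g, g 1 = 1, (forall u, g (f u) = u) &
        forall v w, g (uea_gen v * w) = uea_gen (r v) * g w + phi v *: delta (g w)],
      (forall w, g w = 0 -> exists w', w = w' * uea_gen x) &
      (forall w, g (w * uea_gen x) = 0) /\
      (forall w, w * uea_gen x = 0 -> w = 0)].
Proof.
have [f [lf f1 fM]] := uea_morphism li iB.
have [delta [ld d1 dM]] := derivation_extension lD dD.
have d0 : delta 0 = 0 := lin0 ld.
have [E coefE] : exists E : V -> V, forall p k, (E p : {poly U})`_k =
    (if k == 0%N then 0 else (p : {poly U})`_k.-1) + delta (p : {poly U})`_k.
  exists (fun p => (p : {poly U}) * 'X + map_poly delta (p : {poly U})) => p k.
  by rewrite coefD coefMX coef_map_id0.
have [rho coef_rho] : exists rho : L -> V -> V, forall v p k,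
    (rho v p : {poly U})`_k =
    uea_gen (r v) * (p : {poly U})`_k + phi v *: (E p : {poly U})`_k.
  exists (fun v p => (uea_gen (r v) *: (p : {poly U}) : V) + phi v *: E p).
  by move=> v p k; rewrite coefD coefZ upoly_scaleE.
have E_lin : linear E.
  move=> c p q; apply/polyP => k; rewrite coefD upoly_scaleE !coefE !coefD !upoly_scaleE.
  rewrite ld scalerDr addrACA; case: eqP => _; by rewrite ?scaler0 ?addr0.
have E_gen a (p : V) : E (uea_gen a *: (p : {poly U}) : V) =
    (uea_gen a *: (E p : {poly U}) : V) + (uea_gen (D a) *: (p : {poly U}) : V).
  apply/polyP => k; rewrite coefD !coefZ !coefE !coefZ dM mulrDr.
  rewrite -addrA [uea_gen (D a) * _ + _]addrC; congr (_ + _).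
  by case: eqP; rewrite ?mulr0.
have rho_r v : linear (rho v).
  move=> c p q; apply/polyP => k; rewrite coefD upoly_scaleE !coef_rho.
  rewrite E_lin !coefD !upoly_scaleE mulrDr !scalerDr !scalerA scalerAr.
  by rewrite [c * phi v]mulrC addrACA.
have rho_l p : linear (rho^~ p).
  move=> c v w; apply/polyP => k; rewrite coefD upoly_scaleE !coef_rho.
  rewrite lr uea_gen_linear lphi mulrDl scalerDl scalerDr -scalerAl scalerA.
  by rewrite addrACA.
have E_rho w p k : (E (rho w p) : {poly U})`_k =
    uea_gen (r w) * (E p : {poly U})`_k + uea_gen (D (r w)) * (p : {poly U})`_k
      + phi w *: (E (E p) : {poly U})`_k.
  have -> : rho w p = phi w *: E p + (uea_gen (r w) *: (p : {poly U}) : V).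
    by apply/polyP => i; rewrite coef_rho coefD upoly_scaleE coefZ addrC.
  by rewrite E_lin E_gen coefD upoly_scaleE coefD !coefZ addrC.
have rho_bracket v w p : rho (bracket v w) p = rho v (rho w p) - rho w (rho v p).
  apply/polyP => k; rewrite coefB !coef_rho !E_rho phiB scale0r addr0 rB.
  rewrite (linD (@uea_gen_linear F I)) (linB (@uea_gen_linear F I)) !(linZ (@uea_gen_linear F I)).
  by rewrite uea_gen_bracket; apply: ore_identity.
pose act := uea_act rho.
have act_l p : linear (act^~ p).
  exact: (uea_act_linear_l rho_r rho_l rho_bracket).
have act1 p : act 1 p = p by exact: (uea_act1 rho_r rho_l rho_bracket).
have actM u w p : act (u * w) p = act u (act w p).
  exact: (uea_actM rho_r rho_l rho_bracket).
have act_gen v p : act (uea_gen v) p = rho v p.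
  exact: (uea_act_gen rho_r rho_l rho_bracket).
pose X : V := ('X : {poly U}).
(* Multiplication by [X] on the right commutes with the action, and [x . 1 = X]. Hence right
   multiplication by [x] in [U(L)] becomes multiplication by [X], which is injective and kills
   constant coefficients. *)
have rhoX v p : rho v (p * X) = rho v p * X.
  apply/polyP => k; rewrite coef_rho coefE !coefMX coef_rho coefE.
  by case: k => [|k] //=; rewrite mulr0 d0 addr0 scaler0 addr0.
have actX u p : act u (p * X) = act u p * X.
  elim/uea_ind: u p => [c u w Eu Ew p|p|v u Eu p].
  - by rewrite !act_l Eu Ew mulrDl upoly_scaleAl.
  - by rewrite !act1.
  - by rewrite !actM Eu !act_gen rhoX.
have X0 : rho x 1 = X.
  apply/polyP => k; rewrite coef_rho rx (lin0 (@uea_gen_linear F I)) mul0r add0r phix.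
  rewrite scale1r coefE coefX !coef1.
  by case: k => [|[|k]] /=; rewrite ?mulr0n ?mulr1n ?d1 ?d0 ?addr0.
pose Theta u := act u 1.
have ThetaX u : Theta (u * uea_gen x) = Theta u * X.
  by rewrite /Theta actM act_gen X0 -actX mul1r.
have f0 : f 0 = 0 := lin0 lf.
pose fmap (p : V) : {poly uea L} := map_poly f (p : {poly U}).
have coef_fmap p k : (fmap p)`_k = f (p : {poly U})`_k by exact: coef_map_id0.
pose Psi (p : V) : uea L := (fmap p).[uea_gen x].
have fmapD p q : fmap (p + q) = fmap p + fmap q.
  by apply/polyP => k; rewrite coefD !coef_fmap coefD (linD lf).
have fmapZ c p : fmap (c *: p) = c%:A *: fmap p.
  by apply/polyP => k; rewrite coefZ mulr_algl !coef_fmap upoly_scaleE (linZ lf).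
have PsiD p q : Psi (p + q) = Psi p + Psi q by rewrite /Psi fmapD hornerD.
have PsiZ c p : Psi (c *: p) = c *: Psi p by rewrite /Psi fmapZ hornerZ mulr_algl.
have PsiX p : Psi (p * X) = Psi p * uea_gen x.
  rewrite /Psi -hornerMX; congr (_.[_]); apply/polyP => k.
  by rewrite coef_fmap !coefMX coef_fmap; case: eqP.
have [cst coef_cst] : exists cst : U -> V, forall c k,
    (cst c : {poly U})`_k = if k == 0%N then c else 0.
  by exists (fun c => c%:P : {poly U}) => c k; rewrite coefC.
have PsiC u : Psi (cst u) = f u.
  rewrite /Psi -[RHS](hornerC (f u) (uea_gen x)); congr (_.[_]).
  by apply/polyP => k; rewrite coef_fmap coef_cst coefC; case: eqP.
have Psi_gen a (p : V) : Psi (uea_gen a *: (p : {poly U}) : V) = uea_gen (iota a) * Psi p.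
  rewrite /Psi -hornerZ; congr (_.[_]); apply/polyP => k.
  by rewrite coefZ !coef_fmap coefZ fM.
(* The Ore commutation rule inside [U(L)]. It makes [Psi] turn [E] into left multiplication by [x],
   so that [Psi] is equivariant and [Psi (u . 1) = u]. *)
have xf u : uea_gen x * f u = f u * uea_gen x + f (delta u).
  elim/uea_ind: u => [c u w Eu Ew||a u Eu].
  - rewrite ld !lf mulrDr mulrDl -scalerAr Eu Ew scalerDr -scalerAl.
    by rewrite addrACA.
  - by rewrite d1 f0 f1 mulr1 mul1r addr0.
  - rewrite dM (linD lf) !fM iD uea_gen_bracket mulrBl -!mulrA Eu mulrDr.
    exact: addr_shuffle.
have PsiE p : Psi (E p) = uea_gen x * Psi p.
  elim/poly_ind: (p : {poly U}) => [|q c Eq].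
    have -> : E 0 = 0 by exact: lin0 E_lin.
    have -> : Psi 0 = 0 by rewrite /Psi /fmap map_poly0 horner0.
    by rewrite mulr0.
  have EX : E ((q : V) * X) = E q * X.
    apply/polyP => k; rewrite coefE !coefMX coefE.
    by case: k => [|k] /=; rewrite ?d0 ?addr0.
  have EC : E (cst c) = cst c * X + cst (delta c).
    apply/polyP => k; rewrite coefE coefD coefMX !coef_cst.
    by case: k => [|k] /=; rewrite ?d0.
  have -> : (q * 'X + c%:P : {poly U}) = (q : V) * X + cst c.
    by apply/polyP => k; rewrite !coefD coef_cst coefC.
  rewrite (linD E_lin) EX EC !PsiD !PsiX !PsiC -xf Eq mulrDr.
  by rewrite mulrA.
have Psi_act u p : Psi (act u p) = u * Psi p.
  clearbody act.
  elim/uea_ind: u p => [c u w Eu Ew p|p|v u Eu p].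
  - rewrite (act_l p c u w) PsiD PsiZ Eu Ew.
    by rewrite [in RHS]mulrDl -(scalerAl c u).
  - by rewrite act1 mul1r.
  - rewrite actM act_gen -mulrA -Eu.
    have -> : rho v (act u p) = phi v *: E (act u p) + (uea_gen (r v) *: (act u p : {poly U}) : V).
      by apply/polyP => i; rewrite coef_rho coefD upoly_scaleE coefZ addrC.
    rewrite PsiD PsiZ PsiE Psi_gen [in RHS](rE v) (linD (@uea_gen_linear F L)).
    by rewrite (linZ (@uea_gen_linear F L)) mulrDl -scalerAl addrC.
have PsiTheta u : Psi (Theta u) = u.
  by rewrite Psi_act /Psi (_ : fmap 1 = 1) ?hornerC ?mulr1 //; apply/polyP => k;
    rewrite coef_fmap !coef1; case: eqP.
pose g u := (Theta u : {poly U})`_0.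
have gM v w : g (uea_gen v * w) = uea_gen (r v) * g w + phi v *: delta (g w).
  by rewrite /g /Theta actM act_gen coef_rho coefE /= add0r.
have g1 : g 1 = 1 by rewrite /g /Theta act1 coef1.
have gl : linear g by move=> c u w; rewrite /g /Theta act_l coefD upoly_scaleE.
exists f, delta, g; split=> //.
- split=> // u; elim/uea_ind: u => [c u w Eu Ew||a u Eu].
  + by rewrite lf gl Eu Ew.
  + by rewrite f1.
  + by rewrite fM gM Eu ri phi_i scale0r addr0.
(* As the constant coefficient of [Theta w] vanishes, [Theta w] is divisible by [X]; the witness is
   the image of the quotient. *)
- move=> w gw0; exists (Psi (\poly_(i < size (Theta w : {poly U})) (Theta w : {poly U})`_i.+1)).
  rewrite -PsiX -{1}(PsiTheta w); congr Psi; apply/polyP => -[|i].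
    by rewrite coefMX.
  rewrite coefMX coef_poly /=; case: ltnP => // h.
  by rewrite nth_default // (leq_trans h).
- split=> w; first by rewrite /g ThetaX coefMX.
  move=> wx0; rewrite -(PsiTheta w).
  have -> : Theta w = 0.
    apply/polyP => i; have := congr1 (fun u => (Theta u : {poly U})`_i.+1) wx0.
    by rewrite ThetaX coefMX /= /Theta (lin0 (act_l 1)) !coef0.
  by rewrite /Psi /fmap map_poly0 horner0.
Qed.

End Ore.

(** A homogeneous character of [L]. Graded ideals of codimension at most one are encoded as kernels
    of such functionals, which are closed under brackets with no further condition. *)
Record degree_functional (F : fieldType) (L : gradedLieType F) := DegreeFunctional {
  df_fun :> L -> F;
  df_deg : nat;
  df_linear : linear (df_fun : L -> F^o);
  df_bracket : forall v w, df_fun (bracket v w) = 0;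
  df_off : forall n v, n != df_deg -> homog n v -> df_fun v = 0
}.

Section Kernel.
Variables (F : fieldType) (L : gradedLieType F) (phi : degree_functional L).

Lemma df_proj p v : projections (homog : nat -> set L) p -> phi (p (df_deg phi) v) = phi v.
Proof.
move=> hp; have [N vN] := proj_large hp v; pose M := maxn N (df_deg phi).+1.
have {2}-> : v = \sum_(i < M) p i v.
  by apply: (proj_sum_le hp) => i; rewrite geq_max => /andP[h _]; exact: vN.
apply/esym; apply: etrans (linsum (@df_linear _ _ phi) _ _ _) _.
have h : (df_deg phi < M)%N by rewrite leq_max ltnSn orbT.
rewrite (bigD1 (Ordinal h)) //= big1 ?addr0 // => i ni.
exact: (df_off (ni : (i : nat) != _) (proj_in hp _ _)).
Qed.

Definition df_ker : {pred L} := fun v => phi v == 0.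

Lemma df_ker_submod : submod_closed df_ker.
Proof.
have lphi := @df_linear _ _ phi; split.
  by apply/eqP; exact: (lin0 lphi).
move=> a u v /eqP Eu /eqP Ev; apply/eqP.
by rewrite [LHS](lphi a u v) Eu Ev scaler0 addr0.
Qed.

HB.instance Definition _ := GRing.isSubmodClosed.Build F L df_ker df_ker_submod.

Definition df_kernel : Type := {v : L | v \in df_ker}.
HB.instance Definition _ := SubChoice.on df_kernel.
HB.instance Definition _ := [SubChoice_isSubLmodule of df_kernel by <:].

Definition ker_bracket (v w : df_kernel) : df_kernel :=
  Sub (bracket (val v) (val w)) (introT eqP (df_bracket phi (val v) (val w))).

Let val_ker_bracket v w : val (ker_bracket v w) = bracket (val v) (val w).
Proof. exact: SubK. Qed.

Lemma ker_bracket_linear_l v : linear (ker_bracket^~ v).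
Proof.
move=> a u w; apply: val_inj.
by rewrite linearP !val_ker_bracket linearP [LHS](@bracket_linear_l F L (val v)).
Qed.

Lemma ker_bracket_linear_r v : linear (ker_bracket v).
Proof.
move=> a u w; apply: val_inj.
by rewrite linearP !val_ker_bracket linearP [LHS](@bracket_linear_r F L (val v)).
Qed.

Lemma ker_bracket_alt v : ker_bracket v v = 0.
Proof. by apply: val_inj; rewrite val_ker_bracket bracket_alt raddf0. Qed.

Lemma ker_bracket_jacobi u v w : ker_bracket u (ker_bracket v w) +
  ker_bracket v (ker_bracket w u) + ker_bracket w (ker_bracket u v) = 0.
Proof.
have valD (a b : df_kernel) : val (a + b) = val a + val b by exact: raddfD.
by apply: val_inj; rewrite !valD !val_ker_bracket bracket_jacobi raddf0.
Qed.

HB.instance Definition _ := Lmodule_isLie.Build F df_kernel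
  ker_bracket_linear_l ker_bracket_linear_r ker_bracket_alt ker_bracket_jacobi.

Lemma val_bracket (v w : df_kernel) : val (bracket v w) = bracket (val v) (val w).
Proof. exact: val_ker_bracket. Qed.

Definition ker_homog (n : nat) : set df_kernel := [set v | homog n (val v)].

Lemma ker_grading : is_grading ker_homog.
Proof.
have [p hp] := lie_projections L.
have [Gsub _ Gind] := @homog_grading F L.
have lphi := @df_linear _ _ phi.
split.
- move=> n; split=> [|x y]; rewrite /ker_homog /= ?raddf0 ?raddfB /=.
    by case: (Gsub n).
  by apply: (proj2 (Gsub n)).
- move=> v.
  have Kp n : p n (val v) \in df_ker.
    apply/eqP; have [->|nd] := eqVneq n (df_deg phi); last first.
      exact: (df_off nd (proj_in hp _ _)).
    by rewrite (df_proj _ hp); apply/eqP; exact: (valP v).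
  have [N Ev] := proj_sum hp (val v).
  exists N, (fun n => exist _ (p n (val v)) (Kp n) : df_kernel).
    by move=> n; rewrite /ker_homog /=; apply: (proj_in hp).
  by apply: val_inj; rewrite raddf_sum /= {1}Ev.
- move=> N c hc Ec n nN; apply: val_inj; rewrite raddf0.
  apply: (Gind N (fun n => val (c n))) => //.
  by have := congr1 val Ec; rewrite raddf_sum raddf0.
Qed.

Lemma ker_homogZ n (a : F) (v : df_kernel) : ker_homog n v -> ker_homog n (a *: v).
Proof.
have valZ : val (a *: v) = a *: val v by exact: linearZ.
by rewrite /ker_homog /mkset valZ; apply: homogZ.
Qed.

Lemma ker_homog0 : ker_homog 0 = [set 0].
Proof.
have val0 : val (0 : df_kernel) = 0 by exact: raddf0.
apply/seteqP; split=> v; rewrite /ker_homog /mkset homog0.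
  by move=> E; apply: val_inj; rewrite val0.
by move=> ->; apply: val0.
Qed.

Lemma ker_homog_bracket n m (v w : df_kernel) :
  ker_homog n v -> ker_homog m w -> ker_homog (n + m) (bracket v w).
Proof.
rewrite /ker_homog /mkset => hv hw; rewrite val_bracket.
exact: (homog_bracket n m _ _ hv hw).
Qed.

HB.instance Definition _ := Lie_isGraded.Build F df_kernel
  ker_grading ker_homogZ ker_homog0 ker_homog_bracket.

Lemma homog_kerE n (v : df_kernel) : homog n v <-> homog n (val v).
Proof. by []. Qed.

End Kernel.

Section KernelStep.
Variables (F : fieldType) (L : gradedLieType F) (phi : degree_functional L) (x : L).
Local Notation N := (df_deg phi).
Local Notation I := (df_kernel phi).
Hypotheses (hx : homog N x) (phix : phi x = 1).

Let lphi : linear (phi : L -> F^o) := @df_linear _ _ phi.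

Lemma ker_retract_proof v : v - phi v *: x \in df_ker phi.
Proof.
apply/eqP; rewrite [LHS](linB lphi) [X in _ - X](linZ lphi) phix.
by rewrite -[_ *: 1]/(phi v * 1) mulr1 subrr.
Qed.

Definition ker_retract (v : L) : I := exist (fun v => v \in df_ker phi) _ (ker_retract_proof v).

Lemma ker_ad_proof (a : I) : bracket x (val a) \in df_ker phi.
Proof. by apply/eqP; apply: df_bracket. Qed.

Definition ker_ad (a : I) : I := exist (fun v => v \in df_ker phi) _ (ker_ad_proof a).

Let valD (a b : I) : val (a + b) = val a + val b.
Proof. exact: raddfD. Qed.
Let valB (a b : I) : val (a - b) = val a - val b.
Proof. exact: raddfB. Qed.
Let valZ c (a : I) : val (c *: a) = c *: val a.
Proof. exact: linearZ. Qed.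

Let val_ad (a : I) : val (ker_ad a) = bracket x (val a).
Proof. by []. Qed.
Let val_retract v : val (ker_retract v) = v - phi v *: x.
Proof. by []. Qed.

Lemma kernel_ore : exists (f : uea I -> uea L) (delta : uea I -> uea I)
    (g : uea L -> uea I),
  [/\ [/\ linear f, f 1 = 1 & forall a u, f (uea_gen a * u) = uea_gen (val a) * f u],
      [/\ linear delta, delta 1 = 0 &
        forall a u, delta (uea_gen a * u) = uea_gen (ker_ad a) * u + uea_gen a * delta u],
      [/\ linear g, g 1 = 1, (forall u, g (f u) = u) &
        forall v w, g (uea_gen v * w) = uea_gen (ker_retract v) * g w + phi v *: delta (g w)],
      (forall w, g w = 0 -> exists w', w = w' * uea_gen x) &
      (forall w, g (w * uea_gen x) = 0) /\
      (forall w, w * uea_gen x = 0 -> w = 0)].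
Proof.
apply: (ore_extension (iota := (val : I -> L))) => //.
- move=> c v w; apply: val_inj; rewrite valD valZ !val_retract.
  rewrite (lphi c v w : phi _ = c * phi v + phi w) scalerDl scalerBr scalerA.
  by rewrite opprD addrACA.
- by move=> c a b; apply: val_inj; rewrite valD valZ !val_ad valD valZ bracketDr bracketZr.
- move=> a b; apply: val_inj; rewrite valD !val_bracket !val_ad val_bracket.
  exact: bracket_derivation.
- exact: df_bracket.
- move=> v w; apply: val_inj; rewrite valD val_bracket valB !valZ !val_ad !val_retract.
  rewrite df_bracket scale0r subr0.
  rewrite !bracketBl !bracketBr !bracketZl !bracketZr bracket_alt !scaler0 !subr0.
  rewrite [bracket v x]bracketC scalerN opprK.
  by rewrite [RHS]addrA subrK addrK.
- by move=> v; rewrite val_retract subrK.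
- move=> a; apply: val_inj; rewrite val_retract.
  by have /eqP -> := valP a; rewrite scale0r subr0.
- by move=> a; apply/eqP; apply: (valP a).
- by apply: val_inj; rewrite val_retract phix scale1r subrr.
Qed.

(** Right multiplication by [x], of degree [N], and the map [g], of degree 0, form an exact sequence
    [0 -> U(L) -> U(L) -> U(I) -> 0], with [f] as a section of [g]; dimensions are counted in degree
    [n]. For [n < N] the kernel of [g] in degree [n] is zero. *)
Lemma kernel_step (h : nat -> nat) :
  (forall n, has_dim (@uea_homog F L n) [set 0] (h n)) ->
  exists h' : nat -> nat,
    (forall n, has_dim (@uea_homog F I n) [set 0] (h' n)) /\
    forall n, h n = (h' n + if (N <= n)%N then h (n - N)%N else 0)%N.
Proof.
move=> hdim.
have [f [delta [g [[lf f1 fM] [ld d1 dM] [lg g1 gf gM] kerg [gx xreg]]]]] := kernel_ore.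
have [p hp] := lie_projections L; have hu := uproj_projections hp.
have f_homog n u : uea_homog n u -> uea_homog n (f u).
  elim=> {n u} [n|n u v _ Eu _ Ev|n a u _ Eu||k n a u ha _ Eu].
  - by rewrite (lin0 lf); apply: UeaHomog0.
  - by rewrite (linD lf); apply: UeaHomogD.
  - by rewrite (linZ lf); apply: UeaHomogZ.
  - by rewrite f1; apply: UeaHomog1.
  - by rewrite fM; apply: UeaHomogM.
have d_homog n u : uea_homog n u -> uea_homog (N + n) (delta u).
  elim=> {n u} [n|n u v _ Eu _ Ev|n a u _ Eu||k n a u ha hu' Eu].
  - by rewrite (lin0 ld); apply: UeaHomog0.
  - by rewrite (linD ld); apply: UeaHomogD.
  - by rewrite (linZ ld); apply: UeaHomogZ.
  - by rewrite d1; apply: UeaHomog0.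
  - rewrite dM; apply: UeaHomogD.
      by rewrite addnA; apply: UeaHomogM => //; apply: (homog_bracket N k).
    by rewrite addnCA; apply: UeaHomogM.
have g_homog n u : uea_homog n u -> uea_homog n (g u).
  elim=> {n u} [n|n u v _ Eu _ Ev|n a u _ Eu||k n a u ha _ Eu].
  - by rewrite (lin0 lg); apply: UeaHomog0.
  - by rewrite (linD lg); apply: UeaHomogD.
  - by rewrite (linZ lg); apply: UeaHomogZ.
  - by rewrite g1; apply: UeaHomog1.
  - rewrite gM; have [Ek|nk] := eqVneq k N.
      apply: UeaHomogD; last by apply: UeaHomogZ; rewrite Ek; apply: d_homog.
      apply: UeaHomogM => //; rewrite homog_kerE /=.
      have [G0 GB] := (let: And3 Gs _ _ := @homog_grading F L in Gs k).
      by apply: GB => //; apply: homogZ; rewrite Ek.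
    rewrite (df_off nk ha) scale0r addr0; apply: UeaHomogM => //.
    by rewrite homog_kerE /= (df_off nk ha) scale0r subr0.
pose Y n := [set u | uea_homog n u /\ g u = 0].
have sU n := uea_homog_subspace L n.
have sY n : subspace (Y n).
  split; first by split; [apply: UeaHomog0 | apply: (lin0 lg)].
  move=> a u v [hu1 gu] [hv gv]; split; first exact: (proj2 (sU n)).
  by rewrite lg gu gv scaler0 addr0.
have Yh n : has_dim (Y n) [set 0] (if (N <= n)%N then h (n - N)%N else 0%N).
  case: leqP => nN; last first.
    apply: has_dim_self; first exact: subspace0.
    move=> u [hn /kerg [w Ew]] /=.
    rewrite -(proj_id hu hn) Ew.
    apply: (@proj_shift_lt _ _ _ _ _ _ (fun w => w * uea_gen x) N hu hu) => //.
      by move=> a b; rewrite mulrBl.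
    by move=> m v hv; rewrite addnC; apply: uea_homog_mul => //; apply: uea_homog_gen.
  apply: (has_dim_pushforward (f := fun w : uea L => w * uea_gen x)) (hdim _).
  - exact: sU.
  - exact: subspace0.
  - by move=> a u v _ _; rewrite mulrDl scalerAl.
  - move=> u hu1; split; last exact: gx.
    rewrite -(subnK nN); exact: (uea_homog_mul hu1 (uea_homog_gen hx)).
  - by move=> u _; split=> [/xreg|->] //=; rewrite mul0r.
  - move=> u [hn /kerg [w Ew]]; exists (uproj p (n - N) w); first exact: (proj_in hu).
    rewrite /= -(proj_id hu hn) Ew -{1}(subnKC nN).
    rewrite (@proj_shift _ _ _ _ _ _ (fun w => w * uea_gen x) N hu hu) ?subrr //.
      by move=> a b; rewrite mulrBl.
    by move=> m v hv; rewrite addnC; apply: uea_homog_mul => //; apply: uea_homog_gen.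
have Y0 n : [set 0] `<=` Y n by move=> _ ->; apply: (proj1 (sY n)).
have YU n : Y n `<=` @uea_homog F L n by move=> u [].
have H n : exists h', has_dim (@uea_homog F I n) [set 0] h' /\
    h n = (h' + if (N <= n)%N then h (n - N)%N else 0)%N.
  have [e [le he hY]] := has_dim_split (sU n) (sY n) (subspace0 _) (@Y0 n) (@YU n) (hdim n).
  have Ee := has_dim_unique (sY n) (subspace0 _) hY (Yh n).
  exists (h n - e)%N; rewrite -Ee subnK //; split=> //.
  apply: (has_dim_pushforward (f := g)) he.
  - exact: sU.
  - exact: subspace0.
  - by move=> a u v _ _; rewrite lg.
  - exact: g_homog.
  - by move=> u hu1; split=> [|[]].
  - by move=> u hu1; exists (f u); [apply: f_homog | rewrite /= gf subrr].
have /choice [h' Hh'] := H; exists h'; split=> n; by case: (Hh' n).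
Qed.

End KernelStep.

(** * The Hilbert series of the enveloping algebra *)

Section TruncatedCongruence.
Variable R : comNzRingType.
Implicit Types (p q : {poly R}).

Definition eqX (n : nat) p q := forall i, (i < n)%N -> p`_i = q`_i.

Lemma eqX_refl n p : eqX n p p. Proof. by []. Qed.

Lemma eqX_sym n p q : eqX n p q -> eqX n q p.
Proof. by move=> E i /E. Qed.

Lemma eqX_trans n p q r : eqX n p q -> eqX n q r -> eqX n p r.
Proof. by move=> E E' i h; rewrite E // E'. Qed.

Lemma eqXM n p p' q q' : eqX n p p' -> eqX n q q' -> eqX n (p * q) (p' * q').
Proof.
move=> Ep Eq i hi; rewrite !coefM; apply: eq_bigr => j _.
have hj : (j < n)%N by apply: leq_ltn_trans hi; rewrite -ltnS.
by rewrite Ep // Eq // (leq_ltn_trans (leq_subr _ _)).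
Qed.

Lemma eqXMl n p q q' : eqX n q q' -> eqX n (p * q) (p * q').
Proof. exact: eqXM. Qed.

End TruncatedCongruence.

Lemma homog_subspace (F : fieldType) (L : gradedLieType F) n :
  subspace (homog n : set L).
Proof.
have [Gs _ _] := @homog_grading F L; have [G0 GB] := Gs n.
split=> // a x y hx hy; rewrite -[y]opprK; apply: (GB); first exact: homogZ.
by rewrite -sub0r; apply: GB.
Qed.

Section LowestDegree.
Variables (F : fieldType) (L : gradedLieType F) (N : nat).
Hypothesis (N0 : (0 < N)%N).
Hypothesis conc : forall n (v : L), (n < N)%N -> homog n v -> v = 0.

(** In the brackets of components of degrees [i] and [N - i], the first factor vanishes for [i < N];
    for [i = N] the second has degree 0. *)
Lemma proj_conc_bracket p (a b : L) : projections (homog : nat -> set L) p ->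
  p N (bracket a b) = 0.
Proof.
move=> hp; rewrite (proj_bracket hp) big1 // => i _.
have [iN|Ni] := ltnP i N.
  by rewrite (conc iN (proj_in hp _ _)) bracket0l.
rewrite (conc _ (proj_in hp (N - i)%N b)) ?bracket0r //.
by apply: leq_ltn_trans N0; rewrite leqn0 subn_eq0.
Qed.

Lemma uea_homog_conc n (u : uea L) : (0 < n < N)%N -> uea_homog n u -> u = 0.
Proof.
move=> + hu; elim: hu => {n u} [//|n u v _ Eu _ Ev h|n a u _ Eu h|//|k n x u hx _ _].
- by rewrite (Eu h) (Ev h) addr0.
- by rewrite (Eu h) scaler0.
- move=> /andP[_ h]; rewrite (conc _ hx) ?(lin0 (@uea_gen_linear F L)) ?mul0r //.
  exact: leq_ltn_trans (leq_addr n k) h.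
Qed.

(* L acts on F * L by a . (c, v) = (0, c a_N), since brackets have no component of
   degree N. *)
Lemma uea_gen_inj_lowest (a : L) : homog N a -> uea_gen a = 0 -> a = 0.
Proof.
have [p hp] := lie_projections L; move=> ha ga.
pose V := (F^o * L)%type.
have [rho rhoE] : exists rho : L -> V -> V, forall b v, rho b v = (0, (v.1 : F) *: p N b).
  by exists (fun b v => (0, (v.1 : F) *: p N b)).
have lp := proj_linear hp N.
have rho_r b : linear (rho b).
  move=> c u v; rewrite !rhoE; congr (_, _) => /=; first by rewrite scaler0 addr0.
  by rewrite scalerDl scalerA.
have rho_l v : linear (rho^~ v).
  move=> c b b'; rewrite !rhoE; congr (_, _) => /=; first by rewrite scaler0 addr0.
  by rewrite lp scalerDr !scalerA mulrC.
have rho_bracket b b' v : rho (bracket b b') v = rho b (rho b' v) - rho b' (rho b v).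
  rewrite !rhoE proj_conc_bracket // scaler0; congr (_, _) => /=; first by rewrite subr0.
  by rewrite !scale0r subr0.
have E := uea_act_gen rho_r rho_l rho_bracket a (1, 0).
have := congr1 snd E; rewrite rhoE /= scale1r (proj_id hp ha) => <-.
by rewrite ga (lin0 (uea_act_linear_l rho_r rho_l rho_bracket _)).
Qed.

Lemma homog_lowest_finite h : has_dim (@uea_homog F L N) [set 0] h ->
  exists d, has_dim (homog N : set L) [set 0] d.
Proof.
move=> /has_dim_coordinates [].
- exact: uea_homog_subspace.
- exact: subspace0.
move=> c [lc _ kc].
have sG := homog_subspace L N.
apply: (has_dim_finite (c := fun v : L => c (uea_gen v))) => //.
- exact: subspace0.
- by move=> _ ->; case: sG.
- move=> a x y hx hy; rewrite uea_gen_linear lc //; exact: uea_homog_gen.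
- move=> v hv /kc; move/(_ (uea_homog_gen hv)) => /= /uea_gen_inj_lowest.
  exact.
Qed.

End LowestDegree.

Lemma has_dim_uea0 (F : fieldType) (L : gradedLieType F) :
  has_dim (@uea_homog F L 0) [set 0] 1.
Proof.
exists (fun=> 1) => [_|u hu]; first exact: UeaHomog1.
exists (\row_(i < 1) augm u); split.
  by rewrite big_ord1 mxE /= [X in X - _](uea_homog0 hu) subrr.
move=> r /=; rewrite big_ord1 => /subr0_eq E; apply/rowP => i.
by rewrite mxE ord1 E augm_scale.
Qed.

(** The infinite product cut off at [k = T]: the omitted factors are congruent to 1 modulo
    [X^(T+1)]. *)
Definition lie_poly (T : nat) (d : nat -> nat) : {poly int} :=
  \prod_(k < T) (1 - 'X^(k.+1)) ^+ d k.+1.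

Definition hilbert_poly (T : nat) (h : nat -> nat) : {poly int} :=
  \poly_(i < T.+1) (h i)%:Z.

Lemma lie_poly_incr T d N : (0 < N <= T)%N ->
  lie_poly T (fun k => ((k == N) + d k)%N) = (1 - 'X^N) * lie_poly T d.
Proof.
case: N => // N /= NT; rewrite /lie_poly (bigD1 (Ordinal NT)) // [in RHS](bigD1 (Ordinal NT)) //.
rewrite mulrA; congr (_ * _); first by rewrite /= eqxx add1n exprS.
by apply: eq_bigr => i /negbTE iN; rewrite eqSS -[N]/(val (Ordinal NT)) [_ == _]iN.
Qed.

Section TowerStep.
Variables (F : fieldType) (L : gradedLieType F) (N e : nat).
Hypothesis (N0 : (0 < N)%N).
Hypothesis conc : forall n (v : L), (n < N)%N -> homog n v -> v = 0.
Hypothesis hN : has_dim (homog N : set L) [set 0] e.+1.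

(** Brackets have no component in the lowest degree, so any functional on [L_N], extended by zero to
    the other components, is a character. The first coordinate is used. *)
Lemma lowest_functional : exists (phi : degree_functional L) (x : L),
  [/\ df_deg phi = N, homog N x & phi x = 1].
Proof.
have [p hp] := lie_projections L.
have sN := homog_subspace L N.
have /has_dim_coordinates := hN; case=> //; first exact: subspace0.
move=> c [lc sc kc]; have [x hx cx] := sc (delta_mx 0 ord0).
pose f (v : L) : F := c (p N v) 0 ord0.
have lf : linear (f : L -> F^o).
  move=> a v w; rewrite /f (proj_linear hp) lc; try exact: (proj_in hp).
  by rewrite !mxE.
have fB v w : f (bracket v w) = 0.
  by rewrite /f (proj_conc_bracket N0 conc _ _ hp) (linear_on0 sN lc) mxE.
have foff n v : n != N -> homog n v -> f v = 0.
  by move=> nN hv; rewrite /f (proj_ne hp hv) 1?eq_sym // (linear_on0 sN lc) mxE.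
exists (DegreeFunctional lf fB foff), x; split=> //.
by rewrite /= /f (proj_id hp hx) cx mxE !eqxx.
Qed.

Variables (phi : degree_functional L) (x : L).
Hypotheses (degphi : df_deg phi = N) (hx : homog N x) (phix : phi x = 1).

Let lphi : linear (phi : L -> F^o) := @df_linear _ _ phi.

Let Y := [set v : L | homog N v /\ phi v = 0].

Let sY : subspace Y.
Proof.
have sN := homog_subspace L N.
split; first by split; [case: sN | exact: (lin0 lphi)].
move=> a v w [hv pv] [hw pw]; split; first exact: (proj2 sN).
by rewrite [LHS](lphi a v w) pv pw scaler0 addr0.
Qed.

Lemma has_dim_kernel_val n d : n != N ->
  has_dim (homog n : set (df_kernel phi)) [set 0] d ->
  has_dim (homog n : set L) [set 0] d.
Proof.
move=> nN; apply: (has_dim_pushforward (f := (val : df_kernel phi -> L))).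
- exact: homog_subspace.
- exact: subspace0.
- by move=> a u v _ _; exact: linearP.
- by [].
- by move=> v _; split=> [E|->]; [apply: val_inj; rewrite E raddf0 | rewrite raddf0].
- move=> v hv; have Kv : v \in df_ker phi.
    by apply/eqP; apply: (df_off (n := n)) => //; rewrite degphi.
  exists (exist _ v Kv) => //=; exact: subrr.
Qed.

Let has_dim_Y d : has_dim (homog N : set (df_kernel phi)) [set 0] d <-> has_dim Y [set 0] d.
Proof.
have H1 : subspace (homog N : set (df_kernel phi)) by exact: homog_subspace.
have H2 : linear_on (homog N) (val : df_kernel phi -> L).
  by move=> a u v _ _; exact: linearP.
have H3 (z : df_kernel phi) : homog N z -> Y (val z).
  by move=> hz; split=> //; apply/eqP; exact: (valP z).
have H4 (z : df_kernel phi) : homog N z -> ([set 0] (val z) <-> [set 0] z).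
  by move=> _; split=> [E|->]; [apply: val_inj; rewrite E raddf0 | exact: raddf0].
have H5 w : Y w -> exists2 z : df_kernel phi, homog N z & [set 0] (w - val z).
  move=> [hw /eqP pw]; exists (exist (fun v => v \in df_ker phi) w pw) => //=.
  exact: subrr.
split.
  exact: (has_dim_pushforward H1 (subspace0 _) H2 H3 H4 H5).
exact: (has_dim_pullback H1 (subspace0 _) H2 H3 H4 H5).
Qed.

Let has_dim_over_Y : has_dim (homog N : set L) Y 1.
Proof.
apply: (has_dim_pullback (W := 'rV[F]_1) (f := fun v : L => (\row_(i < 1) phi v : 'rV_1)))
    (has_dim_row F 1).
- exact: homog_subspace.
- exact: subspace0.
- move=> a u v _ _; apply/rowP => i; rewrite !mxE.
  exact: (lphi a u v).
- by [].
- move=> v hv; split=> [/rowP /(_ 0)|[_ pv]]; first by rewrite !mxE.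
  by apply/rowP => i; rewrite !mxE.
- move=> w _; exists (w 0 0 *: x); first exact: homogZ.
  apply/rowP => i; rewrite !mxE ord1.
  by rewrite (linZ lphi (w 0 0) x : phi _ = _ * phi x) phix mulr1 subrr.
Qed.

Lemma has_dim_kernel_lowest d :
  has_dim (homog N : set (df_kernel phi)) [set 0] d ->
  has_dim (homog N : set L) [set 0] (1 + d).
Proof.
move=> /has_dim_Y; apply: has_dim_add has_dim_over_Y.
- exact: homog_subspace.
- exact: sY.
- exact: subspace0.
- by move=> _ ->; case: sY.
- by move=> v [].
Qed.

Lemma has_dim_kernel_pred : has_dim (homog N : set (df_kernel phi)) [set 0] e.
Proof.
apply/has_dim_Y.
have sN := homog_subspace L N.
have Y0 : [set 0] `<=` Y by move=> _ ->; case: sY.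
have YN : Y `<=` homog N by move=> v [].
have [e' [le h1 h2]] := has_dim_split sN sY (subspace0 _) Y0 YN hN.
have := has_dim_unique sN sY h1 has_dim_over_Y; move=> E1.
by have := subnK le; rewrite E1 add1n => -[<-].
Qed.

Lemma df_kernel_conc n (v : df_kernel phi) : (n < N)%N -> homog n v -> v = 0.
Proof.
move=> nN hv; apply: val_inj; rewrite raddf0.
exact: (conc nN (hv : homog n (val v))).
Qed.

End TowerStep.

(** The outer induction is on [m = T + 1 - N], where [L] vanishes below degree [N]; the inner one is
    on the dimension of [L_N]. Passing to the kernel of a character lowers that dimension by one and
    multiplies the Hilbert series by [1 - X^N], which is the factor restored in [lie_poly]. *)
Lemma hilbert_mul_lie_poly (F : fieldType) (T : nat) (L : gradedLieType F) (h : nat -> nat) :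
  (forall n, has_dim (@uea_homog F L n) [set 0] (h n)) ->
  exists d : nat -> nat,
    (forall k, (0 < k <= T)%N -> has_dim (homog k : set L) [set 0] (d k)) /\
    eqX T.+1 (hilbert_poly T h * lie_poly T d) 1.
Proof.
suff H m : forall N (L : gradedLieType F) h, (0 < N)%N -> (N + m = T.+1)%N ->
    (forall n (v : L), (n < N)%N -> homog n v -> v = 0) ->
    (forall n, has_dim (@uea_homog F L n) [set 0] (h n)) ->
  exists d : nat -> nat,
    (forall k, (0 < k <= T)%N -> has_dim (homog k : set L) [set 0] (d k)) /\
    eqX T.+1 (hilbert_poly T h * lie_poly T d) 1.
  apply: (H T 1%N) => //.
  by move=> n v; rewrite ltnS leqn0 => /eqP ->; rewrite homog0.
elim: m => [|m IHm] N {}L {}h N0 NT conc hU.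
  (* Here [N = T + 1]: both [L] and [U(L)] vanish in degrees 1 to [T], and the Hilbert polynomial is
     congruent to 1. *)
  rewrite addn0 in NT; exists (fun=> 0%N); split.
    move=> k /andP[k0 kT]; apply: has_dim_self; first exact: subspace0.
    by move=> v hv; apply: (conc k) => //; rewrite NT ltnS.
  have -> : lie_poly T (fun=> 0%N) = 1 by rewrite /lie_poly big1.
  rewrite mulr1 => i hi; rewrite coef_poly hi coef1.
  case: i hi => [|i] hi /=.
    by rewrite (has_dim_unique (uea_homog_subspace L 0) (subspace0 _) (hU 0%N) (has_dim_uea0 L)).
  have h0 : has_dim (@uea_homog F L i.+1) [set 0] 0.
    apply: has_dim_self; first exact: subspace0.
    by move=> u; apply: (uea_homog_conc conc); rewrite NT.
  by rewrite (has_dim_unique (uea_homog_subspace L _) (subspace0 _) (hU _) h0).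
(* Finiteness of [L_N] is obtained at this stage of the tower, where [N] bounds the degrees from
   below and [L_N] embeds in [U(L)_N]. *)
have [e he] := homog_lowest_finite N0 conc (hU N).
elim: e L h conc hU he => [|e IHe] {}L {}h conc hU he.
  apply: (IHm N.+1 L h) => //; first by rewrite addSnnS.
  move=> n v; rewrite ltnS leq_eqVlt => /orP[/eqP -> hv|]; last exact: conc.
  exact: (has_dim0 he).
have [phi [x [degphi hx phix]]] := lowest_functional N0 conc he.
rewrite -degphi in hx.
have [h' [hU' hh']] := kernel_step hx phix hU.
rewrite degphi in hx hh'.
have he' := has_dim_kernel_pred he hx phix.
have conc' := @df_kernel_conc _ L N conc phi.
have [d' [hd' E]] := IHe (df_kernel phi) h' conc' hU' he'.
exists (fun k => ((k == N) + d' k)%N); split.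
  move=> k hk; have [->|kN] := eqVneq k N.
    apply: (has_dim_kernel_lowest hx phix); apply: hd'.
    by rewrite N0 /=; lia.
  by rewrite add0n; apply: (has_dim_kernel_val degphi kN); apply: hd'.
rewrite lie_poly_incr; last by rewrite N0 /=; lia.
rewrite mulrA; apply: eqX_trans E; apply: eqXM => // i hi.
rewrite mulrBr mulr1 coefB coefMXn !coef_poly hi hh'.
case: ltnP => iN; rewrite ?(leqNgt N i) ?iN /= ?addn0 ?subr0 //.
have -> : (i - N < T.+1)%N by apply: leq_ltn_trans hi; apply: leq_subr.
by rewrite PoszD addrK.
Qed.

(** * Finiteness of Ext *)

Section LinearImage.
Variables (R : pzRingType) (A B : lmodType R) (d : {linear A -> B}).

Definition lin_image : {pred B} := fun b => `[< exists a, d a = b >].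

Lemma lin_imageP b : reflect (exists a, d a = b) (b \in lin_image).
Proof. exact: asboolP. Qed.

Lemma lin_image_submod : submod_closed lin_image.
Proof.
split; first by apply/lin_imageP; exists 0; rewrite raddf0.
move=> c u v /lin_imageP [a <-] /lin_imageP [a' <-]; apply/lin_imageP.
by exists (c *: a + a'); rewrite linearP.
Qed.

HB.instance Definition _ := GRing.isSubmodClosed.Build R B lin_image lin_image_submod.

Definition lin_image_type : Type := {b : B | b \in lin_image}.
HB.instance Definition _ := SubChoice.on lin_image_type.
HB.instance Definition _ := [SubChoice_isSubLmodule of lin_image_type by <:].

(** [projective] speaks of surjections only, so both maps are corestricted to the image of [d]. *)
Lemma projective_lift (P : lmodType R) (f : {linear P -> B}) : projective P ->
  (forall x, exists a, d a = f x) -> exists h : {linear P -> A}, forall x, d (h x) = f x.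
Proof.
move=> projP fim.
have fI x : f x \in lin_image by apply/lin_imageP.
have dI a : d a \in lin_image by apply/lin_imageP; exists a.
pose f' (x : P) : lin_image_type := exist (fun b => b \in lin_image) (f x) (fI x).
pose d' (a : A) : lin_image_type := exist (fun b => b \in lin_image) (d a) (dI a).
have valP (c : R) (u v : lin_image_type) : val (c *: u + v) = c *: val u + val v.
  exact: linearP.
have lf : linear f' by move=> c x y; apply: val_inj; rewrite valP /= linearP.
have ld : linear d' by move=> c x y; apply: val_inj; rewrite valP /= linearP.
pose F' : {linear P -> lin_image_type} := HB.pack f' (GRing.isLinear.Build R _ _ _ f' lf).
pose D' : {linear A -> lin_image_type} := HB.pack d' (GRing.isLinear.Build R _ _ _ d' ld).
have [|h hE] := projP _ _ D' F'.
  move=> [b bI]; have /lin_imageP [a Ea] := bI; exists a; exact: val_inj.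
by exists h => x; have := congr1 val (hE x).
Qed.

End LinearImage.

Section Comparison.
Variables (R : pzRingType) (M : lmodType R).

Lemma res_dd (P : proj_resolution M) s (x : P s.+2) :
  res_diff P s (res_diff P s.+1 x) = 0.
Proof. by apply/res_exact; exists x. Qed.

Lemma res_aug_d (P : proj_resolution M) (x : P 1) :
  res_aug P (res_diff P 0 x) = 0.
Proof. by apply/res_exact0; exists x. Qed.

Lemma res_projectiveP (P : proj_resolution M) s : projective (P s).
Proof. by move=> A B g f; apply: (res_projective f). Qed.

Variables P Q : proj_resolution M.

Definition null_summand s : (P s -> P s) -> Prop :=
  match s return (P s -> P s) -> Prop with
  | 0 => fun e => forall x, e x = 0
  | s'.+1 => fun e => exists k : {linear P s' -> P s'.+1},
      forall x, e x = k (res_diff P s' x)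
  end.

Lemma null_summand_d s (e : P s -> P s) : null_summand e ->
  forall x, e (res_diff P s x) = 0.
Proof.
case: s e => [|s] e /= He x; first exact: He.
by have [k ->] := He; rewrite res_dd raddf0.
Qed.

(* [a] and [b] are the degree [s] components of chain maps between P and Q lifting
   the identity; [b \o a] is homotopic to the identity, the homotopy being [h] on
   P s and the map hidden in [null_summand] on P (s - 1). *)
Lemma comparison s : exists (a : {linear P s -> Q s}) (b : {linear Q s -> P s})
    (h : {linear P s -> P s.+1}) (e : P s -> P s),
  [/\ forall x, exists y, res_diff Q s y = a (res_diff P s x),
      forall y, exists x, res_diff P s x = b (res_diff Q s y),
      forall x, b (a x) = x + res_diff P s (h x) + e x & null_summand e].
Proof.
elim: s => [|s [a [b [h [e [Ha Hb Hh He]]]]]].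
  have [|a aE] := projective_lift (d := res_aug Q) (f := (res_aug P)) (@res_projectiveP P 0).
    by move=> x; exact: res_aug_surj.
  have [|b bE] := projective_lift (d := res_aug P) (f := (res_aug Q)) (@res_projectiveP Q 0).
    by move=> x; exact: res_aug_surj.
  pose f : {linear P 0 -> P 0} := (b \o a) \- idfun.
  have [|h hE] := projective_lift (d := res_diff P 0) (f := f) (@res_projectiveP P 0).
    by move=> x; apply/res_exact0; rewrite /f /= raddfB /= bE aE subrr.
  exists a, b, h, (fun=> 0); split=> //.
  - by move=> x; apply/res_exact0; rewrite aE res_aug_d.
  - by move=> x; apply/res_exact0; rewrite bE res_aug_d.
  - by move=> x; rewrite hE /f /= addr0 addrC subrK.
pose fa : {linear P s.+1 -> Q s} := a \o res_diff P s.
pose fb : {linear Q s.+1 -> P s} := b \o res_diff Q s.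
have [|a' aE] := projective_lift (d := res_diff Q s) (f := fa) (@res_projectiveP P s.+1).
  exact: Ha.
have [|b' bE] := projective_lift (d := res_diff P s) (f := fb) (@res_projectiveP Q s.+1).
  exact: Hb.
have e_d := null_summand_d He.
(* With [d] the differential, [d f = (b a - 1 - d h) d = e d = 0]; by exactness [f] lifts through
   the next differential, and the lift is the new homotopy. *)
pose f : {linear P s.+1 -> P s.+1} := ((b' \o a') \- idfun) \- (h \o res_diff P s).
have [|h' hE] := projective_lift (d := res_diff P s.+1) (f := f) (@res_projectiveP P s.+1).
  move=> x; apply/res_exact; rewrite /f /= !raddfB /= bE /fb /= aE /fa /= Hh e_d addr0.
  by rewrite -addrA -opprD subrr.
exists a', b', h', (h \o res_diff P s); split=> //.
- by move=> x; apply/res_exact; rewrite aE /fa /= res_dd raddf0.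
- by move=> x; apply/res_exact; rewrite bE /fb /= res_dd raddf0.
- by move=> x; rewrite hE /f /= -addrA subrK addrC subrK.
- by exists h.
Qed.

End Comparison.

Section GradedModule.
Variables (F : fieldType) (L : gradedLieType F) (M : lmodType (uea L)).
Variables (G : nat -> set M) (q : nat -> M -> M).
Hypothesis hq : projections G q.
Hypothesis hG : forall n m (u : uea L) x, uea_homog n u -> G m x -> G (n + m)%N (u *: x).

Lemma proj_act m n u x : uea_homog m u -> q (m + n) (u *: x) = u *: q n x.
Proof.
move=> hu; apply: (proj_shift (f := fun x => u *: x) hq hq); first exact: scalerBr.
by move=> k v hv; apply: hG.
Qed.

Lemma proj_act_lt m n u x : uea_homog m u -> (n < m)%N -> q n (u *: x) = 0.
Proof.
move=> hu; apply: (proj_shift_lt (f := fun x => u *: x) hq hq); first exact: scalerBr.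
by move=> k v hv; apply: hG.
Qed.

Lemma triv_linearE (f : M -> triv_mod L) : linear f ->
  forall u x, f (u *: x) = augm u * f x :> F.
Proof. by move=> lf u x; rewrite (linZ lf). Qed.

(** It suffices to treat homogeneous [u]. In positive degree both sides vanish because [augm u = 0];
    in degree 0 the action of [u] commutes with [q t]. *)
Lemma triv_linear_proj (f : M -> triv_mod L) t : linear f ->
  linear (fun x => f (q t x) : triv_mod L).
Proof.
move=> lf u x y; rewrite (projD hq) (linD lf); congr (_ + _).
suff H : f (q t (u *: x)) = augm u * f (q t x) :> F by [].
have [p hp] := lie_projections L; have hu := uproj_projections hp.
have [N Eu] := proj_sum hu u; rewrite {1 2}Eu.
rewrite scaler_suml (proj_bigsum hq) (linsum lf).
have -> : augm (\sum_(i < N) uproj p i u) = \sum_(i < N) augm (uproj p i u).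
  exact: (raddf_sum (@augm F L)).
rewrite mulr_suml; apply: eq_bigr => i _.
have hi : uea_homog i (uproj p i u) := proj_in hu i u.
have [i0|i0] := posnP i.
  by rewrite -{1}[t]add0n -{1}i0 (proj_act t x hi) triv_linearE.
rewrite (augm_homog hi i0) mul0r; have [it|ti] := leqP i t.
  by rewrite -{1}(subnKC it) (proj_act _ x hi) triv_linearE // (augm_homog hi i0) mul0r.
by rewrite (proj_act_lt x hi ti) (lin0 lf).
Qed.

End GradedModule.

Section ExtFinite.
Variables (F : fieldType) (L : gradedLieType F) (P : graded_resolution L).

Lemma gres_projections s : exists q, projections (@gres_homog _ _ P s) q.
Proof. exact: grading_projections (@gres_grading F L P s). Qed.

Lemma cochain_subspace s t : subspace (@cochain F L P s t).
Proof.
split.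
  split; last by [].
  move=> u x y; rewrite [RHS](_ : _ = augm u * 0 + 0 :> F) //.
  by rewrite mulr0 addr0.
move=> a f g [lf f0] [lg g0]; split.
  move=> u x y.
  suff H : a * f (u *: x + y) + g (u *: x + y) =
     augm u * (a * f x + g x) + (a * f y + g y) :> F by [].
  have Ef : f (u *: x + y) = augm u * f x + f y :> F := lf u x y.
  have Eg : g (u *: x + y) = augm u * g x + g y :> F := lg u x y.
  by rewrite Ef Eg !mulrDr !mulrA [a * augm u]mulrC addrACA.
move=> n x nt hx; rewrite -[LHS]/(a * f x + g x : F).
by rewrite (f0 n) // (g0 n) // mulr0 addr0.
Qed.

Lemma cocycle_subspace s t : subspace (@cocycle F L P s t).
Proof.
have [c0 cD] := cochain_subspace s t; split; first by split.
move=> a f g [cf df] [cg dg]; split; first exact: cD.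
by move=> y; rewrite -[LHS]/(a * f _ + g _ : F) df dg mulr0 addr0.
Qed.

Lemma coboundary_subspace s t : subspace (@coboundary F L P s t).
Proof.
case: s => [|s] /=; first exact: subspace0.
have [c0 cD] := cochain_subspace s t; split; first by exists 0.
move=> a f' g' [f cf Ef] [g cg Eg]; exists (a *: f + g); first exact: cD.
by move=> x; rewrite -[RHS]/(a * f _ + g _ : F) -Ef -Eg.
Qed.

Lemma cochain_d s t f : @cochain F L P s t f ->
  @cochain F L P s.+1 t (fun x => f (res_diff P s x)).
Proof.
move=> [lf f0]; split; first by move=> u x y; rewrite linearP lf.
by move=> n x nt hx; apply: (f0 n) => //; apply: gres_homog_diff.
Qed.

Lemma coboundary_cocycle s t : @coboundary F L P s t `<=` @cocycle F L P s t.
Proof.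
case: s => [_ ->|s g [f cf Eg]] /=; first by case: (cocycle_subspace 0 t).
have -> : g = fun x => f (res_diff P s x) by apply: funext.
split; first exact: cochain_d.
by move=> y; rewrite res_dd; case: cf => lf _; apply: (lin0 lf).
Qed.

(** A cocycle [f] is recorded by its values on the images under [b] of generators of [Q s]. If these
    vanish, so does [f b]. As [f] kills boundaries, the homotopy formula leaves [f = - f e], and [e]
    factors through the differential, which makes [f] a coboundary. In homological degree 0, [e = 0]
    and so [f = 0]. *)
Lemma has_dim_ext_sub (Q : proj_resolution (triv_mod L)) s t m
    (g : 'I_m -> Q s) :
  (forall y, exists c : 'I_m -> uea L, y = \sum_i c i *: g i) ->
  exists (c : (P s -> F^o) -> 'rV[F]_m), linear_on (@cocycle F L P s t) c /\
    forall f, @cocycle F L P s t f -> c f = 0 -> @coboundary F L P s t f.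
Proof.
move=> gQ; have [a [b [h [e [_ _ hh he]]]]] := comparison P Q s.
exists (fun f => \row_i f (b (g i))); split.
  by move=> k f f' _ _; apply/rowP => i; rewrite !mxE.
move=> f [[lf f0] fd] cf0.
have fb y : f (b y) = 0.
  have [c ->] := gQ y; rewrite linear_sum (linsum lf) big1 // => i _.
  rewrite linearZ [LHS](triv_linearE lf).
  by have /rowP /(_ i) := cf0; rewrite !mxE => ->; rewrite mulr0.
have fe x : f x = - f (e x).
  have := fb (a x); rewrite hh !(linD lf) fd addr0 => /eqP.
  by rewrite addr_eq0 => /eqP.
case: s g gQ a b h e hh he f lf f0 fd cf0 fb fe => [|s] g gQ a b h e hh he f lf f0 fd cf0 fb fe /=.
  apply: funext => x; rewrite fe he.
  by rewrite [f 0](lin0 lf) oppr0.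
have [k Ek] := he; have [q hq] := gres_projections s.
pose r (x : P s) : triv_mod L := - f (k x).
have lr : linear r.
  by move=> u x y; rewrite /r linearP lf opprD scalerN.
(* The homotopy [k] ignores the grading, so [r] need not be a cochain of degree [t]; its part of
   degree [t] is one, with the same coboundary because [f] has degree [t]. *)
exists (fun x => r (q t x)).
  split; first exact: (triv_linear_proj hq (@gres_homogM _ _ P s) t lr).
  move=> n x nt hx; rewrite (proj_ne hq hx) 1?eq_sym //.
  exact: (lin0 lr).
have [q' hq'] := gres_projections s.+1.
move=> x; have -> : q t (res_diff P s x) = res_diff P s (q' t x).
  apply: (proj_shift (k := 0) (f := res_diff P s) hq' hq).
    exact: raddfB.
  by move=> n v; rewrite add0n; apply: gres_homog_diff.
rewrite /r -Ek -fe.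
have [N xN] := proj_large hq' x; pose M := maxn N t.+1.
have {1}-> : x = \sum_(i < M) q' i x.
  by apply: (proj_sum_le hq') => i; rewrite geq_max => /andP[? _]; apply: xN.
have tM : (t < M)%N by rewrite leq_max ltnSn orbT.
rewrite (linsum lf) (bigD1 (Ordinal tM)) //= big1 ?addr0 // => i it.
exact: (f0 _ _ (it : (i : nat) != t) (proj_in hq' _ _)).
Qed.

Lemma ext_finite s t : type_FP_infty (triv_mod L) ->
  exists d, has_dim (@cocycle F L P s t) (@coboundary F L P s t) d.
Proof.
move=> [Q Qfg]; have [m [g Hg]] := Qfg s.
have [c [lc kc]] := has_dim_ext_sub t Hg.
apply: (has_dim_finite _ _ _ lc kc).
- exact: cocycle_subspace.
- exact: coboundary_subspace.
- exact: coboundary_cocycle.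
Qed.

Lemma ext_vanish : finite_proj_dim (triv_mod L) ->
  exists N, forall s t, (N <= s)%N ->
    has_dim (@cocycle F L P s t) (@coboundary F L P s t) 0.
Proof.
move=> [Q [N QN]]; exists N => s t Ns.
(* The zero module is generated by the empty family, so the classes of cocycles are detected by row
   vectors of length 0. *)
have gQ (y : Q s) : exists c : 'I_0 -> uea L, y = \sum_i c i *: (fun=> 0 : Q s) i.
  by exists (fun=> 0); rewrite big_ord0; apply: QN.
have [c [lc kc]] := has_dim_ext_sub t gQ.
apply: has_dim_self; first exact: coboundary_subspace.
by move=> f hf; apply: kc => //; apply/rowP; case.
Qed.

End ExtFinite.

(** * Euler characteristics of complexes *)

Section Complexes.
Variables (F : fieldType) (V : nat -> lmodType F) (D : forall s, V s -> V s.+1).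
Hypothesis lD : forall s, linear (@D s).

Definition cx_cocycle (C : forall s, set (V s)) s : set (V s) :=
  [set v | C s v /\ D v = 0].

Definition cx_coboundary (C : forall s, set (V s)) s : set (V s) :=
  match s return set (V s) with
  | 0 => [set 0]
  | s'.+1 => [set w | exists2 v, C s' v & D v = w]
  end.

Arguments cx_cocycle : clear implicits.
Arguments cx_coboundary : clear implicits.

(** [D] squares to zero on [C] only: the ambient spaces will consist of all functions on the [P s],
    where [D (D f)] is the constant function with value [f 0]. *)
Definition subcomplex (C : forall s, set (V s)) :=
  (forall s, subspace (C s)) /\
  forall s v, C s v -> C s.+1 (D v) /\ D (D v) = 0.

Definition betti (C : forall s, set (V s)) (b : nat -> nat) :=
  forall s, has_dim (cx_cocycle C s) (cx_coboundary C s) (b s).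

Section Subcomplex.
Variable C : forall s, set (V s).
Arguments C : clear implicits.
Hypothesis hC : subcomplex C.

Lemma cx_cocycle_subspace s : subspace (cx_cocycle C s).
Proof.
have [sC _] := hC; have [C0 CD] := sC s.
split; first by split; rewrite ?(lin0 (@lD s)).
move=> a u v [Cu Du] [Cv Dv]; split; first exact: CD.
by rewrite lD Du Dv scaler0 addr0.
Qed.

Lemma cx_coboundary_subspace s : subspace (cx_coboundary C s).
Proof.
case: s => [|s]; first exact: subspace0.
have [sC _] := hC; have [C0 CD] := sC s.
split; first by exists 0; rewrite ?(lin0 (@lD s)).
by move=> a _ _ [u Cu <-] [v Cv <-]; exists (a *: u + v); rewrite ?lD //; apply: CD.
Qed.

Lemma cx_coboundary_cocycle s : cx_coboundary C s `<=` cx_cocycle C s.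
Proof.
case: s => [_ ->|s _ [v Cv <-]]; first by case: (cx_cocycle_subspace 0).
exact: (proj2 hC).
Qed.

End Subcomplex.

Section ShortExact.
Variables (A B C : forall s, set (V s)) (rho : forall s, V s -> V s).
Arguments A : clear implicits.
Arguments B : clear implicits.
Arguments C : clear implicits.
Hypotheses (hA : subcomplex A) (hB : subcomplex B) (hC : subcomplex C).
Hypothesis lrho : forall s, linear (@rho s).
Hypothesis rhoD : forall s (v : V s), rho (D v) = D (rho v).
Hypothesis AB : forall s, A s `<=` B s.
Hypothesis rhoC : forall s v, B s v -> C s (rho v).
Hypothesis rho0 : forall s v, B s v -> (rho v = 0 <-> A s v).
Hypothesis rho_surj : forall s w, C s w -> exists2 v, B s v & rho v = w.
Variables a c : nat -> nat.
Hypotheses (ha : betti A a) (hc : betti C c).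

Let sA s : subspace (A s) := proj1 hA s.
Let sB s : subspace (B s) := proj1 hB s.
Let sC s : subspace (C s) := proj1 hC s.
Let ZB s := cx_cocycle_subspace hB s.
Let ZA s := cx_cocycle_subspace hA s.
Let ZC s := cx_cocycle_subspace hC s.
Let BB s := cx_coboundary_subspace hB s.
Let BA s := cx_coboundary_subspace hA s.
Let BC s := cx_coboundary_subspace hC s.

Let im s : set (V s) := [set w | exists2 v, cx_cocycle B s v & rho v = w].
Arguments im : clear implicits.
Let sim s : subspace (im s).
Proof.
have [Z0 ZD] := ZB s; split; first by exists 0; rewrite ?(lin0 (@lrho s)).
by move=> k _ _ [u Zu <-] [v Zv <-]; exists (k *: u + v); rewrite ?lrho //; apply: ZD.
Qed.
Let im_ZC s : im s `<=` cx_cocycle C s.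
Proof.
move=> _ [v [Bv Dv] <-]; split; first exact: rhoC.
by rewrite -rhoD Dv (lin0 (@lrho _)).
Qed.
Let BC_im s : cx_coboundary C s `<=` im s.
Proof.
case: s => [_ ->|s _ [w Cw <-]]; first by case: (sim 0).
have [v Bv <-] := rho_surj Cw; rewrite -rhoD; exists (D v) => //.
exact: (proj2 hB).
Qed.

Let W s : set (V s) := [set v | B s v /\ A s.+1 (D v)].
Arguments W : clear implicits.
Let Y s : set (V s) := [set v | W s v /\ exists2 u, A s u & D v = D u].
Arguments Y : clear implicits.
Let K s : set (V s) := [set v | cx_cocycle A s v /\ cx_coboundary B s v].
Arguments K : clear implicits.

Let sW s : subspace (W s).
Proof.
have [B0 BD] := sB s; have [A0 AD] := sA s.+1.
split; first by split; rewrite ?(lin0 (@lD s)).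
by move=> k u v [Bu Au] [Bv Av]; split; [apply: BD | rewrite lD; apply: AD].
Qed.
Let sK s : subspace (K s).
Proof.
have [Z0 ZD] := ZA s; have [B0 BD] := BB s; split; first by split.
by move=> k u v [? ?] [? ?]; split; [apply: ZD | apply: BD].
Qed.

(** The connecting map without choices of lifts: [rho] identifies [W / Y] with the cocycles of [C]
    modulo those that lift to cocycles of [B], and [D] identifies the same quotient with the
    cocycles of [A] bounding in [B] modulo the coboundaries of [A]. *)
Let connecting s r : has_dim (cx_cocycle C s) (im s) r -> has_dim (K s.+1) (cx_coboundary A s.+1) r.
Proof.
move=> h; have hW : has_dim (W s) (Y s) r.
  apply: (has_dim_pullback (f := @rho s)) h => //.
  - by move=> k u v _ _; apply: lrho.
  - move=> v [Bv Av]; split; first exact: rhoC.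
    by rewrite -rhoD; apply/rho0; [apply: AB|].
  - move=> v [Bv Av]; split=> [[z [Bz Dz] E]|[_ [u Au Du]]].
      split=> //; exists (v - z); last by rewrite (linB (@lD s)) Dz subr0.
      apply/rho0; first exact: subspaceB.
      by rewrite (linB (@lrho s)) E subrr.
    have Bu := AB Au; exists (v - u).
      by split; [apply: subspaceB | rewrite (linB (@lD s)) Du subrr].
    by rewrite (linB (@lrho s)) (proj2 (rho0 Bu) Au) subr0.
  - move=> w [Cw Dw]; have [v Bv Ev] := rho_surj Cw; exists v.
      split=> //; apply/rho0; first by case: (proj2 hB _ _ Bv).
      by rewrite rhoD Ev Dw.
    by rewrite Ev subrr; case: (sim s).
apply: (has_dim_pushforward (f := @D s)) hW => //.
- by move=> k u v _ _; apply: lD.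
- by move=> v [Bv Av]; split; [split=> //; case: (proj2 hB _ _ Bv) | exists v].
- move=> v Wv; split=> [[u Au E]|[_ [u Au E]]]; first by split=> //; exists u.
  by exists u.
- move=> w [[Aw Dw] [v Bv Ev]]; exists v; first by split; rewrite ?Ev.
  by rewrite Ev subrr; case: (BA s.+1).
Qed.

(* [r s] is the rank of the connecting map H^s(C) -> H^(s+1)(A). *)
Lemma betti_exact : exists r : nat -> nat, let r' s := if s is s'.+1 then r s' else 0%N in
  (forall s, (r s <= c s)%N /\ (r' s <= a s)%N) /\
  betti B (fun s => ((c s - r s) + (a s - r' s))%N).
Proof.
have H s : exists r, (r <= c s)%N /\ has_dim (cx_cocycle C s) (im s) r /\
    has_dim (im s) (cx_coboundary C s) (c s - r).
  have [e [le h1 h2]] := has_dim_split (ZC s) (sim s) (BC s) (@BC_im s) (@im_ZC s) (hc s).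
  by exists (c s - e)%N; rewrite leq_subr subKn.
have /choice [r Hr] := H; exists r => /=.
set r' := fun s => if s is s'.+1 then r s' else 0%N.
have hK s : has_dim (K s) (cx_coboundary A s) (r' s).
  case: s => [|s]; last by apply: connecting; case: (Hr s) => _ [].
  by apply: has_dim_self; [exact: (BA 0) | move=> v []].
have KZ s : K s `<=` cx_cocycle A s by move=> v [].
have BAK s : cx_coboundary A s `<=` K s.
  move=> v Bv; split; first exact: cx_coboundary_cocycle.
  case: s v Bv => [v|s v [u Au Eu]] //; exists u => //; exact: AB.
have hZK s : (r' s <= a s)%N /\ has_dim (cx_cocycle A s) (K s) (a s - r' s).
  have [e [le h1 h2]] := has_dim_split (ZA s) (sK s) (BA s) (@BAK s) (@KZ s) (ha s).
  by rewrite (has_dim_unique (sK s) (BA s) (hK s) h2).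
split=> s; first by split; [case: (Hr s) | case: (hZK s)].
(* [X] consists of the cocycles of [B] cohomologous to a cocycle of [A]. Modulo [X], [rho] gives the
   image of the cohomology of [B] in that of [C]; [X] modulo coboundaries is the image of the
   cohomology of [A], with kernel [K]. *)
pose X : set (V s) := [set v | cx_cocycle B s v /\
   exists2 u, cx_cocycle A s u & cx_coboundary B s (v - u)].
have ZAB u : cx_cocycle A s u -> cx_cocycle B s u by move=> [Au Du]; split=> //; apply: AB.
have sX : subspace X.
  have [Z0 ZD] := ZB s; have [A0 AD] := ZA s; have [B0 BD] := BB s.
  split; first by split=> //; exists 0; rewrite ?subr0.
  move=> k u v [Zu [u' Au' Bu']] [Zv [v' Av' Bv']]; split; first exact: ZD.
  exists (k *: u' + v'); first exact: AD.
  by rewrite opprD addrACA -scalerBr; apply: BD.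
have BX : cx_coboundary B s `<=` X.
  move=> v Bv; split; first exact: cx_coboundary_cocycle.
  by exists 0; rewrite ?subr0; case: (ZA s).
have XZ : X `<=` cx_cocycle B s by move=> v [].
apply: (has_dim_add (ZB s) sX (BB s) BX XZ).
  have [_ [_ h]] := Hr s.
  apply: (has_dim_pullback (f := @rho s)) h => //.
  - by move=> k u v _ _; apply: lrho.
  - by move=> v Zv; exists v.
  - move=> v Zv; have [Bv Dv] := Zv; split.
      move=> BCv; split=> //.
      have [u Bu Eu] : exists2 u, cx_coboundary B s u & rho u = rho v.
        case: (s) v Zv Bv Dv BCv => [|s'] v Zv Bv Dv BCv /=.
          by exists 0; rewrite ?(lin0 (@lrho _)).
        have [w Cw <-] := BCv; have [u Bu <-] := rho_surj Cw.
        by exists (D u); [exists u | rewrite rhoD].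
      have Zu := cx_coboundary_cocycle hB Bu.
      exists (v - u); last by rewrite opprB addrC subrK.
      have [Bvu Dvu] := subspaceB (ZB s) Zv Zu; split=> //.
      by apply/rho0 => //; rewrite (linB (@lrho s)) Eu subrr.
    move=> [_ [u [Au Du] BBu]].
    have -> : rho v = rho (v - u).
      by rewrite (linB (@lrho s)) (proj2 (rho0 (AB Au)) Au) subr0.
    move: BBu; move: (v - u) => {u Au Du Zv Bv Dv}.
    case: (s) => [|s'] v' /=; first by move=> ->; apply: (lin0 (@lrho _)).
    by move=> [u Bu <-]; exists (rho u); [apply: rhoC | rewrite rhoD].
  - by move=> w [v Zv <-]; exists v; rewrite // subrr; case: (BC s).
have [_ h] := hZK s.
apply: (has_dim_pushforward (f := id)) h => //.
- by move=> u Zu; split; [apply: ZAB | exists u; rewrite // subrr; case: (BB s)].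
- by move=> u Zu; split=> [Bu|[]].
- by move=> v [Zv [u Zu Bu]]; exists u.
Qed.

(** Each connecting rank [r s] enters in degrees [s] and [s + 1] with opposite signs. The
    alternating sum up to [n] retains only [r n], and [r N] is zero because it is at most [c N]. *)
Lemma euler_exact N : (forall s, (N <= s)%N -> a s = 0%N /\ c s = 0%N) ->
  exists b, [/\ betti B b, forall s, (N <= s)%N -> b s = 0%N &
   \sum_(s < N) (-1) ^+ s * (b s)%:Z =
   \sum_(s < N) (-1) ^+ s * (a s)%:Z + \sum_(s < N) (-1) ^+ s * (c s)%:Z].
Proof.
move=> ac0; have [r [rle hb]] := betti_exact.
set b := (fun s : nat => _ : nat) in hb; exists b.
have bN s : (N <= s)%N -> b s = 0%N.
  by move=> /ac0 [a0 c0]; rewrite /b a0 c0 !sub0n.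
split=> //.
have H n : \sum_(s < n.+1) (-1) ^+ s * (b s)%:Z =
    \sum_(s < n.+1) (-1) ^+ s * (a s)%:Z + \sum_(s < n.+1) (-1) ^+ s * (c s)%:Z
    - (-1) ^+ n * (r n)%:Z.
  have Eb s : (b s)%:Z = (c s)%:Z - (r s)%:Z
      + ((a s)%:Z - (if s is s'.+1 then r s' else 0%N)%:Z).
    by have [h1 h2] := rle s; rewrite /b PoszD -!subzn.
  elim: n => [|n IH].
    rewrite !big_ord_recr !big_ord0 /= !add0r expr0 !mul1r Eb.
    by rewrite subr0 addrC addrA.
  rewrite big_ord_recr [in LHS]/= IH Eb.
  rewrite [\sum_(s < n.+2) (-1) ^+ s * (a s)%:Z]big_ord_recr.
  rewrite [\sum_(s < n.+2) (-1) ^+ s * (c s)%:Z]big_ord_recr /= exprS.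
  move: (\sum_(i < n.+1) _) (\sum_(i < n.+1) _) => x y.
  by ring.
have := H N; rewrite !big_ord_recr /= bN // !(proj1 (ac0 N _)) // !(proj2 (ac0 N _)) //.
have [rN _] := rle N; move: rN; rewrite (proj2 (ac0 N _)) // leqn0 => /eqP ->.
by rewrite !mulr0 ?oppr0 !addr0.
Qed.

End ShortExact.

End Complexes.

Arguments cx_cocycle {F V} D C s.
Arguments cx_coboundary {F V} D C s.

(** * The filtration of the coinduced complex *)

Section FunctionalExtension.
Variables (F : fieldType) (A : algType F) (V : lmodType A).
Variables (W : set V) (f : V -> F).
Hypothesis W0 : W 0.
Hypothesis WD : forall (c : F) x y, W x -> W y -> W (c%:A *: x + y).
Hypothesis fD : forall (c : F) x y, W x -> W y -> f (c%:A *: x + y) = c * f x + f y.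

(* Graphs of functionals extending f; the empty set is allowed because the union of
   the empty chain must be good. *)
Let good (G : set (V * F)) :=
  [/\ forall (c : F) x y, G x -> G y -> G (c%:A *: x.1 + y.1, c * x.2 + y.2),
      forall c, G (0, c) -> c = 0
    & forall x, G x -> forall w, W w -> G (w, f w)].

Let scaleA (c d : F) (x : V) : (c * d)%:A *: x = c%:A *: (d%:A *: x).
Proof. by rewrite scalerA mulr_algl scalerA. Qed.

Let f0 : f 0 = 0.
Proof.
have := fD 1 W0 W0; rewrite scaler0 addr0 mul1r => /eqP.
by rewrite -subr_eq subrr => /eqP.
Qed.

Let good_bigcup (C : set (set (V * F))) : C `<=` good -> total_on C subset ->
  good (\bigcup_(X in C) X).
Proof.
move=> Cgood Ctot; split.
- move=> c x y [X CX Xx] [Y CY Yy].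
  have [XY|YX] := Ctot _ _ CX CY.
    by exists Y => //; have [YD _ _] := Cgood _ CY; apply: YD => //; apply: XY.
  by exists X => //; have [XD _ _] := Cgood _ CX; apply: XD => //; apply: YX.
- by move=> c [X CX Xc]; have [_ X0 _] := Cgood _ CX; apply: X0.
- by move=> x [X CX Xx] w Ww; exists X => //; have [_ _ XW] := Cgood _ CX; apply: (XW x).
Qed.

Lemma functional_extension : exists g : V -> F,
  (forall (c : F) x y, g (c%:A *: x + y) = c * g x + g y) /\
  forall w, W w -> g w = f w.
Proof.
have [G [[GD G0 GW] Gmax]] := Zorn_bigcup good_bigcup.
have Gne : G (0, 0).
  have [h|nG] := pselect (exists x, G x).
    by have [x Gx] := h; have := GW x Gx 0 W0; rewrite f0.
  exfalso; pose H := [set x : V * F | W x.1 /\ x.2 = f x.1].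
  apply: (Gmax H).
    split; last by move=> /(_ (0, 0)) /= h; apply: nG; exists (0, 0); apply: h; rewrite /H /= f0.
    by move=> x Gx; exfalso; apply: nG; exists x.
  split.
  - by move=> c x y [Wx Ex] [Wy Ey]; split; [apply: WD | rewrite Ex Ey fD].
  - by move=> c [_ /= ->].
  - by move=> _ _ w Ww.
have GWf w : W w -> G (w, f w) by apply: GW Gne w.
have dom v : exists c, G (v, c).
  apply: contrapT => nv.
  (* The functional is extended to the line through [v] by the value 0 at [v], which contradicts
     maximality. *)
  pose H := [set x : V * F | exists a, G (x.1 - a%:A *: v, x.2)].
  have GH : G `<=` H.
    by move=> [x c] Gx; exists 0; rewrite scale0r scale0r subr0.
  apply: (Gmax H).
    split=> //; move=> HG; apply: nv; exists 0; apply: HG.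
    by exists 1; rewrite /= scale1r scale1r subrr.
  split.
  - move=> c x y [a Ga] [b Gb]; exists (c * a + b) => /=.
    have := GD c _ _ Ga Gb; rewrite /= scalerDl scalerDl scaleA.
    by rewrite opprD addrACA -scalerBr.
  - move=> c [a]; rewrite /= sub0r => Ga.
    have [a0|an0] := eqVneq a 0.
      by apply: G0; move: Ga; rewrite a0 scale0r scale0r oppr0.
    exfalso; apply: nv; exists (- a^-1 * c).
    have := GD (- a^-1) _ _ Ga Gne; rewrite /= !addr0 scalerN -scaleA mulNr mulVf //.
    by rewrite scaleN1r scaleN1r opprK.
  - by move=> x _ w /GWf /GH.
have /choice [g Hg] := dom; have guniq v c : G (v, c) -> g v = c.
  move=> Gc; have := GD (-1) _ _ Gc (Hg v) => /=.
  rewrite scaleN1r scaleN1r addNr mulN1r => /G0 /eqP.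
  by rewrite addrC subr_eq0 => /eqP.
exists g; split; first by move=> c x y; apply: guniq; exact: (GD c _ _ (Hg x) (Hg y)).
by move=> w /GWf /guniq.
Qed.

End FunctionalExtension.

Record right_ideal (F : fieldType) (A : algType F) := RightIdeal {
  ri_set :> A -> Prop;
  ri_mulr : forall u v, ri_set u -> ri_set (u * v)
}.

Section Coinduced.
Variables (F : fieldType) (A : algType F) (K : right_ideal A).

(* The submodule of the coinduced module Hom_F(A, F) formed by the functionals that
   vanish on K. *)
Definition coind_pred : {pred (A -> F^o)} :=
  fun f => `[< linear f /\ forall u, K u -> f u = 0 >].

Lemma coind_predP f : reflect (linear f /\ forall u, K u -> f u = 0) (f \in coind_pred).
Proof. exact: asboolP. Qed.

Lemma coind_zmod_closed : zmod_closed coind_pred.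
Proof.
split.
  by apply/coind_predP; split=> // c u v; rewrite -[RHS]/(c * 0 + 0 : F) mulr0 addr0.
move=> f g /coind_predP [lf f0] /coind_predP [lg g0]; apply/coind_predP; split.
  move=> c u v; rewrite -[LHS]/(f _ - g _ : F) lf lg.
  rewrite -[RHS]/(c * (f u - g u) + (f v - g v) : F) mulrBr opprD.
  by rewrite addrACA.
by move=> u Ku; rewrite -[LHS]/(f u - g u : F) f0 // g0 // subrr.
Qed.

HB.instance Definition _ := GRing.isZmodClosed.Build (A -> F^o) coind_pred coind_zmod_closed.

Definition coind : Type := {f : A -> F^o | f \in coind_pred}.
HB.instance Definition _ := SubChoice.on coind.
HB.instance Definition _ := [SubChoice_isSubZmodule of coind by <:].

Lemma coind_linear (f : coind) : linear (val f).
Proof. by have /coind_predP [] := valP f. Qed.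

Lemma coind_scale_proof (v : A) (f : coind) : (fun u => val f (u * v)) \in coind_pred.
Proof.
have /coind_predP [lf f0] := valP f; apply/coind_predP; split.
  by move=> c u w; rewrite mulrDl -scalerAl lf.
by move=> u Ku; apply: f0; apply: ri_mulr.
Qed.

Definition coind_scale (v : A) (f : coind) : coind :=
  exist (fun f => f \in coind_pred) _ (coind_scale_proof v f).

Let coind_ext (f g : coind) : (forall u, val f u = val g u) -> f = g.
Proof. by move=> E; apply: val_inj; apply: funext. Qed.

Let valDE (f g : coind) u : val (f + g) u = val f u + val g u.
Proof. by []. Qed.

Let coind_scaleA (v w : A) f : coind_scale v (coind_scale w f) = coind_scale (v * w) f.
Proof. by apply: coind_ext => u /=; rewrite mulrA. Qed.
Let coind_scale1 : left_id 1 coind_scale.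
Proof. by move=> f; apply: coind_ext => u /=; rewrite mulr1. Qed.
Let coind_scaleDr : right_distributive coind_scale +%R.
Proof. by move=> v f g; apply: coind_ext => u. Qed.
Let coind_scaleDl f : {morph coind_scale^~ f : v w / v + w}.
Proof.
move=> v w; apply: coind_ext => u; rewrite valDE /= mulrDr.
exact: (linD (coind_linear f)).
Qed.

HB.instance Definition _ := GRing.Zmodule_isLmodule.Build A coind
  coind_scaleA coind_scale1 coind_scaleDr coind_scaleDl.

Lemma coind_scaleE v (f : coind) u : val (v *: f) u = val f (u * v).
Proof. by []. Qed.

Lemma coind_addE (f g : coind) u : val (f + g) u = val f u + val g u.
Proof. by []. Qed.

End Coinduced.

Section LiftFunctional.
Variables (F : fieldType) (L : gradedLieType F) (M : lmodType (uea L)).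
Variables (K : right_ideal (uea L)) (b : uea L) (f0 : uea L -> F^o).
Hypothesis projM : projective M.
Hypothesis bK : forall u, augm u = 0 -> K (b * u).
Hypotheses (lf0 : linear f0) (f0K : forall u, K u -> f0 u = 0) (f0b : f0 b = 1).

(* f |-> f b maps [coind K] onto the trivial module; lift psi along this map, then
   evaluate at 1. *)
Lemma lift_functional (psi : M -> triv_mod L) : linear psi ->
  exists phi : M -> F^o,
    [/\ forall (c : F) x y, phi (c%:A *: x + y) = c * phi x + phi y,
        forall u x, K u -> phi (u *: x) = 0
      & forall x, phi (b *: x) = psi x].
Proof.
move=> lpsi.
pose ev (f : coind K) : triv_mod L := val f b.
have lev : linear ev.
  move=> v f g; rewrite /ev coind_addE coind_scaleE.
  rewrite -[RHS]/(augm v * val f b + val g b : F); congr (_ + _).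
  (* Modulo [K], [b * v] is [augm v] times [b]; thus evaluation at [b] is linear into the trivial
     module. *)
  have -> : b * v = b * (v - (augm v)%:A) + augm v *: b.
    by rewrite mulrBr mulr_algr subrK.
  have /coind_predP [lf fK] := valP f.
  rewrite (linD lf) (linZ lf) (fK (b * _)) ?add0r //.
  by apply: bK; rewrite (raddfB (@augm F L)) /= augm_scale subrr.
pose Ev : {linear coind K -> triv_mod L} := HB.pack ev (GRing.isLinear.Build _ _ _ _ ev lev).
pose Psi : {linear M -> triv_mod L} := HB.pack psi (GRing.isLinear.Build _ _ _ _ psi lpsi).
have f0P : f0 \in coind_pred K by apply/coind_predP.
have [|h hE] := projM (g := Ev) Psi.
  move=> c; exists (c%:A *: (exist (fun f => f \in coind_pred K) f0 f0P : coind K)).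
  by rewrite linearZ /= /ev /= f0b -[LHS]/(augm _ * 1) augm_scale mulr1.
exists (fun x => val (h x) 1); split.
- move=> c x y; rewrite linearP coind_addE coind_scaleE mul1r.
  by rewrite (linZ (coind_linear (h x))).
- move=> u x Ku; rewrite linearZ /= mul1r.
  by have /coind_predP [_ fK] := valP (h x); apply: fK.
- by move=> x; rewrite linearZ /= mul1r -[RHS](hE x).
Qed.

End LiftFunctional.

Section Filtration.
Variables (F : fieldType) (L : gradedLieType F) (P : graded_resolution L).
Local Notation U := (uea L).
Variable (p : nat -> U -> U).
Hypothesis hp : projections (@uea_homog F L) p.

Local Notation V := (fun s => P s -> F^o).

Definition fun_d s (f : P s -> F^o) : P s.+1 -> F^o := fun x => f (res_diff P s x).

Lemma fun_d_linear s : linear (@fun_d s).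
Proof. by []. Qed.

(* The functionals of degree t on P_s that vanish on K P_s.  For K = 0 they form
   Hom_U(P_s, Hom_F(U, F)), for K the augmentation ideal Hom_U(P_s, F). *)
Definition kill (K : set U) (t s : nat) : set (P s -> F^o) :=
  [set f | [/\ forall (c : F) x y, f (c%:A *: x + y) = c * f x + f y,
     forall n x, n != t -> @gres_homog _ _ P s n x -> f x = 0
   & forall u x, K u -> f (u *: x) = 0]].
Arguments kill : clear implicits.

Lemma kill_linear K t s f : kill K t s f ->
  [/\ f 0 = 0, forall x y, f (x + y) = f x + f y, forall c x, f (c%:A *: x) = c * f x
   & forall I (r : seq I) (Q : pred I) (h : I -> P s),
      f (\sum_(i <- r | Q i) h i) = \sum_(i <- r | Q i) f (h i)].
Proof.
move=> [lf _ _].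
have f0 : f 0 = 0.
  have := lf 1 0 0; rewrite scaler0 addr0 mul1r => /eqP.
  by rewrite -subr_eq subrr => /eqP.
have fD x y : f (x + y) = f x + f y.
  by have := lf 1 x y; rewrite scale1r scale1r mul1r.
split=> //.
  by move=> c x; have := lf c x 0; rewrite !addr0 f0 addr0.
move=> I r Q h; elim/big_rec2: _ => [//|i x y _ <-]; exact: fD.
Qed.

Lemma kill_subspace K t s : subspace (kill K t s).
Proof.
split.
  by split=> // c x y; rewrite -[RHS]/(c * 0 + 0 : F) mulr0 addr0.
move=> a f g [lf f0 fK] [lg g0 gK]; split.
- move=> c x y; rewrite -[LHS]/(a * f _ + g _ : F) lf lg.
  rewrite -[RHS]/(c * (a * f x + g x) + (a * f y + g y) : F).
  by rewrite !mulrDr !mulrA [a * c]mulrC addrACA.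
- by move=> n x nt hx; rewrite -[LHS]/(a * f _ + g _ : F) (f0 n) // (g0 n) // mulr0 addr0.
- by move=> u x Ku; rewrite -[LHS]/(a * f _ + g _ : F) fK // gK // mulr0 addr0.
Qed.

Lemma kill_subcomplex K t : subcomplex fun_d (kill K t).
Proof.
split; first exact: kill_subspace.
move=> s f hf; split; last first.
  by apply: funext => x; rewrite /fun_d res_dd; case: (kill_linear hf).
case: hf => [lf f0 fK]; split.
- by move=> c x y; rewrite /fun_d linearP lf.
- by move=> n x nt hx; apply: (f0 n) => //; apply: gres_homog_diff.
- by move=> u x Ku; rewrite /fun_d linearZ /= fK.
Qed.

Lemma kill_cochain t s : kill [set u | augm u = 0] t s = @cochain F L P s t.
Proof.
apply/seteqP; split=> f.
  move=> hf; have [f0 fD fZ _] := kill_linear hf; case: hf => lf foff fK; split=> //.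
  move=> u x y; rewrite fD; congr (_ + _).
  have {1}-> : u = (u - (augm u)%:A) + (augm u)%:A by rewrite subrK.
  rewrite scalerDl fD fK ?add0r; last first.
    by rewrite /= (raddfB (@augm F L)) /= augm_scale subrr.
  exact: fZ.
move=> [lf foff]; split=> //.
  move=> c x y; rewrite -[in RHS](@augm_scale F L c); exact: (lf c%:A x y).
by move=> u x /= u0; apply: etrans (triv_linearE lf _ _) _; rewrite u0 mul0r.
Qed.

Lemma kill_proj K t s f q : projections (@gres_homog _ _ P s) q ->
  kill K t s f -> forall x, f (q t x) = f x.
Proof.
move=> hq hf x; have [f0 fD fZ fsum] := kill_linear hf; have [_ foff _] := hf.
have [N xN] := proj_large hq x; pose M := maxn N t.+1.
have {2}-> : x = \sum_(i < M) q i x.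
  by apply: (proj_sum_le hq) => i; rewrite geq_max => /andP[? _]; apply: xN.
have tM : (t < M)%N by rewrite leq_max ltnSn orbT.
rewrite fsum (bigD1 (Ordinal tM)) //= big1 ?addr0 // => i it.
exact: (foff _ _ (it : (i : nat) != t) (proj_in hq _ _)).
Qed.

Lemma uea_homog_scalar (c : F) : uea_homog 0 (c%:A : U).
Proof. by apply: UeaHomogZ; apply: UeaHomog1. Qed.

(** [lift_functional] yields a lift without control of degrees. Its component of degree [m + t]
    still lifts [psi], since [b] has degree [m], and still vanishes on [K P], since [K] is stable
    under the projections [p n]. *)
Lemma kill_lift (K : set U) (b : U) m t s (psi : P s -> F^o) :
  (forall u v, K u -> K (u * v)) -> (forall n u, K u -> K (p n u)) ->
  (forall u, augm u = 0 -> K (b * u)) -> uea_homog m b ->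
  forall f0 : U -> F^o, linear f0 -> (forall u, K u -> f0 u = 0) -> f0 b = 1 ->
  kill [set u | augm u = 0] t s psi ->
  exists2 phi, kill K (m + t) s phi & forall x, phi (b *: x) = psi x.
Proof.
move=> Kr Kp bK hb f0 lf0 f0K f0b hpsi.
have [q hq] := gres_projections P s.
have hG := @gres_homogM F L P s.
have lpsi : linear (psi : P s -> triv_mod L) by have := hpsi; rewrite kill_cochain => -[].
have [phi [lphi phiK phib]] :=
  lift_functional (K := RightIdeal Kr) (@res_projectiveP _ _ P s) bK lf0 f0K f0b lpsi.
have phi0 : phi 0 = 0.
  have := lphi 1 0 0; rewrite scaler0 addr0 mul1r => /eqP.
  by rewrite -subr_eq subrr => /eqP.
have phiD x y : phi (x + y) = phi x + phi y.
  by have := lphi 1 x y; rewrite scale1r scale1r mul1r.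
exists (fun x => phi (q (m + t)%N x)); last first.
  by move=> x; rewrite (proj_act hq hG t x hb) phib; apply: (kill_proj hq hpsi).
split.
- move=> c x y; rewrite (projD hq) -lphi; congr (phi (_ + _)).
  exact: (proj_act hq hG (m + t) x (uea_homog_scalar c)).
- by move=> n x nt hx; rewrite (proj_ne hq hx) // eq_sym.
- move=> u x Ku; have [N Eu] := proj_sum hp u.
  rewrite {1}Eu scaler_suml (proj_bigsum hq).
  elim/big_rec: _ => [//|i y _ IH]; rewrite phiD IH addr0.
  have hi : uea_homog i (p i u) := proj_in hp i u.
  have [it|ti] := leqP i (m + t); last by rewrite (proj_act_lt hq hG x hi ti).
  by rewrite -{1}(subnKC it) (proj_act hq hG _ x hi); apply: phiK; apply: Kp.
Qed.

(* phi |-> phi (b _) yields the exact sequence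
   0 -> kill K' (m + t) -> kill K (m + t) -> kill U^+ t -> 0. *)
Lemma kill_step (K K' : set U) (b : U) m t N (a c : nat -> nat) :
  (forall u v, K u -> K (u * v)) -> (forall n u, K u -> K (p n u)) ->
  (forall u, augm u = 0 -> K (b * u)) -> uea_homog m b ->
  forall f0 : U -> F^o, linear f0 -> (forall u, K u -> f0 u = 0) -> f0 b = 1 ->
  K `<=` K' -> K' b -> (forall u, K' u -> exists k : F, K (u - k *: b)) ->
  betti fun_d (kill K' (m + t)) a -> betti fun_d (kill [set u | augm u = 0] t) c ->
  (forall s, (N <= s)%N -> a s = 0%N /\ c s = 0%N) ->
  exists d, [/\ betti fun_d (kill K (m + t)) d, forall s, (N <= s)%N -> d s = 0%N &
   \sum_(s < N) (-1) ^+ s * (d s)%:Z =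
   \sum_(s < N) (-1) ^+ s * (a s)%:Z + \sum_(s < N) (-1) ^+ s * (c s)%:Z].
Proof.
move=> Kr Kp bK hb f0 lf0 f0K f0b KK' K'b K'K ha hc ac0.
have hG s := @gres_homogM F L P s.
apply: (@euler_exact _ _ _ fun_d_linear (kill K' (m + t)) (kill K (m + t))
  (kill [set u | augm u = 0] t) (fun s (f : P s -> F^o) => (fun x => f (b *: x)) : P s -> F^o)
  _ _ _ _ _ _ _ _ _ a c ha hc N ac0) => //.
- exact: kill_subcomplex.
- exact: kill_subcomplex.
- exact: kill_subcomplex.
- by move=> s f; apply: funext => x; rewrite /fun_d linearZ.
- by move=> s f [lf foff fK]; split=> // u x /KK'; apply: fK.
- move=> s f [lf foff fK]; split.
  + move=> k x y; rewrite -lf scalerDr !scalerA; congr (f (_ *: _ + _)).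
    by rewrite mulr_algr mulr_algl.
  + move=> n x nt hx; apply: (foff (m + n)%N); last exact: hG.
    by rewrite eqn_add2l.
  + by move=> u x /= u0; rewrite scalerA; apply: fK; apply: bK.
- move=> s f hf; have [_ fD fZ _] := kill_linear hf; have [lf foff fK] := hf.
  split=> [fb|[_ _ fK']]; last by apply: funext => x; apply: fK'.
  split=> // u x /K'K [k Kuk].
  have -> : u = (u - k *: b) + k%:A * b by rewrite mulr_algl subrK.
  rewrite scalerDl fD fK // add0r -scalerA fZ.
  by rewrite -[f (b *: x)]/((fun x => f (b *: x)) x) fb mulr0.
- move=> s psi hpsi.
  have [phi hphi E] := kill_lift Kr Kp bK hb lf0 f0K f0b hpsi.
  by exists phi => //; apply: funext.
Qed.

End Filtration.

(** * The complex of all functionals of a fixed internal degree *)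

Section TopComplex.
Variables (F : fieldType) (L : gradedLieType F) (P : graded_resolution L).
Local Notation U := (uea L).
Variable (p : nat -> U -> U).
Hypothesis hp : projections (@uea_homog F L) p.

Definition trunc (t : nat) : set U := [set u | forall m, (m <= t)%N -> p m u = 0].

(** [trunc t] is the part of [U(L)] in degrees above [t]. As [P s] has no negative degrees, it
    carries [P s] into degrees above [t], where [f] vanishes; hence [kill (trunc t) t] contains
    every functional of degree [t]. *)
Lemma kill_trunc t s (f : P s -> F^o) :
  (forall (c : F) x y, f (c%:A *: x + y) = c * f x + f y) ->
  (forall n x, n != t -> @gres_homog _ _ P s n x -> f x = 0) ->
  kill (trunc t) t f.
Proof.
move=> lf foff; split=> // u x Ku.
have [q hq] := gres_projections P s; have hG := @gres_homogM F L P s.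
have h0 : kill set0 t f by split.
rewrite -(kill_proj hq h0); have [N Eu] := proj_sum hp u.
have [f0 _ _ _] := kill_linear h0.
rewrite Eu scaler_suml (proj_bigsum hq) big1 ?f0 // => i _.
have [it|ti] := leqP i t; first by rewrite Ku // scale0r (proj0 hq).
by rewrite (proj_act_lt hq hG x (proj_in hp i u) ti).
Qed.

Local Notation D := (@fun_d F L P).
Local Notation killT t := (@kill F L P (trunc t) t).

(** A cocycle factors through the image of the differential; the resulting functional extends to all
    of [P s] as over any field, and its part of degree [t] has the required coboundary. *)
Lemma kill_trunc_exact t s : cx_cocycle D (killT t) s.+1 `<=`
  cx_coboundary D (killT t) s.+1.
Proof.
move=> f [hf fd].
have [f0 fD fZ _] := kill_linear hf.
have fd0 y : f (res_diff P s.+1 y) = 0 by rewrite -[LHS]/(fun_d f y) fd.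
pose W : set (P s) := [set x | exists y, res_diff P s y = x].
have fwd x : exists c, forall y, res_diff P s y = x -> f y = c.
  have [[y Ey]|nx] := pselect (exists y, res_diff P s y = x); last first.
    by exists 0 => y Ey; exfalso; apply: nx; exists y.
  exists (f y) => y' Ey'.
  have [z Ez] : exists z, res_diff P s.+1 z = y' - y.
    by apply/res_exact; rewrite raddfB /= Ey Ey' subrr.
  by rewrite -[y'](subrK y) fD -Ez fd0 add0r.
have /choice [g Hg] := fwd.
have W0 : W 0 by exists 0; rewrite raddf0.
have WD (c : F) x y : W x -> W y -> W (c%:A *: x + y).
  move=> [x' <-] [y' <-]; exists (c%:A *: x' + y').
  by rewrite linearP.
have gD (c : F) x y : W x -> W y -> g (c%:A *: x + y) = c * g x + g y.
  move=> [x' Ex] [y' Ey]; rewrite -(Hg _ _ Ex) -(Hg _ _ Ey).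
  have [lf _ _] := hf; rewrite -lf; apply/esym/Hg.
  by rewrite linearP /= Ex Ey.
have [h [lh hW]] := functional_extension W0 WD gD.
have [q hq] := gres_projections P s; have [q' hq'] := gres_projections P s.+1.
have hG := @gres_homogM F L P s.
exists (fun x => h (q t x) : F^o).
  apply: kill_trunc.
    move=> c x y; rewrite (projD hq) -lh; congr (h (_ + _)).
    exact: (proj_act hq hG t x (uea_homog_scalar _ c)).
  move=> n x nt hx; rewrite (proj_ne hq hx) 1?eq_sym //.
  by have := lh 1 0 0; rewrite scaler0 addr0 mul1r => /eqP; rewrite -subr_eq subrr => /eqP.
apply: funext => x; rewrite /fun_d.
have -> : q t (res_diff P s x) = res_diff P s (q' t x).
  apply: (proj_shift (k := 0) (f := res_diff P s) hq' hq); first exact: raddfB.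
  by move=> n v; rewrite add0n; apply: gres_homog_diff.
rewrite hW; last by exists (q' t x).
by rewrite -(Hg _ (q' t x) erefl) (kill_proj hq' hf).
Qed.

(** A cocycle in homological degree 0 vanishes on the kernel of the augmentation, hence is a
    multiple of it, and the augmentation has internal degree 0. *)
Lemma kill_trunc0 t : has_dim (cx_cocycle D (killT t) 0)
  [set (0 : P 0%N -> F^o)] (t == 0%N).
Proof.
have [e Ee] := res_aug_surj P (1 : F).
have cocE f : cx_cocycle D (killT t) 0 f ->
    forall x, f x = f e * res_aug P x.
  move=> [hf fd] x; have [f0 fD fZ _] := kill_linear hf.
  have [y Ey] : exists y, res_diff P 0 y = x - (res_aug P x)%:A *: e.
    apply/res_exact0; rewrite raddfB /= linearZ /= Ee.
    rewrite -[X in _ - X]/(augm _ * 1) augm_scale mulr1.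
    exact: (subrr (res_aug P x : F)).
  have := congr1 f Ey; rewrite -[LHS]/(fun_d f y) fd.
  have [lf _ _] := hf.
  rewrite -[x - _]addrC -scaleNr -scaleNr lf => /eqP.
  by rewrite mulNr addrC eq_sym subr_eq0 => /eqP ->; rewrite mulrC.
case: eqP => [t0|/eqP t0] /=; last first.
  apply: has_dim_self; first exact: subspace0.
  move=> f hf; apply: funext => x; have [hf1 _] := hf.
  have [q hq] := gres_projections P 0.
  rewrite -(kill_proj hq hf1) (cocE f hf).
  by rewrite (gres_homog_aug t0 (proj_in hq t x)) mulr0.
pose g : P 0%N -> F^o := fun x => res_aug P x.
have gcoc : cx_cocycle D (killT t) 0 g.
  split; last by apply: funext => x; rewrite /fun_d /g res_aug_d.
  apply: kill_trunc => [c x y|n x]; rewrite /g.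
    rewrite linearP /= -[LHS]/(augm c%:A * res_aug P x + res_aug P y : F).
    by rewrite augm_scale.
  by rewrite t0 => n0 /(gres_homog_aug n0).
exists (fun=> g) => [//|f hf].
exists (\row_(i < 1) f e); split.
  apply/eqP; rewrite subr_eq0; apply/eqP; rewrite big_ord1 mxE; apply: funext => x.
  exact: cocE.
move=> r; rewrite big_ord1 => /subr0_eq E; apply/rowP => i; rewrite (ord1 i) mxE E.
exact: (etrans (congr1 (fun c : F => r 0 0 * c) Ee) (mulr1 (r 0 0))).
Qed.

Lemma betti_trunc t : betti D (killT t)
  (fun s => ((s == 0%N) && (t == 0%N) : bool) : nat).
Proof.
case=> [|s]; first exact: kill_trunc0.
apply: has_dim_self; last exact: kill_trunc_exact.
exact: (cx_coboundary_subspace (@fun_d_linear F L P) (kill_subcomplex P (trunc t) t)).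
Qed.

End TopComplex.

Section EulerCharacteristic.
Variables (F : fieldType) (L : gradedLieType F) (P : graded_resolution L).
Local Notation U := (uea L).
Local Notation D := (@fun_d F L P).
Variable (p : nat -> U -> U).
Hypothesis hp : projections (@uea_homog F L) p.
Variable h : nat -> nat.
Hypothesis hU : forall n, has_dim (@uea_homog F L n) [set 0] (h n).
Hypothesis FPinf : type_FP_infty (triv_mod L).
Variable N : nat.
Hypothesis extN : forall s t, (N <= s)%N ->
  has_dim (@cocycle F L P s t) (@coboundary F L P s t) 0.

(** By the vanishing of Ext for [s >= N], this is the coefficient of [y^t] in the characteristic
    polynomial; see [coef_lie_char_poly]. *)
Definition ext_euler (t : nat) : int := \sum_(s < N) (-1) ^+ s * (ext_dim P s t)%:Z.

(** [dim] is 0 by convention on infinite-dimensional quotients, so finiteness is what gives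
    [ext_dim] its meaning. *)
Lemma ext_dimE s t : has_dim (@cocycle F L P s t) (@coboundary F L P s t) (ext_dim P s t).
Proof.
have [d hd] := ext_finite P s t FPinf.
by rewrite /ext_dim (dimE (cocycle_subspace P s t) (coboundary_subspace P s t) hd).
Qed.

Lemma ext_dim0 s t : (N <= s)%N -> ext_dim P s t = 0%N.
Proof.
move=> Ns.
exact: (dimE (cocycle_subspace P s t) (coboundary_subspace P s t) (extN t Ns)).
Qed.

Lemma betti_ext t : betti D (@kill F L P [set u | augm u = 0] t) (ext_dim P ^~ t).
Proof.
move=> s.
have -> : cx_cocycle D (@kill F L P [set u | augm u = 0] t) s = @cocycle F L P s t.
  apply/seteqP; split=> f.
    move=> [hf fd]; split; first by rewrite -kill_cochain.
    by move=> y; rewrite -[LHS]/(fun_d f y) fd.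
  move=> [hf fd]; split; first by rewrite kill_cochain.
  by apply: funext.
have -> : cx_coboundary D (@kill F L P [set u | augm u = 0] t) s = @coboundary F L P s t.
  case: s => [//|s]; apply/seteqP; split=> g.
    by move=> [f hf <-]; exists f; rewrite -?kill_cochain.
  by move=> [f hf E]; exists f; rewrite ?kill_cochain //; apply: funext.
exact: ext_dimE.
Qed.

Let euler (b : nat -> nat) : int := \sum_(s < N) (-1) ^+ s * (b s)%:Z.

(* e is the Euler characteristic of kill K in degree t. *)
Let attained K t (e : int) := exists b, [/\ betti D (@kill F L P K t) b,
  forall s, (N <= s)%N -> b s = 0%N & euler b = e].

Lemma trunc0 : trunc p 0 = [set u | augm u = 0].
Proof.
apply/seteqP; split=> u.
  move=> /(_ 0%N (leqnn 0)) E.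
  by rewrite /= -(augm_scale L (augm u)) -(augm_proj0 u hp) E raddf0.
by move=> u0 m; rewrite leqn0 => /eqP ->; rewrite (augm_proj0 u hp) u0 scale0r.
Qed.

(* The right ideals K i of the proof form a flag from trunc j.+1 to trunc j, each
   obtained from the previous one by adding a basis vector of U_(j+1). *)
Lemma attained_trunc_step (q : nat -> L -> L) t j e : p = uproj q ->
  projections (homog : nat -> set L) q -> (j < t)%N ->
  attained (trunc p j) t e ->
  attained (trunc p j.+1) t (e + (h j.+1)%:Z * ext_euler (t - j.+1)).
Proof.
move=> Ep hq jt H0.
have sU := uea_homog_subspace L j.+1.
have /has_dim_coordinates := hU j.+1; case=> //; first exact: subspace0.
move=> c [lc sc kc].
pose K i : set U := [set u | (forall m, (m <= j)%N -> p m u = 0) /\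
  forall l : 'I_(h j.+1), (i <= l)%N -> c (p j.+1 u) 0 l = 0].
have lp n : linear (p n) by rewrite Ep; apply: (uproj_linear hq).
have lcp a u v : c (p j.+1 (a *: u + v)) = a *: c (p j.+1 u) + c (p j.+1 v).
  by rewrite lp lc //; apply: (proj_in hp).
have cp0 : c (p j.+1 0) = 0 by rewrite (proj0 hp) (linear_on0 sU lc).
have K0 : K 0%N = trunc p j.+1.
  apply/seteqP; split=> u.
    move=> [u0 uc] m; rewrite leq_eqVlt => /orP[/eqP ->|]; last exact: u0.
    apply/kc; first exact: (proj_in hp).
    by apply/rowP => l; rewrite mxE uc.
  move=> u0; split=> [m mj|l _]; first by apply: u0; apply: leqW.
  by rewrite u0 // (linear_on0 sU lc) mxE.
have Kh : K (h j.+1) = trunc p j.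
  apply/seteqP; split=> u; first by case.
  by move=> u0; split=> // l; rewrite leqNgt ltn_ord.
(* The flag is descended from [K (h j.+1) = trunc j]: each basis vector removed from the right ideal
   adds one copy of the Ext complex in internal degree [t - j.+1]. *)
suff H r : (r <= h j.+1)%N -> attained (K (h j.+1 - r)%N) t (e + r%:Z * ext_euler (t - j.+1)).
  by have := H _ (leqnn _); rewrite subnn K0.
elim: r => [_|r IH rh]; first by rewrite subn0 Kh mul0r addr0.
have [a [ha aN Ea]] := IH (ltnW rh).
pose i := (h j.+1 - r.+1)%N.
have ih : (i < h j.+1)%N by rewrite /i; apply: (leq_trans _ (leq_subr r _)); rewrite -subSn // subSS.
have Ei : (h j.+1 - r)%N = i.+1 by rewrite /i -subSn // subSS.
rewrite Ei in ha.
pose oi := Ordinal ih.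
have [b hb cb] := sc (delta_mx 0 oi).
have Et : t = (j.+1 + (t - j.+1))%N by rewrite subnKC.
rewrite Et in ha.
have pb m : (m <= j)%N -> p m b = 0.
  by move=> mj; apply: (proj_ne hp hb); rewrite ltn_eqF.
have [] := @kill_step F L P p hp (K i) (K i.+1) b j.+1 (t - j.+1) N a
  (ext_dim P ^~ (t - j.+1)%N) _ _ _ hb (fun u => c (p j.+1 u) 0 oi : F^o) _ _ _ _ _ _ ha
  (betti_ext _) _.
- move=> u v [u0 uc].
  have pM m : p m (u * v) = \sum_(i < m.+1) p i u * p (m - i)%N v by rewrite Ep (uprojM hq).
  split=> [m mj|l il].
    rewrite pM big1 // => k _; rewrite u0 ?mul0r //.
    by rewrite (leq_trans _ mj) // -ltnS.
  rewrite pM big_ord_recr /= big1 => [|k _]; last by rewrite u0 ?mul0r // -ltnS.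
  rewrite add0r subnn (augm_proj0 v hp) mulr_algr.
  by rewrite (linear_onZ sU lc) ?mxE ?uc ?mulr0 //; apply: (proj_in hp).
- move=> n u [u0 uc]; split=> [m mj|l il]; rewrite (projK hp).
    by rewrite u0 // if_same.
  by case: eqP => _; [apply: uc | rewrite (linear_on0 sU lc) mxE].
(* For [u] in the augmentation ideal, [b * u] has components only in degrees above [j.+1], hence
   lies in every [K i]. *)
- move=> u u0.
  have pM m : p m (b * u) = \sum_(i < m.+1) p i b * p (m - i)%N u by rewrite Ep (uprojM hq).
  have z m : (m <= j.+1)%N -> p m (b * u) = 0.
    move=> mj; rewrite pM big1 // => k _.
    have [kj|jk] := leqP k j; first by rewrite pb // mul0r.
    have -> : (m - k)%N = 0%N.
      by apply/eqP; rewrite subn_eq0 (leq_trans mj).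
    by rewrite (augm_proj0 u hp) u0 scale0r mulr0.
  split=> [m mj|l _]; first by apply: z; apply: leqW.
  by rewrite z // (linear_on0 sU lc) mxE.
- by move=> k u v; rewrite lcp !mxE.
- by move=> u [_ uc]; apply: uc.
- by rewrite (proj_id hp hb) cb mxE !eqxx.
- by move=> u [u0 uc]; split=> // l il; apply: uc; apply: ltnW.
- split=> // l il; rewrite (proj_id hp hb) cb mxE eqxx /=.
  by rewrite (_ : (l == oi) = false) //; apply/negbTE; rewrite -val_eqE /= gtn_eqF.
- move=> u [u0 uc]; exists (c (p j.+1 u) 0 oi); split=> [m mj|l il].
    by rewrite (linB (lp m)) (linZ (lp m)) u0 // pb // scaler0 subr0.
  rewrite (linB (lp _)) (linZ (lp _)) (proj_id hp hb).
  rewrite (linear_onB sU lc) ?(linear_onZ sU lc) //; last first.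
  + exact: subspaceZ.
  + exact: (proj_in hp).
  rewrite cb !mxE eqxx /=; move: il; rewrite leq_eqVlt => /orP[/eqP il|il].
    have -> : l = oi by apply: val_inj; rewrite /= -il.
    by rewrite eqxx mulr1 subrr.
  rewrite uc // (_ : (l == oi) = false) ?mulr0 ?subr0 //.
  by apply/negbTE; rewrite -val_eqE /= gtn_eqF.
- by move=> s Ns; split; [apply: aN | apply: ext_dim0].
move=> d [hd dN Ed]; exists d; split=> //; first by rewrite Et.
rewrite /euler Ed -/(euler a) Ea -[\sum_(s < N) _]/(ext_euler (t - j.+1)).
by rewrite -[r.+1]addn1 PoszD mulrDl mul1r addrA.
Qed.

Lemma attained_trunc (q : nat -> L -> L) t j : p = uproj q ->
  projections (homog : nat -> set L) q -> (j <= t)%N ->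
  attained (trunc p j) t (\sum_(m < j.+1) (h m)%:Z * ext_euler (t - m)).
Proof.
move=> Ep hq; elim: j => [_|j IH jt]; last first.
  by rewrite big_ord_recr; apply: (attained_trunc_step Ep hq jt (IH (ltnW jt))).
rewrite big_ord_recl big_ord0 addr0 subn0 trunc0.
have -> : h 0 = 1%N.
  exact: (has_dim_unique (uea_homog_subspace L 0) (subspace0 _) (hU 0%N) (has_dim_uea0 L)).
rewrite mul1r; exists (ext_dim P ^~ t); split=> //; first exact: betti_ext.
by move=> s; apply: ext_dim0.
Qed.

End EulerCharacteristic.

(** At [j = t] the filtration ends with all functionals of degree [t], whose Betti numbers
    [betti_trunc] provides; the two computations of the Euler characteristic are compared. [N] is
    positive so that the sum includes [s = 0]. *)
Lemma hilbert_ext_euler (F : fieldType) (L : gradedLieType F) (P : graded_resolution L)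
    (h : nat -> nat) (N t : nat) :
  (forall n, has_dim (@uea_homog F L n) [set 0] (h n)) ->
  type_FP_infty (triv_mod L) ->
  (forall s t, (N <= s)%N -> has_dim (@cocycle F L P s t) (@coboundary F L P s t) 0) ->
  (0 < N)%N ->
  \sum_(m < t.+1) (h m)%:Z * ext_euler P N (t - m) = (t == 0%N)%:R.
Proof.
move=> hU FP extN N0.
have [q hq] := lie_projections L; have hp := uproj_projections hq.
have [b [hb bN <-]] := attained_trunc hp hU FP extN erefl hq (leqnn t).
have hb' := betti_trunc P hp t.
have E s : b s = ((s == 0%N) && (t == 0%N) : bool) :> nat.
  apply: (has_dim_unique _ _ (hb s) (hb' s)).
    exact: (cx_cocycle_subspace (@fun_d_linear F L P) (kill_subcomplex P _ t)).
  exact: (cx_coboundary_subspace (@fun_d_linear F L P) (kill_subcomplex P _ t)).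
case: N N0 {extN bN} => // N _.
rewrite big_ord_recl /= E mul1r big1 ?addr0 //=; first by case: eqP.
by move=> i _; rewrite E mulr0.
Qed.

(** * Logarithmic derivatives and Moebius inversion *)

Section LogDerivative.
Variable R : comNzRingType.
Implicit Types (p q : {poly R}) (f g : nat -> R).

Definition power_series T f : {poly R} := \poly_(m < T.+1) (if m == 0%N then 0 else f m).

(* -X p' / p agrees with \sum_(m > 0) f m X^m up to degree T. *)
Definition log_derivative T p f := eqX T.+1 ('X * p^`()) (- (power_series T f) * p).

Lemma log_derivative1 T : log_derivative T 1 (fun=> 0).
Proof.
rewrite /log_derivative (_ : power_series T _ = 0).
  by rewrite -[1]/(1%:P) derivC mulr0 oppr0 mul0r.
by apply/polyP => i; rewrite coef_poly coef0 !if_same.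
Qed.

Lemma power_seriesD T f g :
  power_series T (fun m => f m + g m) = power_series T f + power_series T g.
Proof.
apply/polyP => i; rewrite coefD !coef_poly; case: ifP; last by rewrite addr0.
by case: ifP => //; rewrite addr0.
Qed.

Lemma log_derivativeM T p q f g : log_derivative T p f -> log_derivative T q g ->
  log_derivative T (p * q) (fun m => f m + g m).
Proof.
move=> Hp Hq; rewrite /log_derivative power_seriesD derivM mulrDr opprD mulrDl.
move=> i hi; rewrite !coefD; congr (_ + _).
  by rewrite !mulrA; apply: (eqXM Hp).
by rewrite (mulrCA 'X) (mulrCA (- power_series T g)); exact: (eqXMl p Hq hi).
Qed.

Lemma log_derivative_prod T (I : Type) (r : seq I) (p : I -> {poly R}) (f : I -> nat -> R) :
  (forall i, log_derivative T (p i) (f i)) ->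
  log_derivative T (\prod_(i <- r) p i) (fun m => \sum_(i <- r) f i m).
Proof.
move=> H; elim: r => [|i r IH].
  rewrite big_nil (_ : (fun m => _) = fun=> 0); first exact: log_derivative1.
  by apply: funext => m; rewrite big_nil.
rewrite big_cons (_ : (fun m => _) = fun m => f i m + \sum_(j <- r) f j m).
  exact: log_derivativeM.
by apply: funext => m; rewrite big_cons.
Qed.

Lemma log_derivativeX T p f n : log_derivative T p f ->
  log_derivative T (p ^+ n) (fun m => f m *+ n).
Proof.
move=> H; rewrite -[n]card_ord -prodr_const.
have := log_derivative_prod (index_enum 'I_n) (fun=> H).
rewrite (_ : (fun m => _) = fun m => f m *+ #|'I_n|) // card_ord.
by apply: funext => m; rewrite big_const_ord iter_addr_0.
Qed.

(** The series is [k a X^k / (1 - a X^k) = \sum_(j >= 1) k a^j X^(k j)]. *)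
Lemma log_derivative_1BXn T k (a : R) : (0 < k)%N ->
  log_derivative T (1 - a *: 'X^k) (fun m => if (k %| m)%N then a ^+ (m %/ k) *+ k else 0).
Proof.
move=> k0 i hi; rewrite mulNr coefN mulrBr mulr1 coefB -scalerAr coefZ coefMXn coef_poly hi.
rewrite coefXM coef_deriv coefB coef1 coefZ coefXn.
case: i hi => [|i] hi; first by rewrite eqxx k0 mulr0 subr0 oppr0.
rewrite /= sub0r; have [ik|ki|ik] := ltngtP i.+1 k.
- by rewrite gtnNdvd // mulr0 oppr0 mul0rn addr0 oppr0.
- have j0 : (i.+1 - k == 0)%N = false by rewrite subn_eq0 leqNgt ki.
  rewrite coef_poly (leq_ltn_trans (leq_subr _ _) hi) j0 mulr0 oppr0 mul0rn.
  rewrite (dvdn_subl (ltnW ki) (dvdnn k)).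
  case: ifP => kd; rewrite ?mulr0 ?subr0 ?oppr0 //.
  have -> : (i.+1 %/ k = ((i.+1 - k) %/ k).+1)%N.
    by rewrite -{1}(subnK (ltnW ki)) divnDr ?dvdnn // divnn k0 addn1.
  by rewrite exprS mulrnAr subrr oppr0.
- rewrite -ik dvdnn divnn subnn coef_poly /= mulr1 mulr0 subr0 expr1.
  by rewrite mulNrn.
Qed.

(** The factor [X] keeps the truncation order: coefficient [i] of [X p'] is [i] times that of [p].
    So the difference of the two series times [p] is congruent to 0, and the constant term 1 lets
    [p] be cancelled degree by degree. *)
Lemma log_derivative_unique T p q f g : eqX T.+1 p q -> p`_0 = 1 ->
  log_derivative T p f -> log_derivative T q g ->
  forall m, (0 < m <= T)%N -> f m = g m.
Proof.
move=> pq p0 Hp Hq.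
have E : eqX T.+1 ((power_series T f - power_series T g) * p) 0.
  move=> i hi; rewrite mulrBl coefB coef0.
  have -> : (power_series T g * p)`_i = (power_series T g * q)`_i by apply: eqXMl hi.
  have := Hp i hi; have := Hq i hi; rewrite !mulNr !coefN !coefXM !coef_deriv.
  case: i hi => [|i] hi /=.
    move=> /esym/eqP; rewrite oppr_eq0 => /eqP -> /esym/eqP.
    by rewrite oppr_eq0 => /eqP ->; rewrite subr0.
  by rewrite pq // => -> /oppr_inj ->; rewrite subrr.
have Z m : (m <= T)%N -> (power_series T f - power_series T g)`_m = 0.
  elim/ltn_ind: m => m IH mT; have := E m mT; rewrite coefM coef0 big_ord_recr /= subnn p0 mulr1.
  rewrite big1 ?add0r // => i _; rewrite IH ?mul0r //.
  by rewrite (leq_trans _ mT) // ltnW.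
move=> m /andP[m0 mT]; have := Z m mT; rewrite coefB !coef_poly !ltnS mT.
by rewrite -(prednK m0) /= => /subr0_eq.
Qed.

End LogDerivative.

(** * Moebius inversion *)

Lemma moebius_mul_prime p d : prime p -> (0 < d)%N -> ~~ (p %| d)%N ->
  moebius (p * d) = - moebius d.
Proof.
move=> pp d0 pd; have p0 := prime_gt0 pp.
have Hp : perm_eq (primes (p * d)) (p :: primes d).
  apply: uniq_perm; first exact: primes_uniq.
    by rewrite /= primes_uniq mem_primes (negbTE pd) !andbF.
  by move=> q; rewrite primesM // primes_prime // !inE.
rewrite /moebius (perm_all _ Hp) (perm_size Hp) /=.
have lp : logn p (p * d) = 1%N.
  by rewrite lognM // logn_prime // eqxx (lognE p d) (negbTE pd) !andbF.
rewrite lp eqxx /=.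
have -> : all (fun q => logn q (p * d) == 1%N) (primes d) =
    all (fun q => logn q d == 1%N) (primes d).
  apply: eq_in_all => q; rewrite mem_primes => /and3P[pq _ qd].
  rewrite lognM // logn_prime // (_ : (q == p) = false) //.
  by apply: contraNF pd => /eqP <-.
by case: ifP => _; rewrite ?oppr0 // exprS mulN1r.
Qed.

Lemma moebius_sq_dvd p d : prime p -> (0 < d)%N -> (p ^ 2 %| d)%N -> moebius d = 0.
Proof.
move=> pp d0 pd; rewrite /moebius ifF //; apply/negbTE/allPn.
have pl : (2 <= logn p d)%N by rewrite -pfactor_dvdn.
exists p; first by rewrite mem_primes pp d0 (dvdn_trans _ pd) // dvdn_exp.
by rewrite gtn_eqF.
Qed.

(* For a prime p dividing n the terms of d and p * d cancel when p does not divide d,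
   and the terms of the multiples of p ^ 2 vanish. *)
Lemma sum_moebius n : (0 < n)%N -> \sum_(d <- divisors n) moebius d = (n == 1%N)%:R.
Proof.
move=> n0; have [->|n1] := eqVneq n 1%N; first by rewrite big_seq1.
have pp : prime (pdiv n) by apply: pdiv_prime; case: n n0 n1 => [|[]].
set p := pdiv n in pp; have p0 := prime_gt0 pp.
have pn : (p %| n)%N := pdiv_dvd n.
rewrite (bigID (fun d => p %| d)%N) /=.
rewrite (bigID (fun d => p ^ 2 %| d)%N) /= big_seq_cond big1 ?add0r; last first.
  move=> d; rewrite -dvdn_divisors // => /and3P[dn pd p2d].
  by apply: moebius_sq_dvd p2d => //; apply: dvdn_gt0 dn.
rewrite -big_filter -[X in _ + X]big_filter.
rewrite (perm_big [seq (p * d)%N | d <- [seq d <- divisors n | ~~ (p %| d)%N]]) /=.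
  rewrite big_map -big_split /= big_seq big1 // => d.
  rewrite mem_filter -dvdn_divisors // => /andP[pd dn].
  by rewrite moebius_mul_prime ?addNr //; apply: dvdn_gt0 dn.
apply: uniq_perm.
- by rewrite filter_uniq // divisors_uniq.
- rewrite map_inj_uniq ?filter_uniq ?divisors_uniq // => a b /eqP.
  by rewrite eqn_pmul2l // => /eqP.
move=> d; apply/idP/mapP.
  rewrite mem_filter -dvdn_divisors // => /andP[/andP[/dvdnP [e ->] p2] dn].
  exists e; last by rewrite mulnC.
  rewrite mem_filter -dvdn_divisors // (dvdn_trans _ dn) ?dvdn_mulr // andbT.
  by move: p2; rewrite expnS expn1 dvdn_pmul2r.
move=> [e]; rewrite mem_filter -dvdn_divisors // => /andP[pe en] ->.
rewrite mem_filter -dvdn_divisors // dvdn_mulr // expnS expn1 dvdn_pmul2l // pe /=.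
by rewrite Gauss_dvd ?pn // prime_coprime.
Qed.

(** The formula for [f] is assumed at the divisors of [n] only, because the power sums will be known
    only up to a finite degree. *)
Lemma moebius_inversion (R : comNzRingType) (f g : nat -> R) n : (0 < n)%N ->
  (forall m, (m %| n)%N -> f m = \sum_(k <- divisors m) g k) ->
  \sum_(j <- divisors n) (moebius (n %/ j))%:~R * f j = g n.
Proof.
move=> n0 H.
have Ef j : (j %| n)%N -> f j = \sum_(k <- divisors n | (k %| j)%N) g k.
  move=> jn; have j0 := dvdn_gt0 n0 jn.
  rewrite H // -[RHS]big_filter; apply: perm_big; apply: uniq_perm.
  - exact: divisors_uniq.
  - by rewrite filter_uniq // divisors_uniq.
  - move=> k; rewrite mem_filter -!dvdn_divisors //.
    by case: (boolP (k %| j)%N) => //= kj; rewrite (dvdn_trans kj).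
have -> : \sum_(j <- divisors n) (moebius (n %/ j))%:~R * f j =
    \sum_(j <- divisors n) \sum_(k <- divisors n)
      (if (k %| j)%N then (moebius (n %/ j))%:~R * g k else 0).
  rewrite big_seq [RHS]big_seq; apply: eq_bigr => j; rewrite -dvdn_divisors // => jn.
  by rewrite Ef // mulr_sumr big_mkcond; apply: eq_bigr => k _; case: ifP; rewrite ?mulr0.
rewrite exchange_big /= big_seq.
(* The coefficient of [g k] sums [moebius (n / j)] over [j] with [k | j | n]; the substitution
   [j |-> n / j] makes this the sum of [moebius] over the divisors of [n / k]. *)
have E k : (k %| n)%N ->
    \sum_(j <- divisors n) (if (k %| j)%N then (moebius (n %/ j))%:~R * g k else 0) =
    (k == n)%:R * g k.
  move=> kn; have k0 := dvdn_gt0 n0 kn.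
  rewrite -big_mkcond -mulr_suml -big_filter; congr (_ * _).
  have nk0 : (0 < n %/ k)%N by rewrite divn_gt0 // dvdn_leq.
  have -> : (k == n) = (n %/ k == 1)%N.
    by rewrite [RHS]eq_sym eqn_div // mul1n.
  rewrite -[RHS](rmorph_nat (intr : int -> R)) -(sum_moebius nk0) rmorph_sum /=.
  rewrite -(big_map (fun j => n %/ j)%N xpredT (fun d => (moebius d)%:~R)).
  apply: perm_big; apply: uniq_perm.
  - rewrite map_inj_in_uniq ?filter_uniq ?divisors_uniq // => a b.
    rewrite !mem_filter -!dvdn_divisors // => /andP[_ an] /andP[_ bn] Eab.
    have a0 := dvdn_gt0 n0 an; have b0 := dvdn_gt0 n0 bn.
    have Ea : (n %/ b * a = n %/ b * b)%N by rewrite -{1}Eab (divnK an) (divnK bn).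
    have nb0 : (0 < n %/ b)%N by rewrite divn_gt0 // (dvdn_leq n0 bn).
    by apply/eqP; rewrite -(eqn_pmul2l nb0) Ea.
  - exact: divisors_uniq.
  - move=> d; rewrite -dvdn_divisors //; apply/mapP/idP.
      move=> [j]; rewrite mem_filter -dvdn_divisors // => /andP[/dvdnP [c ->] /dvdnP [e En]] ->.
      have ck0 : (0 < c * k)%N by move: n0; rewrite En muln_gt0 => /andP[].
      by rewrite En mulnK // mulnA mulnK // dvdn_mulr.
    move=> /dvdnP [e Ee].
    have En : n = (e * d * k)%N by rewrite -Ee divnK.
    have d0 : (0 < d)%N by move: n0; rewrite En !muln_gt0 => /andP[/andP[]].
    have e0 : (0 < e)%N by move: n0; rewrite En !muln_gt0 => /andP[/andP[]].
    exists (e * k)%N; last by rewrite En mulnAC mulKn // muln_gt0 e0.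
    by rewrite mem_filter -dvdn_divisors // dvdn_mull //= En mulnAC dvdn_mulr.
rewrite (eq_bigr (fun k => (k == n)%:R * g k)) => [|k]; last first.
  by rewrite -dvdn_divisors // => /E.
rewrite -big_seq (bigD1_seq n) ?divisors_uniq //=; last by rewrite -dvdn_divisors.
by rewrite eqxx mul1r big1 ?addr0 // => k /negbTE ->; rewrite mul0r.
Qed.

(** * The characteristic polynomial and the dimension formula *)

Lemma coef_lie_char_poly (F : fieldType) (L : gradedLieType F) (P : graded_resolution L) N t :
  (forall s t, (N <= s)%N -> ext_dim P s t = 0%N) -> lie_char_poly P != 0 ->
  (lie_char_poly P)`_t = ext_euler P N t.
Proof.
move=> extN; rewrite /lie_char_poly => nz.
(* A sum with infinite support is 0 by convention, so a nonzero value guarantees finite support. *)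
have [X X0] : exists X : seq (nat * nat),
    forall st, st \notin X -> char_term P st = 0.
  move: nz; case: finite_supportP => [_|X _ X0 _ _]; first by rewrite big_nil eqxx.
  by exists X => st; apply: X0.
have [M [tM XM]] : exists M, (t < M)%N /\ forall st, st \in X -> (st.2 < M)%N.
  exists (maxn t (\max_(st <- X) st.2)).+1; split; first by rewrite ltnS leq_maxl.
  move=> st h; rewrite ltnS leq_max; apply/orP; right.
  exact: (leq_bigmax_seq (F := fun x : nat * nat => x.2) st h isT).
(* A rectangle containing the support and all [(s, t)] with [s < N]; the coefficient of [X^t]
   selects the terms with [m = t]. *)
pose r := [seq (s, m) | s <- iota 0 N, m <- iota 0 M].
rewrite (fsbigE r) //=; last 2 first.
- by rewrite allpairs_uniq ?iota_uniq // => -[a b] [a' b'].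
- move=> [s m] _ h; have [Ns|sN] := leqP N s.
    by rewrite /char_term extN //= mulr0 scale0r.
  apply: X0; apply: contra h => h; apply/allpairsP; exists (s, m); split=> //=.
    by rewrite mem_iota.
  by rewrite mem_iota; apply: (XM (s, m)).
rewrite (eq_bigl xpredT) => [|i]; last by rewrite in_setT.
rewrite big_allpairs coef_sum /ext_euler.
rewrite -(big_mkord xpredT (fun s => (-1) ^+ s * (ext_dim P s t)%:Z)) /index_iota subn0.
apply: eq_bigr => s _; rewrite coef_sum.
rewrite (bigD1_seq t) ?iota_uniq //=; last by rewrite mem_iota.
rewrite /char_term /= coefZ coefXn eqxx mulr1 big1 ?addr0 // => m mt.
by rewrite coefZ coefXn eq_sym (negbTE mt) mulr0.
Qed.

(** With [H] the Hilbert polynomial and [Q] the product [lie_poly T d], [chi] is congruent to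
    [chi (H Q) = (H chi) Q], hence to [Q]; no inverse of [H] has to be formed. *)
Lemma lie_char_poly_eqX (F : fieldType) (L : gradedLieType F) (P : graded_resolution L) T :
  type_FP L -> lie_char_poly P != 0 ->
  exists d : nat -> nat,
    (forall k, (0 < k <= T)%N -> has_dim (homog k : set L) [set 0] (d k)) /\
    eqX T.+1 (lie_char_poly P) (lie_poly T d).
Proof.
move=> [FPinf FPfin] nz.
have [N extN] := ext_vanish P FPfin.
(* The bound is raised by one because [hilbert_ext_euler] requires it to be positive. *)
have extN' s t : (N.+1 <= s)%N ->
    has_dim (@cocycle F L P s t) (@coboundary F L P s t) 0.
  by move=> h; apply: extN; apply: ltnW.
have /choice [h hU] := uea_homog_finite FPinf.
have [d [hd Ed]] := hilbert_mul_lie_poly T hU.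
exists d; split=> //.
have Echi : eqX T.+1 (hilbert_poly T h * lie_char_poly P) 1.
  move=> i hi; rewrite coefM coef1 -(hilbert_ext_euler i hU FPinf extN') //.
  apply: eq_bigr => j _; rewrite coef_poly.
  have -> : (j < T.+1)%N by apply: leq_ltn_trans hi; rewrite -ltnS.
  by rewrite (coef_lie_char_poly _ (N := N.+1)) // => s t; apply: ext_dim0.
have E1 := eqXMl (lie_char_poly P) Ed; rewrite mulr1 in E1.
have E2 := eqXM Echi (@eqX_refl _ T.+1 (lie_poly T d)); rewrite mul1r in E2.
apply: (eqX_trans (eqX_sym E1)).
by rewrite mulrCA mulrA.
Qed.

Lemma log_derivative_roots (R : comNzRingType) T n (lam : 'I_n -> R) :
  log_derivative T (\prod_(i < n) (1 - lam i *: 'X)) (fun m => \sum_(i < n) lam i ^+ m).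
Proof.
apply: log_derivative_prod => i.
have := @log_derivative_1BXn R T 1 (lam i) isT; rewrite expr1.
by rewrite (_ : (fun m => _) = GRing.exp (lam i)) //; apply: funext => m; rewrite dvd1n divn1.
Qed.

Lemma log_derivative_lie_poly (R : comNzRingType) T (d : nat -> nat) :
  log_derivative T (map_poly (intr : int -> R) (lie_poly T d))
    (fun m => \sum_(k < T) if (k.+1 %| m)%N then (k.+1 * d k.+1)%:R else 0).
Proof.
rewrite /lie_poly rmorph_prod /=.
rewrite (_ : (fun m => _) = fun m => \sum_(k < T)
    (if (k.+1 %| m)%N then 1 ^+ (m %/ k.+1) *+ k.+1 else 0) *+ d k.+1); last first.
  apply: funext => m; apply: eq_bigr => k _; case: ifP; rewrite ?mul0rn //.
  by rewrite expr1n natrM mulr_natr.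
apply: log_derivative_prod => k; rewrite rmorphXn /= rmorphB /= rmorph1 map_polyXn.
apply: log_derivativeX; rewrite -['X^_]scale1r.
exact: log_derivative_1BXn.
Qed.

Theorem theoremD (R : realType) (F : fieldType) (L : gradedLieType F)
    (hFP : type_FP L) (P : graded_resolution L)
    (n : nat) (hn : size (lie_char_poly P) = n.+1) (lam : 'I_n -> R[i])
    (hlam : map_poly intr (lie_char_poly P) = \prod_(i < n) (1 - lam i *: 'X))
    (k : nat) (hk : (0 < k)%N) :
  exists2 d : nat, has_dim (homog k : set L) [set 0] d &
    d%:R = \sum_(i < n) (map_poly ratr (necklace k)).[lam i].
Proof.
(* The size [n.+1] excludes the conventional value 0, so the sum defining the polynomial has finite
   support. *)
have nz : lie_char_poly P != 0 by rewrite -size_poly_eq0 hn.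
have [d [hd E]] := lie_char_poly_eqX k hFP nz.
exists (d k); first by apply: hd; rewrite hk leqnn.
have EC : eqX k.+1 (\prod_(i < n) (1 - lam i *: 'X)) (map_poly intr (lie_poly k d)).
  by rewrite -hlam => i hi; rewrite !coef_map /= E.
have A0 : (\prod_(i < n) (1 - lam i *: 'X))`_0 = 1.
  rewrite -horner_coef0 horner_prod big1 // => i _.
  by rewrite hornerD hornerN hornerZ hornerC hornerX mulr0 subr0.
(* A divisor of [k] is at most [k], so the congruence modulo [X^(k+1)] determines its power sum. *)
have Hp m : (m %| k)%N ->
    \sum_(i < n) lam i ^+ m = \sum_(j <- divisors m) ((j * d j)%N%:R : R[i]).
  move=> mk; have m0 := dvdn_gt0 hk mk; have mlek := dvdn_leq hk mk.
  rewrite (log_derivative_unique EC A0 (@log_derivative_roots _ k n lam)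
    (@log_derivative_lie_poly _ k d)) ?m0 //.
  rewrite -(big_mkord xpredT (fun j => if (j.+1 %| m)%N then ((j.+1 * d j.+1)%N%:R : R[i]) else 0)).
  rewrite -(big_add1 _ _ 0 k.+1 xpredT (fun j => if (j %| m)%N then ((j * d j)%N%:R : R[i]) else 0)).
  rewrite -big_mkcond -big_filter; apply: perm_big; apply: uniq_perm.
  - by rewrite filter_uniq // iota_uniq.
  - exact: divisors_uniq.
  - move=> j; rewrite mem_filter mem_index_iota -dvdn_divisors //.
    case: (boolP (j %| m)%N) => //= jm.
    by rewrite (dvdn_gt0 m0 jm) ltnS (leq_trans (dvdn_leq m0 jm)).
have k0 : (k%:R : R[i]) != 0 by rewrite pnatr_eq0 -lt0n.
have Einv := moebius_inversion hk Hp.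
(* Multiplication by [k], invertible in characteristic 0, clears the denominator of the necklace
   polynomial; Moebius inversion gives [k * d k]. *)
apply: (mulfI k0); rewrite -natrM -Einv.
rewrite mulr_sumr.
have Eneck i : k%:R * (map_poly ratr (necklace k)).[lam i] =
    \sum_(j <- divisors k) (moebius (k %/ j))%:~R * lam i ^+ j.
  rewrite /necklace map_polyZ hornerZ fmorphV /= ratr_nat mulrA divff // mul1r.
  rewrite rmorph_sum horner_sum; apply: eq_bigr => j _.
  by rewrite /= map_polyZ hornerZ map_polyXn hornerXn /= ratr_int.
rewrite (eq_bigr _ (fun i _ => Eneck i)) exchange_big /=.
by apply: eq_bigr => j _; rewrite mulr_sumr.
Qed.
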